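(* Fix $n\geq 1$ and let $T$ be an automorphism of a standard probability Borel space $(X,\mathcal{B},\mu)$. Assume that, for each $g\in L^2(X,\mathcal{B},\mu)$, there exist a sequence $(k_j)_{j\geq 1}$ of positive integers going to infinity and a sequence $(S_j)_{j\geq 1}$ of weakly mixing automorphisms such that, for every $j$, $T$ is a factor of the Cartesian power $S_j^{\times k_j}$, and moreover $$\mathrm{dist}\bigl(g,L^2(\mathcal{F}_{k_j}(S_j))\bigr)=o\left(\frac{1}{k_j^{n/2}}\right)\quad\text{as } j\to\infty.$$ Then $T$ is disjoint from every automorphism with the JP($n$) property.
   Context: An automorphism is an invertible measure-preserving transformation of a standard probability Borel space. For an automorphism $S$ of $(Y,\mathcal{C},\nu)$ and $k\geq 1$, the symmetric factor $\mathcal{F}_k(S)$ of $S^{\times k}$ is the sub-$\sigma$-algebra of $\mathcal{C}^{\otimes k}$ consisting of all sets invariant under permutations of the $k$ coordinates. When $T$ is a factor of $S^{\times k}$, $L^2(X,\mathcal{B},\mu)$ is regarded as a subspace of $L^2(Y^{k},\mathcal{C}^{\otimes k},\nu^{\otimes k})$ via the factor map; $L^2(\mathcal{F}_k(S))$ is the subspace of $\mathcal{F}_k(S)$-measurable functions, and $\mathrm{dist}$ is the distance in this $L^2$ space. For automorphisms $T$ of $(X,\mathcal{B},\mu)$ and $S$ of $(Y,\mathcal{C},\nu)$, $J(T,S)$ is the set of $T\times S$-invariant probability measures on $X\times Y$ with marginals $\mu$ and $\nu$, and $J^e(T,S)$ is the subset of ergodic ones. $T$ and $S$ are disjoint if $J(T,S)=\{\mu\otimes\nu\}$.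 JP($n$) (joining primeness of order $n\ge 1$): an ergodic automorphism $R$ of $(Z,\mathcal{D},\rho)$ has the JP($n$) property if for any $k\geq n+1$, any weakly mixing automorphisms $S_i$ of standard probability Borel spaces $(Y_i,\mathcal{C}_i,\nu_i)$, $1\leq i\leq k$, and every $\lambda\in J^e(R,S_1\times\dots\times S_k)$, there exist indices $i_1,\dots,i_n\in\{1,\dots,k\}$ such that $\lambda=\lambda_{Z,Y_{i_1},\dots,Y_{i_n}}\otimes\bigotimes_{j\notin\{i_1,\dots,i_n\}}\nu_j$, where $\lambda_{Z,Y_{i_1},\dots,Y_{i_n}}$ is the projection of $\lambda$ on the product of the corresponding coordinate spaces. *)

(* Defs.v *)
From HB Require Import structures.
From mathcomp Require Import all_boot all_order all_algebra perm.
From mathcomp Require Import all_classical all_reals all_analysis.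

Set Implicit Arguments.
Unset Strict Implicit.
Unset Printing Implicit Defensive.
Import Order.TTheory GRing.Theory Num.Theory.
Import numFieldNormedType.Exports.

Local Open Scope classical_set_scope.
Local Open Scope ring_scope.

(* MathComp-Analysis has no product of a family of measurable types (only
   binary products and n.-tuple); [prodspace Y] is the dependent product with
   the sigma-algebra generated by the coordinate maps. *)

Definition measure_family_display (I : Type) (d : I -> measure_display) :
  measure_display.
Proof. exact: default_measure_display. Qed.

Section product_space.
Context {I : Type} {d : I -> measure_display}.
Variable Y : forall i, measurableType (d i).

Definition prodspace : Type := forall i, Y i.

HB.instance Definition _ := gen_eqMixin prodspace.
HB.instance Definition _ := gen_choiceMixin prodspace.
HB.instance Definition _ := isPointed.Build prodspace (fun=> point).

Definition cylinders : set_system prodspace :=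
  \bigcup_(i in [set: I])
    preimage_set_system [set: prodspace] (fun y => y i) measurable.

Let prodspace0 : <<s cylinders >> set0.
Proof. exact: sigma_algebra0. Qed.

Let prodspaceC A : <<s cylinders >> A -> <<s cylinders >> (~` A).
Proof. exact: sigma_algebraC. Qed.

Let prodspace_bigcup (F : (set prodspace)^nat) :
  (forall i, <<s cylinders >> (F i)) -> <<s cylinders >> (\bigcup_i F i).
Proof. exact: sigma_algebra_bigcup. Qed.

HB.instance Definition _ := @isMeasurable.Build (measure_family_display d)
  prodspace <<s cylinders >> prodspace0 prodspaceC prodspace_bigcup.

Lemma measurable_coord i : measurable_fun [set: prodspace] (fun y => y i).
Proof.
move=> _ B mB; apply: sub_sigma_algebra.
by exists i => //; exists B.
Qed.

Lemma measurable_prodspaceP d' (X : measurableType d') (f : X -> prodspace) :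
  (forall i, measurable_fun [set: X] (fun x => f x i)) ->
  measurable_fun [set: X] f.
Proof.
move=> mf; apply: (@measurability _ _ X prodspace setT f cylinders) => //.
move=> _ [_ [i _ [B mB <-]] <-].
by have := mf i measurableT B mB; rewrite !setTI.
Qed.

End product_space.

Section product_probability.
Context {I : finType} {d : I -> measure_display} {R : realType}.
Variables (Y : forall i, measurableType (d i))
          (nu : forall i, probability (Y i) R).

Definition resample i (p : prodspace Y * Y i) : prodspace Y :=
  dfwith p.1 i p.2.

Lemma measurable_resample i : measurable_fun setT (@resample i).
Proof.
apply: measurable_prodspaceP => j; case: (eqVneq i j) => [ij|ij].
  subst j; apply: (eq_measurable_fun snd) => // x _.
  by rewrite /resample dfwithin.
apply: (eq_measurable_fun (fun x : prodspace Y * Y i => x.1 j)).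
  by move=> x _; rewrite /resample dfwithout.
exact: (measurableT_comp (@measurable_coord _ _ Y j) measurable_fst).
Qed.

HB.instance Definition _ i :=
  isMeasurableFun.Build _ _ _ _ (@resample i) (@measurable_resample i).

(* Start from any point and replace its coordinates, one after the other, by
   independent samples of the nu i; see prod_probE. *)
Definition prod_prob : probability (prodspace Y) R :=
  foldr (fun i (m : probability (prodspace Y) R) =>
    distribution (m \x nu i)%E (@resample i) : probability (prodspace Y) R)
    (dirac (point : prodspace Y) : probability (prodspace Y) R) (enum I).

Lemma prod_probE (A : forall i, set (Y i)) : (forall i, measurable (A i)) ->
  prod_prob [set y | forall i, A i (y i)] = (\prod_(i : I) fine (nu i (A i)))%:E.
Proof.
move=> mA.
have mrect (s : seq I) :
    measurable [set y : prodspace Y | forall i, i \in s -> A i (y i)].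
  elim: s => [|i s ih].
    rewrite (_ : [set _ | _] = setT); first exact: measurableT.
    by apply/seteqP; split.
  rewrite (_ : [set _ | _] = (fun y : prodspace Y => y i) @^-1` A i `&`
      [set y : prodspace Y | forall i, i \in s -> A i (y i)]); last first.
    apply/seteqP; split => [y Ay|y [Ai As] j].
      split=> [|j js]; apply: Ay; first by rewrite /= mem_head.
      by rewrite in_cons js orbT.
    by rewrite in_cons => /orP[/eqP ->//|]; exact: As.
  apply: measurableI => //; rewrite -[X in measurable X]setTI.
  exact: measurable_coord.
rewrite (_ : [set _ | _] = [set y | forall i, i \in enum I -> A i (y i)]);
  last by apply/seteqP; split=> y Ay i => [_|]; apply: Ay; rewrite ?mem_enum.
rewrite -(big_enum _ _) /prod_prob /=.
elim: (enum I) (enum_uniq I) => [_|i s ih /= /andP[iNs us]].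
  by rewrite big_nil /= diracE mem_set.
rewrite big_cons /distribution /pushforward.
rewrite (_ : _ @^-1` _ =
    [set y : prodspace Y | forall i, i \in s -> A i (y i)] `*` A i); last first.
  apply/seteqP; split=> [[y z]|[y z] [/= Ay Az] j]; rewrite /resample /=.
    move=> Ay; split=> [j js|] /=.
      have := Ay j; rewrite in_cons js orbT dfwithout; first exact.
      by apply: contraNneq iNs => ->.
    by have := Ay i; rewrite mem_head dfwithin; exact.
  rewrite in_cons => /orP[/eqP -> /=|js /=]; first by rewrite dfwithin.
  by rewrite dfwithout; [exact: Ay|apply: contraNneq iNs => ->].
rewrite product_measure1E//= ih// muleC EFinM fineK//.
exact: fin_num_measure.
Qed.

End product_probability.

(* Every Polish space is complete for some metric compatible with its topology;
   <<s open >> is its Borel sigma-algebra. *)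
Definition standard_borel (R : realType) d (X : measurableType d) : Prop :=
  exists (M : metricType R) (phi : X -> M),
    [/\ forall F : set_system M, ProperFilter F -> cauchy F ->
          exists x : M, F --> x,
        exists2 D : set M, countable D & dense D,
        bijective phi
      & @measurable _ X =
          preimage_set_system [set: X] phi <<s @open M >>].

(* The data (X, B, mu, T); no condition is imposed on the map. *)
Record system (R : realType) := System {
  sys_display : measure_display;
  sys_space :> measurableType sys_display;
  sys_prob : probability sys_space R;
  sys_map : sys_space -> sys_space }.

Definition invertible d (X : measurableType d) (f : X -> X) : Prop :=
  exists f' : X -> X,
    [/\ cancel f f', cancel f' f, measurable_fun [set: X] f
      & measurable_fun [set: X] f'].

Definition invariant_measure (R : realType) d (X : measurableType d)
    (mu : set X -> \bar R) (f : X -> X) : Prop :=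
  forall A, measurable A -> mu (f @^-1` A) = mu A.

Definition automorphism (R : realType) (T : system R) : Prop :=
  [/\ standard_borel R T, invertible (@sys_map R T)
    & invariant_measure (sys_prob T) (@sys_map R T)].

Definition ergodic (R : realType) d (X : measurableType d)
    (mu : set X -> \bar R) (f : X -> X) : Prop :=
  forall A, measurable A -> f @^-1` A = A -> mu A = 0%E \/ mu A = 1%E.

Definition system_pair (R : realType) (T S : system R) : system R :=
  System (sys_prob T \x sys_prob S : probability (T * S)%type R)%E
    (fun p : T * S => (sys_map p.1, sys_map p.2)).

Definition system_prod (R : realType) (I : finType) (S : I -> system R) :
    system R :=
  System (prod_prob (fun i => sys_prob (S i)))
    (fun y : prodspace S => (fun i => sys_map (y i)) : prodspace S).

Definition system_power (R : realType) (S : system R) (k : nat) : system R :=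
  system_prod (fun _ : 'I_k => S).

Definition weakly_mixing (R : realType) (S : system R) : Prop :=
  ergodic (sys_prob (system_pair S S)) (@sys_map R (system_pair S S)).

Definition factor_map (R : realType) (S T : system R) (p : S -> T) : Prop :=
  [/\ measurable_fun [set: S] p,
      forall A, measurable A -> sys_prob S (p @^-1` A) = sys_prob T A
    & {ae sys_prob S, forall y, p (sys_map y) = sys_map (p y)}].

Definition joining (R : realType) (T S : system R)
    (lambda : probability (T * S)%type R) : Prop :=
  [/\ forall A, measurable A -> lambda (fst @^-1` A) = sys_prob T A,
      forall B, measurable B -> lambda (snd @^-1` B) = sys_prob S B
    & invariant_measure lambda (@sys_map R (system_pair T S))].

Definition ergodic_joining (R : realType) (T S : system R)
    (lambda : probability (T * S)%type R) : Prop :=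
  joining lambda /\ ergodic lambda (@sys_map R (system_pair T S)).

(* Measures are compared on measurable sets only: nothing is prescribed on the
   value of a measure at a non-measurable set. *)
Definition disjoint_systems (R : realType) (T S : system R) : Prop :=
  forall lambda : probability (T * S)%type R,
    joining lambda <->
    forall A, measurable A -> lambda A = (sys_prob T \x sys_prob S)%E A.

Section coordinate_splitting.
Context {R : realType} {I : finType}.
Variables (Z : system R) (S : I -> system R).

(* The projection to the coordinate of Z and those in P. *)
Definition proj_coords (P : pred I) (p : Z * prodspace S) :
    Z * prodspace (fun i : {i | P i} => S (val i)) :=
  (p.1, fun i => p.2 (val i)).

Lemma measurable_proj_coords P : measurable_fun setT (proj_coords P).
Proof.
apply: measurable_fun_pair; first exact: measurable_fst.
apply: measurable_prodspaceP => i.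
exact: (measurableT_comp (@measurable_coord _ _ S (val i)) measurable_snd).
Qed.

HB.instance Definition _ P :=
  isMeasurableFun.Build _ _ _ _ (proj_coords P) (@measurable_proj_coords P).

(* The identification of Z * \prod_i S i with
   (Z * \prod_(i | P i) S i) * \prod_(i | ~~ P i) S i. *)
Definition split_coords (P : pred I) (p : Z * prodspace S) :
    (Z * prodspace (fun i : {i | P i} => S (val i))) *
    prodspace (fun i : {i | ~~ P i} => S (val i)) :=
  (proj_coords P p, fun i => p.2 (val i)).

Definition independent_outside (P : pred I)
    (lambda : probability (Z * prodspace S)%type R) : Prop :=
  forall A, measurable A ->
    lambda (split_coords P @^-1` A) =
    (distribution lambda (proj_coords P) \x
     prod_prob (fun i : {i | ~~ P i} => sys_prob (S (val i))))%E A.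

End coordinate_splitting.

Definition JP (R : realType) (n : nat) (Z : system R) : Prop :=
  [/\ automorphism Z, ergodic (sys_prob Z) (@sys_map R Z)
    & forall (k : nat) (S : 'I_k -> system R), (n.+1 <= k)%N ->
        (forall i, automorphism (S i) /\ weakly_mixing (S i)) ->
        forall lambda : probability (Z * system_prod S)%type R,
          ergodic_joining lambda ->
          exists i : n.-tuple 'I_k,
            independent_outside (fun j => j \in i) lambda].

Definition symmetric_factor (R : realType) (S : system R) (k : nat) :
    set_system (system_power S k) :=
  [set A | measurable A /\
    forall s : 'S_k,
      (fun y : prodspace (fun _ : 'I_k => S) => (fun i => y (s i)) :
        prodspace (fun _ : 'I_k => S)) @^-1` A = A].

Section L2_distance.
Context {R : realType} {d : measure_display} {X : measurableType d}.
Variable mu : probability X R.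

Definition L2_sub (G : set_system X) : set (X -> R) :=
  [set f | f \in Lfun mu 2%:E /\
           preimage_set_system [set: X] f measurable `<=` G].

Definition L2_dist (f : X -> R) (E : set (X -> R)) : R :=
  fine (ereal_inf [set 'N[mu]_2%:E[EFin \o (f \- h)%R]%E | h in E]).

End L2_distance.

(* Main.v *)
(* Let lam be a joining of T and Z, and D, A measurable subsets of T and Z.
   Choose a symmetric h close in L2 to the indicator of the pull-back of D to a
   power S^k of which T is a factor, with k large.  The relatively independent
   extension of lam over the factor map gives a joining of Z and S^k.  Among all
   joinings of Z and S^k, an extreme point of those giving maximal mass to the
   product of A and the pull-back of D is an ergodic joining (as Z and S^k are
   ergodic, conditioning on an invariant set again gives a joining), so JP(n)
   applies to it: the conditional probability of A given S^k is a function a of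
   n coordinates only.  As h is symmetric, a may be replaced in the integral of
   a h by the average of its k cyclic shifts, whose variance is at most n^2/k
   since shifts with disjoint supports are independent.  Hence
   lam(D x A) <= mu(D) rho(A) up to an arbitrarily small error, and equality
   follows by taking complements.

   Compactness of the set of joinings is obtained by ultralimits of biadditive
   set functions; such a function is a measure as soon as its marginals are and
   one of the two factors is standard Borel. *)
From HB Require Import structures.
Require Import Defs.
From mathcomp Require Import all_boot all_order all_algebra perm.
From mathcomp Require Import all_classical all_reals all_analysis.
From mathcomp Require Import measurable_realfun.
From mathcomp Require Import ring lra.
Import Order.TTheory GRing.Theory Num.Theory.
Import numFieldNormedType.Exports.

Set Implicit Arguments.
Unset Strict Implicit.
Unset Printing Implicit Defensive.

Local Open Scope classical_set_scope.
Local Open Scope ring_scope.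

(** JP(n) concerns ergodic joinings, whereas the relatively independent extension need not be
    ergodic. Maximization plays the part of an ergodic decomposition: the new joining need not
    project to the given one, but it charges the chosen rectangle at least as much, so an upper
    bound for it bounds the given joining too. Hence the argument proves an inequality, for one
    rectangle and one error at a time, with a power S^k chosen accordingly.

    Joinings are handled through their values on rectangles, so that limits can be taken pointwise;
    domination by the marginals preserves countable additivity in each variable. Since the spaces
    are countably generated, extremality is tested on countably many rectangles, and it is reached
    by maximizing these evaluations one after another.

    Ergodicity always enters through one principle: an invariant set function dominated by an
    ergodic measure is a multiple of it.

    The final error is 2 delta + e + n^2/(k e): delta is paid each time the indicator and h are
    exchanged, and the rest comes from bounding an L1 norm by e/2 plus the variance over 2e. *)

Section means.
Context {R : realType}.
Implicit Types (a b : nat -> R) (M L : (nat -> R) -> R).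

(** * Means of bounded sequences: ultralimits and Banach limits *)

Definition bounded_seq a := exists K : R, forall n, `|a n| <= K.

Lemma bounded_seqD a b : bounded_seq a -> bounded_seq b ->
  bounded_seq (fun n => a n + b n).
Proof.
move=> [K aK] [K' bK']; exists (K + K') => n.
by rewrite (le_trans (ler_normD _ _))// lerD.
Qed.

Lemma bounded_seqZ c a : bounded_seq a -> bounded_seq (fun n => c * a n).
Proof.
by move=> [K aK]; exists (`|c| * K) => n; rewrite normrM ler_wpM2l.
Qed.

Lemma bounded_seq_cst c : bounded_seq (fun=> c).
Proof. by exists `|c|. Qed.

Lemma bounded_seq01 a : (forall n, 0 <= a n <= 1) -> bounded_seq a.
Proof. by move=> a01; exists 1 => n; have /andP[? ?] := a01 n; rewrite ger0_norm. Qed.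

Record is_mean M : Prop := IsMean {
  meanD : forall a b, bounded_seq a -> bounded_seq b ->
    M (fun n => a n + b n) = M a + M b;
  meanZ : forall c a, bounded_seq a -> M (fun n => c * a n) = c * M a;
  mean_le : forall a b, bounded_seq a -> bounded_seq b ->
    (forall n, a n <= b n) -> M a <= M b;
  mean_cst : forall c, M (fun=> c) = c }.

(** Limit along an ultrafilter finer than [\oo]; bounded sequences converge along it by compactness
    of a segment. Since an eventual inequality is enough for monotonicity, [L] ignores finitely many
    terms. *)
Lemma exists_ultralimit : exists L, is_mean L /\
  forall a b, bounded_seq a -> bounded_seq b ->
    (\forall n \near \oo, a n <= b n) -> L a <= L b.
Proof.
have [U [UU FU]] := @ultraFilterLemma nat \oo _.
pose L (a : nat -> R) : R := lim (a @ U).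
have Lcvg a : bounded_seq a -> a @ U --> L a.
  move=> [K aK]; suff : cvg (a @ U) by [].
  have := @segment_compact R (- K) K; rewrite compact_ultra => /(_ (a @ U)).
  case.
  - split; first exact: fmap_proper_filter.
    move=> G GF aG; apply/seteqP; split=> [A GA|]; last exact: aG.
    have [//|UA] := in_ultra_setVsetC (a @^-1` A) UU.
    suff : G set0 by move/filter_not_empty.
    by rewrite -(setICr A); apply: filterI => //; exact: aG.
  - rewrite /nbhs /=; apply: filterS filterT => n _ /=.
    by rewrite in_itv /= -ler_norml.
  - by move=> l [_ al]; apply/cvg_ex; exists l.
have Lle a b : bounded_seq a -> bounded_seq b ->
    (\forall n \near \oo, a n <= b n) -> L a <= L b.
  move=> ba bb ab; apply: (ler_cvg_to (Lcvg _ ba) (Lcvg _ bb)).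
  exact: FU.
exists L; split => //; split.
- move=> a b ba bb; apply/cvg_lim => //; apply: cvgD; exact: Lcvg.
- move=> c a ba; apply/cvg_lim => //; apply: cvgZr; exact: Lcvg.
- by move=> a b ba bb ab; apply: Lle => //; exists 0%N => // n _ /=.
- by move=> c; apply/cvg_lim => //; exact: cvg_cst.
Qed.

(** A Banach limit: the ultralimit of the Cesaro averages. The averages of a sequence and of its
    shift differ by (a_(n+1) - a_0)/(n+1), which tends to 0. *)
Lemma exists_invariant_mean : exists M, is_mean M /\
  forall a, bounded_seq a -> M (fun n => a n.+1) = M a.
Proof.
have [L [mL Lle]] := exists_ultralimit.
pose C a n : R := n.+1%:R^-1 * \sum_(i < n.+1) a i.
have bC a : bounded_seq a -> bounded_seq (C a).
  move=> [K aK]; exists K => n; rewrite /C normrM ger0_norm ?invr_ge0//.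
  rewrite ler_pdivrMl ?ltr0n// (le_trans (ler_norm_sum _ _ _))//.
  rewrite mulr_natl -[X in _ *+ X]card_ord -sumr_const.
  by apply: ler_sum => i _; exact: aK.
exists (fun a => L (C a)); split.
  split.
  - move=> a b ba bb; rewrite -(meanD mL (bC _ ba) (bC _ bb)); congr L.
    by apply/funext => n; rewrite /C big_split mulrDr.
  - move=> c a ba; rewrite -(meanZ mL c (bC _ ba)); congr L.
    by apply/funext => n; rewrite /C -mulr_sumr mulrCA.
  - move=> a b ba bb ab; apply: (mean_le mL) => // [||n]; [exact: bC..|].
    by rewrite /C ler_wpM2l ?invr_ge0//; apply: ler_sum.
  - move=> c; rewrite -[RHS](mean_cst mL c); congr L; apply/funext => n.
    by rewrite /C sumr_const card_ord -[X in _ * X]mulr_natl mulKf// pnatr_eq0.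
move=> a ba; have [K aK] := ba.
have b1 : bounded_seq (fun n => a n.+1) by exists K => n.
have bN : bounded_seq (fun n => -1 * C a n) by apply: bounded_seqZ; exact: bC.
apply/eqP; rewrite -subr_eq0 -mulN1r -(meanZ mL (-1) (bC _ ba)).
rewrite -(meanD mL (bC _ b1) bN); set d := (fun n => _).
have bd : bounded_seq d by apply: bounded_seqD => //; exact: bC.
have K0 : 0 <= K by rewrite (le_trans _ (aK 0%N)).
have dE n : `|d n| <= n.+1%:R^-1 * (K + K).
  rewrite /d mulN1r /C -mulrBr normrM ger0_norm ?invr_ge0//.
  rewrite ler_wpM2l ?invr_ge0//.
  rewrite -sumrB -(big_mkord xpredT (fun i => a i.+1 - a i)) telescope_sumr//.
  by rewrite (le_trans (ler_normB _ _))// lerD.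
apply/eqP/le_anti/andP; split; apply/ler_addgt0Pl => e e0.
  rewrite addr0 -[leRHS](mean_cst mL); apply: Lle => //.
    exact: bounded_seq_cst.
  near=> n; apply: (le_trans (ler_norm _)); apply: (le_trans (dE n)).
  rewrite ler_pdivrMl// -ler_pdivrMr//; rewrite (@le_trans _ _ n%:R)// ?ler_nat//.
  by near: n; exact: nbhs_infty_ger.
rewrite -lerBlDl sub0r -[leLHS](mean_cst mL); apply: Lle => //.
  exact: bounded_seq_cst.
near=> n; rewrite lerNl (le_trans (ler_norm _))// normrN.
apply: (le_trans (dE n)).
rewrite ler_pdivrMl// -ler_pdivrMr//; rewrite (@le_trans _ _ n%:R)// ?ler_nat//.
  by near: n; exact: nbhs_infty_ger.
Unshelve. all: by end_near. Qed.

End means.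

(** * Finitely additive set functions dominated by a probability *)

Section additive_below.
Context {d} {X : measurableType d} {R : realType}.
Implicit Types (P : probability X R) (f : set X -> R) (A B : set X).

(** Domination by [P] upgrades finite additivity to countable additivity, while both conditions
    survive limits taken set by set. *)
Definition additive_below P f : Prop :=
  (forall A, measurable A -> 0 <= f A <= fine (P A)) /\
  (forall A B, measurable A -> measurable B -> A `&` B = set0 ->
    f (A `|` B) = f A + f B).

Variables (P : probability X R) (f : set X -> R).
Hypothesis fP : additive_below P f.

(** Set to 0 off the measurable sets, where nothing is known about [f], because a measure must be
    nonnegative on every set. *)
Let below : set X -> \bar R :=
  fun A => (if `[< measurable A >] then f A else 0)%:E.

Let belowE A : measurable A -> below A = (f A)%:E.
Proof. by move=> mA; rewrite /below asboolT. Qed.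

Lemma additive_below0 : f set0 = 0.
Proof.
have [+ _] := fP => /(_ _ measurable0); rewrite measure0 /=.
by move=> ?; apply/le_anti; rewrite andbC.
Qed.

Lemma additive_belowD A B : measurable A -> measurable B -> B `<=` A ->
  f (A `\` B) = f A - f B.
Proof.
move=> mA mB BA; rewrite -{2}(setDUK BA) fP.2 ?setDIK//.
  by rewrite addrC addKr.
exact: measurableD.
Qed.

Lemma additive_belowC A : measurable A -> f (~` A) = f setT - f A.
Proof. by move=> mA; rewrite -setTD additive_belowD. Qed.

Lemma le_additive_below A B : measurable A -> measurable B -> A `<=` B ->
  f A <= f B.
Proof.
move=> mA mB AB; rewrite -subr_ge0 -additive_belowD//.
by have /andP[] := fP.1 _ (measurableD mB mA).
Qed.

Let below0 : below set0 = 0%E.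
Proof. by rewrite belowE// additive_below0. Qed.

Let below_ge0 A : (0 <= below A)%E.
Proof.
rewrite /below lee_fin; case: asboolP => // mA.
by have /andP[] := fP.1 _ mA.
Qed.

Let below_sum (F : (set X)^nat) n : (forall i, measurable (F i)) ->
  trivIset setT F ->
  f (\big[setU/set0]_(i < n) F i) = \sum_(i < n) f (F i).
Proof.
move=> mF tF; elim: n => [|n ih]; first by rewrite !big_ord0 additive_below0.
rewrite !big_ord_recr/= fP.2 ?ih//; first exact: bigsetU_measurable.
rewrite -(bigcup_mkord n F) setI_bigcupl bigcup0// => i /= ni.
by move/trivIsetP : tF; apply => //; rewrite neq_ltn ni.
Qed.

(** With U the union of the [F n], the difference f(U) - f(F n) is f(U \ F n), at most P(U \ F n),
    which tends to 0. *)
Lemma additive_below_cvg (F : (set X)^nat) : (forall i, measurable (F i)) ->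
  nondecreasing_seq F -> f (F n) @[n --> \oo] --> f (\bigcup_n F n).
Proof.
move=> mF ndF; have mU := bigcupT_measurable F mF.
have cP : fine (P (F n)) @[n --> \oo] --> fine (P (\bigcup_n F n)).
  apply: fine_cvg; rewrite fineK ?fin_num_measure//.
  exact: nondecreasing_cvg_mu.
have c0 : f (\bigcup_n F n) - (fine (P (\bigcup_n F n)) - fine (P (F n)))
    @[n --> \oo] --> f (\bigcup_n F n).
  rewrite -[X in _ --> X]subr0; apply: cvgB; first exact: cvg_cst.
  rewrite -(subrr (fine (P (\bigcup_n F n)))).
  by apply: cvgB => //; exact: cvg_cst.
apply: (squeeze_cvgr _ c0 (cvg_cst _)); near=> n.
have FU : F n `<=` \bigcup_n F n by exact: bigcup_sup.
rewrite le_additive_below// andbT lerBlDr -lerBlDl -additive_belowD//.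
have /andP[_ /le_trans] := fP.1 _ (measurableD mU (mF n)); apply.
rewrite measureD ?(setIidr FU) ?ltey_eq ?fin_num_measure//=.
by rewrite fineB ?fin_num_measure.
Unshelve. all: by end_near. Qed.

Lemma additive_below_cvg_bigcap (F : (set X)^nat) :
  (forall i, measurable (F i)) -> nonincreasing_seq F ->
  f (F n) @[n --> \oo] --> f (\bigcap_n F n).
Proof.
move=> mF niF; have mI := bigcapT_measurable mF.
have := @additive_below_cvg (fun n => ~` F n) (fun n => measurableC (mF n)).
have ndF : nondecreasing_seq (fun n => ~` F n).
  by move=> m n mn; apply/subsetPset/subsetC/subsetPset; exact: niF.
move=> /(_ ndF); rewrite -setC_bigcap additive_belowC// => h.
have -> : f (\bigcap_n F n) = f setT - (f setT - f (\bigcap_n F n)) by ring.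
have -> : (fun n => f (F n)) = (fun n => f setT - f (~` F n)).
  by apply/funext => n; rewrite additive_belowC//; ring.
by apply: cvgB => //; exact: cvg_cst.
Qed.

Let below_sigma_additive : semi_sigma_additive below.
Proof.
move=> F mF tF mUF; rewrite belowE//.
have fE n : (\sum_(0 <= i < n) below (F i))%E =
    (f (\big[setU/set0]_(i < n) F i))%:E.
  rewrite below_sum// big_mkord sumEFin; congr EFin.
  by apply: eq_bigr => i _; rewrite /below asboolT.
under eq_fun do rewrite fE.
apply: cvg_EFin => //; first exact: nearW.
rewrite -(cvg_shiftS (fine \o _)) -bigcup_bigsetU_bigcup.
apply: additive_below_cvg => [i|]; first exact: bigsetU_measurable.
move=> m n mn; apply/subsetPset; rewrite -!(bigcup_mkord _ F).
by apply: bigcup_subset => i /= /leq_trans; apply.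
Qed.

HB.instance Definition _ := isMeasure.Build _ _ _ below
  below0 below_ge0 below_sigma_additive.

Let below_fin : fin_num_fun below.
Proof. by move=> A mA; rewrite belowE. Qed.

HB.instance Definition _ := Measure_isFinite.Build _ _ _ below below_fin.

Lemma additive_below_measure : exists m : {finite_measure set X -> \bar R},
  forall A, measurable A -> m A = (f A)%:E.
Proof. by exists below; exact: belowE. Qed.

End additive_below.

Section additive_below_theory.
Context {d} {X : measurableType d} {R : realType}.
Implicit Types (P Q : probability X R) (f g : set X -> R) (A B C : set X).

Lemma fine_probability_le1 P A : measurable A -> 0 <= fine (P A) <= 1.
Proof.
move=> mA; rewrite fine_ge0//= -lee_fin fineK ?fin_num_measure//.
exact: probability_le1.
Qed.

Lemma additive_below_probability P : additive_below P (fun A => fine (P A)).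
Proof.
split=> [A mA|A B mA mB AB0]; first by rewrite lexx fine_ge0.
by rewrite measureU// fineD ?fin_num_measure.
Qed.

Lemma additive_belowI P f C : measurable C -> additive_below P f ->
  additive_below P (fun A => f (A `&` C)).
Proof.
move=> mC fP; split=> [A mA|A B mA mB AB0].
  have mAC : measurable (A `&` C) by exact: measurableI.
  have /andP[-> _] := fP.1 _ mAC.
  rewrite (le_trans (le_additive_below fP mAC mA _))//.
  by have /andP[] := fP.1 _ mA.
rewrite setIUl fP.2//; [exact: measurableI..|].
by rewrite setIACA AB0 set0I.
Qed.

Lemma additive_belowZ P f c : 0 <= c <= 1 -> additive_below P f ->
  additive_below P (fun A => c * f A).
Proof.
move=> /andP[c0 c1] fP; split=> [A mA|A B mA mB AB0]; last by rewrite fP.2// mulrDr.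
have /andP[fA0 fAP] := fP.1 _ mA; rewrite mulr_ge0//=.
by rewrite (le_trans _ fAP)// ler_piMl.
Qed.

Lemma additive_below_preimage d' (Y : measurableType d') (Q : probability Y R) P
    f (h : X -> Y) : measurable_fun setT h ->
  (forall E, measurable E -> P (h @^-1` E) = Q E) -> additive_below P f ->
  additive_below Q (fun E => f (h @^-1` E)).
Proof.
move=> mh hPQ fP; have mpre E : measurable E -> measurable (h @^-1` E).
  by move=> mB; rewrite -[X in measurable X]setTI; exact: mh.
split=> [E mE|E F mE mF EF0]; first by rewrite -hPQ//; exact/fP.1/mpre.
rewrite preimage_setU fP.2//; [exact: mpre..|].
by rewrite -preimage_setI EF0 preimage_set0.
Qed.

Lemma additive_below_mean P (M : (nat -> R) -> R) (f : nat -> set X -> R) :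
  is_mean M -> (forall n, additive_below P (f n)) ->
  additive_below P (fun A => M (f ^~ A)).
Proof.
move=> meanM fP; have bf A : measurable A -> bounded_seq (f ^~ A).
  move=> mA; apply: bounded_seq01 => n; have /andP[-> /le_trans->//] := (fP n).1 _ mA.
  by have /andP[] := fine_probability_le1 P mA.
split=> [A mA|A B mA mB AB0].
  rewrite -{1}(mean_cst meanM 0) -(mean_cst meanM (fine (P A))).
  apply/andP; split; apply: mean_le => //; try exact: bounded_seq_cst.
  - exact: bf.
  - by move=> n; have /andP[] := (fP n).1 _ mA.
  - exact: bf.
  - by move=> n; have /andP[] := (fP n).1 _ mA.
by rewrite -meanD//; [congr M; apply/funext => n; exact: (fP n).2|exact: bf..].
Qed.

(** Both set functions extend to finite measures, so the uniqueness theorem on a generating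
    pi-system applies. *)
Lemma additive_below_unique P Q (G : set_system X) f g :
  measurable = <<s G >> -> setI_closed G -> G setT ->
  additive_below P f -> additive_below Q g ->
  {in G, f =1 g} -> forall A, measurable A -> f A = g A.
Proof.
move=> mG GI GT fP gQ fg A mA.
have [m mE] := additive_below_measure fP.
have [m' m'E] := additive_below_measure gQ.
apply: EFin_inj; rewrite -mE// -m'E//.
apply: (measure_unique G (fun=> setT)) => //.
- by apply/seteqP; split => // x _; exists 0%N.
- move=> B GB; have mB : measurable B by rewrite mG; exact: sub_sigma_algebra.
  by rewrite /= mE// m'E// fg// inE.
- by move=> k; rewrite /= ltey_eq fin_num_measure.
Qed.

End additive_below_theory.

Lemma additive_below_unique_prod d1 d2 (X : measurableType d1)
    (Y : measurableType d2) (R : realType) (P Q : probability (X * Y)%type R)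
    (f g : set (X * Y) -> R) : additive_below P f -> additive_below Q g ->
  (forall A B, measurable A -> measurable B -> f (A `*` B) = g (A `*` B)) ->
  forall C, measurable C -> f C = g C.
Proof.
move=> fP gQ fg; pose G : set_system (X * Y) :=
  [set A `*` B | A in measurable & B in measurable].
apply: (additive_below_unique (G := G) _ _ _ fP gQ).
- by rewrite /G measurable_prod_measurableType.
- move=> _ _ [A mA [B mB <-]] [A' mA' [B' mB' <-]].
  exists (A `&` A'); first exact: measurableI.
  by exists (B `&` B'); [exact: measurableI|rewrite setXI].
- by exists setT => //; exists setT => //; rewrite setXTT.
- by move=> C /[!inE] -[A mA [B mB <-]]; exact: fg.
Qed.

(** * Invariant set functions dominated by an ergodic measure *)

Section ergodic_uniqueness.
Context {d} {X : measurableType d} {R : realType}.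
Variables (P : probability X R) (T : X -> X) (f : set X -> R).
Hypotheses (mT : measurable_fun setT T) (PT : invariant_measure P T).
Hypotheses (ergT : ergodic P T) (fP : additive_below P f).
Hypothesis fT : forall A, measurable A -> f (T @^-1` A) = f A.

Let p A : R := fine (P A).
Let s A : R := f A - f setT * p A.

Let mpre B : measurable B -> measurable (T @^-1` B).
Proof. by move=> mB; rewrite -[X in measurable X]setTI; exact: mT. Qed.

Let pP : additive_below P p := additive_below_probability P.

Let sU A B : measurable A -> measurable B -> A `&` B = set0 ->
  s (A `|` B) = s A + s B.
Proof. by move=> mA mB AB0; rewrite /s fP.2// pP.2//; ring. Qed.

Let sT A : measurable A -> s (T @^-1` A) = s A.
Proof. by move=> mA; rewrite /s fT// /p PT. Qed.

(** The maximum is attained at the positive set of a Hahn decomposition of [s]: dropping from A its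
    part in the negative set, then adding what is missing of the positive set, never decreases
    [s]. *)
Let s_maximum : exists2 B, measurable B & forall A, measurable A -> s A <= s B.
Proof.
have [m mE] := additive_below_measure fP.
pose nu := cadd (charge_of_finite_measure m)
  (copp (cscale (f setT) (charge_of_finite_measure P))).
have nuE A : measurable A -> nu A = (s A)%:E.
  move=> mA; rewrite /nu /cadd /copp /cscale /= /charge_of_finite_measure.
  by rewrite mE// /s EFinB EFinM /p fineK// fin_num_measure.
have [B [N [[mB posB] [mN negN] BNT BN0]]] := Hahn_decomposition nu.
exists B => // A mA; have mAB : measurable (A `&` B) by exact: measurableI.
have mAN : measurable (A `&` N) by exact: measurableI.
have mBA : measurable (B `\` A) by exact: measurableD.
have -> : s A = s (A `&` B) + s (A `&` N).
  by rewrite -sU// -?setIUr ?BNT ?setIT// setIACA BN0 setI0.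
have -> : s B = s (A `&` B) + s (B `\` A).
  rewrite -sU//; last by rewrite setDE [B `&` _]setIC setIACA setICr set0I.
  by rewrite setIC setUIDK.
have nuN : (nu (A `&` N) <= 0)%E := negN _ mAN (@subIsetr _ _ _).
have nuB : (0 <= nu (B `\` A))%E := posB _ mBA (@subDsetl _ _ _).
move: nuN nuB; rewrite lerD2l !nuE// !lee_fin; exact: le_trans.
Qed.

(* A set maximizing the invariant signed measure [f - f(X) P] can be replaced by
   its limsup under T, which is strictly invariant, hence of measure 0 or 1. *)
Lemma ergodic_additive_below A : measurable A -> f A = f setT * fine (P A).
Proof.
have [B0 mB0 maxB0] := s_maximum.
pose mx B := measurable B /\ s B = s B0.
have mxT B : mx B -> mx (T @^-1` B).
  by move=> [mB sB]; split; [exact: mpre|rewrite sT].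
(* By modularity, s(B u C) + s(B n C) = s(B) + s(C) is twice the maximum, and s(B n C) is at most
   the maximum. *)
have mxU B C : mx B -> mx C -> mx (B `|` C).
  move=> [mB sB] [mC sC]; have mBC := measurableU _ _ mB mC; split => //.
  have mI : measurable (B `&` C) by exact: measurableI.
  have mD : measurable (B `\` C) by exact: measurableD.
  have e1 : s (B `|` C) = s (B `\` C) + s C.
    rewrite -sU//; last by rewrite setDE -setIA setICl setI0.
    by rewrite setDE setUIl setUCl setIT.
  have e2 : s B = s (B `\` C) + s (B `&` C).
    rewrite -sU//; last by rewrite setDE setIACA setICl setI0.
    by rewrite setUC setUIDK.
  apply/le_anti; rewrite maxB0//=; have := maxB0 _ mI; lra.
have sB_cvg (F : (set X)^nat) B :
    f (F n) @[n --> \oo] --> f B -> p (F n) @[n --> \oo] --> p B ->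
    (forall n, mx (F n)) -> s B = s B0.
  move=> fF pF mxF; have sF : s (F n) @[n --> \oo] --> s B.
    by apply: cvgB => //; apply: cvgZr.
  have sF0 : s (F n) @[n --> \oo] --> s B0.
    have -> : (fun n => s (F n)) = (fun=> s B0).
      by apply/funext => n; rewrite (mxF n).2.
    exact: cvg_cst.
  exact: (cvg_unique _ sF sF0).
(* [U n] is the union of the T^-i B0 for i <= n. The union [B1] of all of them only satisfies T^-1
   B1 <= B1; the intersection of the T^-n B1 gives the exact invariance that [ergodic] asks for. *)
pose U n : set X := iter n (fun B => B0 `|` T @^-1` B) B0.
have mxUn n : mx (U n) by elim: n => [//|n ih]; apply: mxU => //; exact: mxT.
have ndU : nondecreasing_seq U.
  apply/nondecreasing_seqP => n; apply/subsetPset.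
  elim: n => [|n ih] /=; first exact: subsetUl.
  by apply: setUS; exact: preimage_subset.
pose B1 := \bigcup_n U n.
have mB1 : measurable B1 by apply: bigcupT_measurable => n; exact: (mxUn n).1.
have mxB1 : mx B1.
  split => //; apply: (sB_cvg _ _ _ _ mxUn); [apply: (additive_below_cvg fP)|
    apply: (additive_below_cvg pP)] => // n; exact: (mxUn n).1.
have TB1 : T @^-1` B1 `<=` B1 by move=> x [n _ Ux]; exists n.+1 => //; right.
pose V n : set X := iter n (preimage T) B1.
have mxV n : mx (V n) by elim: n => [//|n ih]; exact: mxT.
have niV : nonincreasing_seq V.
  apply/nonincreasing_seqP => n; apply/subsetPset.
  by elim: n => [//|n ih] /=; exact: preimage_subset.
pose B := \bigcap_n V n.
have mB : measurable B by apply: bigcapT_measurable => n; exact: (mxV n).1.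
have mxB : mx B.
  split => //; apply: (sB_cvg _ _ _ _ mxV); [apply: (additive_below_cvg_bigcap fP)|
    apply: (additive_below_cvg_bigcap pP)] => // n; exact: (mxV n).1.
have TB : T @^-1` B = B.
  apply/seteqP; split=> x Bx n _; last exact: (Bx n.+1).
  by move/subsetPset : (niV n n.+1 (leqnSn n)); apply; exact: (Bx n).
have sT0 : s setT = 0 by rewrite /s /p probability_setT /= mulr1 subrr.
have null C : measurable C -> P C = 0%E -> s C = 0.
  move=> mC PC; have := fP.1 _ mC; rewrite /s /p PC/= mulr0 subr0.
  by move=> ?; apply/le_anti; rewrite andbC.
(* The invariant maximizer has mass 0 or 1, and [s] vanishes in both cases. So [s] is nowhere
   positive, and it vanishes since its values at C and at the complement of C add up to s(X) = 0. *)
have max0 : s B0 = 0.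
  rewrite -mxB.2; have [|PB1] := ergT mB TB; first exact: null.
  rewrite -[RHS]sT0 -(setUv B) sU ?setICr//; last exact: measurableC.
  rewrite (null (~` B)) ?addr0//; first exact: measurableC.
  by rewrite probability_setC// PB1 subee.
have s0 C : measurable C -> s C = 0.
  move=> mC; apply/le_anti; rewrite -{1}max0 maxB0//=.
  have := maxB0 _ (measurableC mC); rewrite max0.
  have : s C + s (~` C) = 0.
    by rewrite -sU ?setUv ?setICr//; exact: measurableC.
  by lra.
by move=> mA; apply/eqP; rewrite -subr_eq0; apply/eqP; exact: s0.
Qed.

End ergodic_uniqueness.

(** * Rectangles in finite products *)

Section rectangles.
Context {I : finType} {d : I -> measure_display}.
Variable Y : forall i, measurableType (d i).

Definition rectangle (A : forall i, set (Y i)) : set (prodspace Y) :=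
  [set y | forall i, A i (y i)].

Lemma measurable_rectangle A : (forall i, measurable (A i)) ->
  measurable (rectangle A).
Proof.
move=> mA; have -> : rectangle A =
    \bigcap_(i in [set: I]) (fun y : prodspace Y => y i) @^-1` A i.
  by apply/seteqP; split=> y Ay => [i _|i]; exact: Ay.
apply: fin_bigcap_measurable => // i _; rewrite -[X in measurable X]setTI.
exact: measurable_coord.
Qed.

Lemma rectangleI A B :
  rectangle A `&` rectangle B = rectangle (fun i => A i `&` B i).
Proof.
apply/seteqP; split=> [y [Ay By] i|y ABy]; first by split.
by split=> i; have [] := ABy i.
Qed.

(** The generating cylinders constrain a single coordinate and are not stable under intersection.
    Rectangles form a pi-system, which uniqueness arguments require. *)
Lemma prodspace_measurableE :
  @measurable _ (prodspace Y) = <<s rectangle @` (fun A => forall i, measurable (A i)) >>.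
Proof.
apply/seteqP; split; last first.
  apply: smallest_sub; first exact: sigma_algebra_measurable.
  by move=> _ [A mA <-]; exact: measurable_rectangle.
apply: smallest_sub; first exact: smallest_sigma_algebra.
move=> _ [i _ [B mB <-]]; rewrite setTI; apply: sub_sigma_algebra.
pose A : forall j, set (Y j) := dfwith (fun j => setT) i B.
exists A.
  move=> j; rewrite /A; case: dfwithP => // j' _; exact: measurableT.
apply/seteqP; split=> y /=.
  by move=> /(_ i); rewrite /A dfwithin.
by move=> By j; rewrite /A; case: dfwithP.
Qed.

Lemma additive_below_unique_prodspace (R : realType)
    (P Q : probability (prodspace Y) R) f g :
  additive_below P f -> additive_below Q g ->
  (forall A, (forall i, measurable (A i)) ->
    f (rectangle A) = g (rectangle A)) ->
  forall C, measurable C -> f C = g C.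
Proof.
move=> fP gQ fg; apply: (additive_below_unique prodspace_measurableE _ _ fP gQ).
- move=> _ _ [A mA <-] [B mB <-]; rewrite rectangleI.
  by exists (fun i => A i `&` B i) => // i; exact: measurableI.
- by exists (fun i => setT); [move=> i; exact: measurableT|apply/seteqP; split].
- by move=> _ /[!inE] -[A mA <-]; exact: fg.
Qed.

End rectangles.

Lemma fine_prod_probE (I : finType) (d : I -> measure_display) (R : realType)
    (Y : forall i, measurableType (d i)) (nu : forall i, probability (Y i) R)
    (A : forall i, set (Y i)) : (forall i, measurable (A i)) ->
  fine (prod_prob nu (rectangle A)) = \prod_i fine (nu i (A i)).
Proof. by move=> mA; rewrite prod_probE. Qed.

Lemma probability_unique_prodspace (I : finType) (d : I -> measure_display)
    (R : realType) (Y : forall i, measurableType (d i))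
    (P Q : probability (prodspace Y) R) :
  (forall A, (forall i, measurable (A i)) ->
    P (rectangle A) = Q (rectangle A)) ->
  forall C, measurable C -> P C = Q C.
Proof.
move=> PQ C mC; rewrite -[LHS]fineK ?fin_num_measure// -[RHS]fineK ?fin_num_measure//.
congr EFin.
apply: (additive_below_unique_prodspace (additive_below_probability P)
  (additive_below_probability Q)) mC => A mA; by rewrite PQ.
Qed.

Lemma exists_pushforward d d' (X : measurableType d) (Y : measurableType d')
    (R : realType) (P : probability X R) (h : X -> Y) :
  measurable_fun setT h ->
  exists Q : probability Y R, forall B, Q B = P (h @^-1` B).
Proof.
move=> mh; pose h' : {mfun X >-> Y} := mfun_Sub (mem_set mh).
by exists (distribution P h').
Qed.

Lemma probability_unique_prod d1 d2 (X : measurableType d1)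
    (Y : measurableType d2) (R : realType) (P Q : probability (X * Y)%type R) :
  (forall A B, measurable A -> measurable B -> P (A `*` B) = Q (A `*` B)) ->
  forall C, measurable C -> P C = Q C.
Proof.
move=> PQ C mC; rewrite -[LHS]fineK ?fin_num_measure// -[RHS]fineK ?fin_num_measure//.
congr EFin.
apply: (additive_below_unique_prod (additive_below_probability P)
  (additive_below_probability Q)) mC => A B mA mB; by rewrite PQ.
Qed.

(** * Mean correlations in an ergodic system *)

Section invariant_iterates.
Context {d} {X : measurableType d} {R : realType}.
Variables (P : probability X R) (T : X -> X).
Hypotheses (mT : measurable_fun setT T) (PT : invariant_measure P T).

Lemma measurable_preimageT d' (Y : measurableType d') (h : X -> Y) B :
  measurable_fun setT h -> measurable B -> measurable (h @^-1` B).
Proof. by move=> mh mB; rewrite -[X in measurable X]setTI; exact: mh. Qed.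

Lemma measurable_iter n : measurable_fun setT (iter n T).
Proof.
elim: n => [|n ih]; first exact: measurable_id.
exact: (measurableT_comp mT ih).
Qed.

Lemma preimage_iterSr n A : iter n.+1 T @^-1` A = T @^-1` (iter n T @^-1` A).
Proof. by apply/seteqP; split=> x; rewrite /preimage /mkset iterSr. Qed.

Lemma invariant_iter n A : measurable A -> P (iter n T @^-1` A) = P A.
Proof.
move=> mA; elim: n => [//|n ih]; rewrite preimage_iterSr PT//.
exact/measurable_preimageT/mA/measurable_iter.
Qed.

Variable M : (nat -> R) -> R.
Hypotheses (meanM : is_mean M)
  (Mshift : forall a, bounded_seq a -> M (fun n => a n.+1) = M a).

(** As a function of B the left side is dominated by [P], and it is T-invariant because [M] is
    shift-invariant. By ergodicity it is a multiple of [P], with total mass P(A). *)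
Lemma ergodic_mean A B : ergodic P T -> measurable A -> measurable B ->
  M (fun n => fine (P (iter n T @^-1` A `&` B))) = fine (P A) * fine (P B).
Proof.
move=> ergT mA mB.
have mTA n : measurable (iter n T @^-1` A).
  exact/measurable_preimageT/mA/measurable_iter.
pose f B := M (fun n => fine (P (iter n T @^-1` A `&` B))).
have fP : additive_below P f.
  apply: additive_below_mean => // n.
  rewrite (_ : (fun _ => _) = (fun E => fine (P (E `&` (iter n T @^-1` A))))).
    exact: (additive_belowI (mTA n) (additive_below_probability P)).
  by apply/funext => E; rewrite setIC.
have fT C : measurable C -> f (T @^-1` C) = f C.
  move=> mC; rewrite /f -[LHS]Mshift.
    congr M; apply/funext => n.
    rewrite preimage_iterSr -preimage_setI PT//; exact: measurableI.
  apply: bounded_seq01 => n; apply: fine_probability_le1.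
  exact/measurableI/measurable_preimageT.
rewrite -/(f B) (ergodic_additive_below mT PT ergT fP fT mB); congr (_ * _).
rewrite /f -[RHS](mean_cst meanM); congr M; apply/funext => n.
by rewrite setIT invariant_iter.
Qed.

End invariant_iterates.

(** * Weak mixing and ergodicity of products *)

Lemma le_norm_prodB (R : realDomainType) (I : Type) (r : seq I) (x y : I -> R) :
  (forall i, 0 <= x i <= 1) -> (forall i, 0 <= y i <= 1) ->
  `|\prod_(i <- r) x i - \prod_(i <- r) y i| <= \sum_(i <- r) `|x i - y i|.
Proof.
move=> x01 y01; elim: r => [|i r ih]; first by rewrite !big_nil subrr normr0.
rewrite !big_cons.
have -> : x i * \prod_(j <- r) x j - y i * \prod_(j <- r) y j =
    (x i - y i) * \prod_(j <- r) x j +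
    y i * (\prod_(j <- r) x j - \prod_(j <- r) y j) by ring.
rewrite (le_trans (ler_normD _ _))// lerD// normrM.
  rewrite ler_piMr// ger0_norm; last by apply: prodr_ge0 => j _; case/andP: (x01 j).
  by apply: prodr_ile1 => j _; exact: x01.
have /andP[y0 y1] := y01 i.
by rewrite (le_trans _ ih)// ler_piMl// ger0_norm.
Qed.

Section weak_mixing.
Context {R : realType}.
Implicit Types S : system R.

Lemma automorphism_measurable S :
  automorphism S -> measurable_fun setT (@sys_map R S).
Proof. by case=> _ [f' []]. Qed.

Lemma measurable_pair_map (T S : system R) :
  measurable_fun setT (@sys_map R T) -> measurable_fun setT (@sys_map R S) ->
  measurable_fun setT (@sys_map R (system_pair T S)).
Proof.
move=> mT mS; apply: measurable_fun_pair => /=.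
  exact: (measurableT_comp mT measurable_fst).
exact: (measurableT_comp mS measurable_snd).
Qed.

Lemma invariant_pair (T S : system R) :
  measurable_fun setT (@sys_map R T) -> measurable_fun setT (@sys_map R S) ->
  invariant_measure (sys_prob T) (@sys_map R T) ->
  invariant_measure (sys_prob S) (@sys_map R S) ->
  invariant_measure (sys_prob (system_pair T S)) (@sys_map R (system_pair T S)).
Proof.
move=> mT mS iT iS C mC.
have [Q QE] := exists_pushforward (sys_prob (system_pair T S))
  (measurable_pair_map mT mS).
rewrite -QE; apply: probability_unique_prod mC => A B mA mB.
rewrite QE [LHS](_ : _ = (sys_prob T \x sys_prob S)%E
    ((@sys_map R T @^-1` A) `*` (@sys_map R S @^-1` B)))//.
rewrite product_measure1E; [|exact: measurable_preimageT..].
rewrite [RHS]product_measure1E//; congr (_ * _)%E; [exact: iT|exact: iS].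
Qed.

Lemma measurable_prod_map (I : finType) (S : I -> system R) :
  (forall i, measurable_fun setT (@sys_map R (S i))) ->
  measurable_fun setT (@sys_map R (system_prod S)).
Proof.
move=> mS; apply: measurable_prodspaceP => i /=.
exact: (measurableT_comp (mS i) (@measurable_coord _ _ S i)).
Qed.

Lemma invariant_prod (I : finType) (S : I -> system R) :
  (forall i, measurable_fun setT (@sys_map R (S i))) ->
  (forall i, invariant_measure (sys_prob (S i)) (@sys_map R (S i))) ->
  invariant_measure (sys_prob (system_prod S)) (@sys_map R (system_prod S)).
Proof.
move=> mS iS C mC.
have [Q QE] := exists_pushforward (sys_prob (system_prod S))
  (measurable_prod_map mS).
rewrite -QE; apply: probability_unique_prodspace mC => A mA.
rewrite QE [LHS](_ : _ = prod_prob (fun i => sys_prob (S i))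
    (rectangle (fun i => @sys_map R (S i) @^-1` A i)))//.
rewrite !prod_probE//; last by move=> i; exact: measurable_preimageT.
by congr EFin; apply: eq_bigr => i _; rewrite iS.
Qed.

Section mean.
Variable M : (nat -> R) -> R.
Hypotheses (meanM : is_mean M)
  (Mshift : forall a, bounded_seq a -> M (fun n => a n.+1) = M a).

(** Let a_n be the correlation and c = P(A) P(B). Ergodicity of S x S, applied to products of sets,
    gives a_n the mean c and a_n^2 the mean c^2, so (a_n - c)^2 has mean 0. The inequality |x| <= e
    + x^2/e, for all e > 0, passes from squares to absolute values. *)
Lemma weakly_mixing_mean S A B : automorphism S -> weakly_mixing S ->
  measurable A -> measurable B ->
  M (fun n => `|fine (sys_prob S (iter n (@sys_map R S) @^-1` A `&` B)) -
              fine (sys_prob S A) * fine (sys_prob S B)|) = 0.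
Proof.
move=> autS wmS mA mB; have [_ _ iS] := autS.
have mS := automorphism_measurable autS.
set P := sys_prob S; set T := @sys_map R S; set c := _ * _.
pose a n : R := fine (P (iter n T @^-1` A `&` B)).
have mAB n : measurable (iter n T @^-1` A `&` B).
  by apply: measurableI => //; exact/measurable_preimageT/mA/measurable_iter.
have a01 n : 0 <= a n <= 1 by exact: fine_probability_le1.
have ba : bounded_seq a by exact: bounded_seq01.
have ba2 : bounded_seq (fun n => a n ^+ 2).
  apply: bounded_seq01 => n; have /andP[a0 a1] := a01 n.
  by rewrite sqr_ge0 expr_le1.
have pairM (C D E F : set S) : measurable C -> measurable D -> measurable E ->
    measurable F ->
    M (fun n => fine (P (iter n T @^-1` C `&` E)) *
                fine (P (iter n T @^-1` D `&` F))) =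
    fine (P C) * fine (P D) * (fine (P E) * fine (P F)).
  move=> mC mD mE mF.
  have := ergodic_mean (measurable_pair_map mS mS) (invariant_pair mS mS iS iS)
    meanM Mshift wmS (measurableX mC mD) (measurableX mE mF).
  rewrite /= !product_measure1E// !fineM ?fin_num_measure// => <-.
  congr M; apply/funext => n.
  have -> : iter n (fun p : S * S => (sys_map p.1, sys_map p.2)) =
      (fun p => (iter n T p.1, iter n T p.2)).
    by apply/funext => -[x y]; elim: n => //= n ->.
  rewrite -[X in _ = fine (_ X)]/((iter n T @^-1` C `*` iter n T @^-1` D) `&` _).
  have mI D1 D2 : measurable D1 -> measurable D2 ->
      measurable (iter n T @^-1` D1 `&` D2).
    by move=> m1 m2; apply: measurableI => //; exact/measurable_preimageT/m1/measurable_iter.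
  have mCE := mI _ _ mC mE; have mDF := mI _ _ mD mF.
  by rewrite -setXI product_measure1E// fineM// fin_num_measure.
have Ma : M a = c.
  rewrite /c; have := pairM A setT B setT mA measurableT mB measurableT.
  rewrite probability_setT /= !mulr1 => <-; congr M; apply/funext => n.
  by rewrite setIT preimage_setT probability_setT mulr1.
have Ma2 : M (fun n => a n ^+ 2) = c ^+ 2.
  transitivity (M (fun n => a n * a n)).
    by congr M; apply/funext => n; rewrite expr2.
  by rewrite pairM// /c; ring.
have bd : bounded_seq (fun n => (a n - c) ^+ 2).
  apply: bounded_seq01 => n; rewrite sqr_ge0/= -[X in X <= _]real_normK ?num_real//.
  rewrite expr_le1// ler_norml; have := a01 n.
  have := fine_probability_le1 P mA; have := fine_probability_le1 P mB.
  rewrite /c; nra.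
have Md : M (fun n => (a n - c) ^+ 2) = 0.
  transitivity (M (fun n => a n ^+ 2 + ((- 2 * c) * a n + c ^+ 2))).
    by congr M; apply/funext => n; ring.
  have bb : bounded_seq (fun n => (- 2 * c) * a n) by exact: bounded_seqZ.
  have bc : bounded_seq (fun=> c ^+ 2) by exact: bounded_seq_cst.
  rewrite (meanD meanM ba2 (bounded_seqD bb bc)) (meanD meanM bb bc).
  by rewrite (meanZ meanM _ ba) (mean_cst meanM) Ma Ma2; ring.
have bn : bounded_seq (fun n => `|a n - c|).
  have [K Kd] : bounded_seq (fun n => a n + (- c)).
    by apply: bounded_seqD => //; exact: bounded_seq_cst.
  by exists K => n; rewrite normr_id.
apply/le_anti/andP; split; last first.
  rewrite -(mean_cst meanM 0); apply: mean_le => //; exact: bounded_seq_cst.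
apply/ler_addgt0Pl => e e0; rewrite addr0.
have {1}-> : e = M (fun n => e + e^-1 * (a n - c) ^+ 2).
  rewrite (meanD meanM) ?(meanZ meanM)// ?(mean_cst meanM) ?Md ?mulr0 ?addr0//.
  - exact: bounded_seq_cst.
  - exact: bounded_seqZ.
apply: mean_le => // [|n].
  by apply: bounded_seqD; [exact: bounded_seq_cst|exact: bounded_seqZ].
have [le_e|/ltW le_e] := leP `|a n - c| e.
  by rewrite (le_trans le_e)// lerDl mulr_ge0 ?invr_ge0 ?sqr_ge0// ltW.
rewrite -[X in _ <= _ + X]add0r addrA -[leLHS]add0r lerD//; first by rewrite addr0 ltW.
by rewrite -[(a n - c) ^+ 2]real_normK ?num_real// ler_pdivlMl// expr2 ler_wpM2r.
Qed.

End mean.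

(** On rectangles, the mean of P(T^-n A n B) is P(A) P(B). For an invariant C this is extended to A
    = C, then to B = C, giving P(C) = P(C)^2. *)
Lemma ergodic_prod (I : finType) (S : I -> system R) :
  (forall i, automorphism (S i) /\ weakly_mixing (S i)) ->
  ergodic (sys_prob (system_prod S)) (@sys_map R (system_prod S)).
Proof.
move=> hS C mC CT.
have [M [meanM Mshift]] := @exists_invariant_mean R.
have mS i := automorphism_measurable (hS i).1.
have mT := measurable_prod_map mS.
have iT : invariant_measure (sys_prob (system_prod S)) (@sys_map R (system_prod S)).
  by apply: invariant_prod => // i; have [[]] := hS i.
set P := sys_prob (system_prod S) in iT *.
set T := @sys_map R (system_prod S) in mT CT iT *.
have iterE n y i : iter n T y i = iter n (@sys_map R (S i)) (y i).
  by elim: n => // n ih; rewrite !iterS -ih.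
have rectM A B : (forall i, measurable (A i)) -> (forall i, measurable (B i)) ->
    M (fun n => fine (P (iter n T @^-1` rectangle A `&` rectangle B))) =
    fine (P (rectangle A)) * fine (P (rectangle B)).
  move=> mA mB.
  have -> : (fun n => fine (P (iter n T @^-1` rectangle A `&` rectangle B))) =
      (fun n => \prod_i fine (sys_prob (S i)
         (iter n (@sys_map R (S i)) @^-1` A i `&` B i))).
    apply/funext => n; rewrite -fine_prod_probE.
      rewrite -rectangleI; congr (fine (P (_ `&` _))).
      by apply/seteqP; split=> y /= Ay i; have := Ay i; rewrite iterE.
    by move=> i; apply: measurableI => //; exact/measurable_preimageT/mA/measurable_iter.
  (* The correlation of two rectangles is a product over the coordinates. It deviates from the
     product of the limits by at most the sum of the absolute deviations of the factors, each of
     mean 0. *)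
  pose x n i := fine (sys_prob (S i) (iter n (@sys_map R (S i)) @^-1` A i `&` B i)).
  pose c i : R := fine (sys_prob (S i) (A i)) * fine (sys_prob (S i) (B i)).
  have x01 n i : 0 <= x n i <= 1.
    apply: fine_probability_le1; apply: measurableI => //.
    exact/measurable_preimageT/mA/measurable_iter.
  have c01 i : 0 <= c i <= 1.
    have /andP[a0 a1] := fine_probability_le1 (sys_prob (S i)) (mA i).
    have /andP[b0 b1] := fine_probability_le1 (sys_prob (S i)) (mB i).
    by rewrite mulr_ge0//= mulr_ile1.
  have -> : fine (P (rectangle A)) * fine (P (rectangle B)) = \prod_i c i.
    by rewrite !fine_prod_probE// -big_split.
  have bx i : bounded_seq (fun n => `|x n i - c i|).
    exists 1 => n; rewrite normr_id ler_norml.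
    have := x01 n i; have := c01 i; lra.
  have bsum (r : seq I) : bounded_seq (fun n => \sum_(i <- r) `|x n i - c i|).
    elim: r => [|i r ih].
      by under eq_fun do rewrite big_nil; exact: bounded_seq_cst.
    by under eq_fun do rewrite big_cons; exact: bounded_seqD.
  have sum0 (r : seq I) : M (fun n => \sum_(i <- r) `|x n i - c i|) = 0.
    elim: r => [|i r ih].
      by under eq_fun do rewrite big_nil; exact: mean_cst.
    under eq_fun do rewrite big_cons; rewrite (meanD meanM (bx i) (bsum r)) ih.
    rewrite (weakly_mixing_mean meanM Mshift)  ?addr0//; [exact: (hS i).1|exact: (hS i).2].
  have prod01 (y : I -> R) : (forall i, 0 <= y i <= 1) -> 0 <= \prod_i y i <= 1.
    move=> y01; rewrite prodr_ge0/=; last by move=> i _; case/andP: (y01 i).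
    by apply: prodr_ile1 => i _; exact: y01.
  have bp : bounded_seq (fun n => \prod_i x n i).
    by apply: bounded_seq01 => n; exact/prod01/x01.
  have bc := bounded_seq_cst (\prod_i c i).
  have bs := bsum (index_enum I).
  have le n : `|\prod_i x n i - \prod_i c i| <= \sum_i `|x n i - c i|.
    by apply: le_norm_prodB => //; exact: x01.
  apply/le_anti/andP; split.
    rewrite -[leRHS](mean_cst meanM) -[leRHS]addr0 -(sum0 (index_enum I)) -(meanD meanM)//.
    apply: mean_le => // [|n]; first exact: bounded_seqD.
    by rewrite -lerBlDl; exact: le_trans (ler_norm _) (le n).
  rewrite -[leLHS](mean_cst meanM) -[leRHS]addr0 -(sum0 (index_enum I)) -(meanD meanM)//.
  apply: mean_le => // [|n]; first exact: bounded_seqD.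
  by rewrite -lerBlDl; apply: le_trans (ler_norm _) _; rewrite distrC; exact: le.
have mTC n : iter n T @^-1` C = C.
  by elim: n => // n ih; rewrite preimage_iterSr ih.
have mTn n := measurable_iter mT n.
(* For fixed B both sides, as functions of the first set, are dominated by [P] and agree on
   rectangles. At the invariant set C the sequence under the mean is constant. *)
have CB B : (forall i, measurable (B i)) ->
    fine (P (C `&` rectangle B)) = fine (P (rectangle B)) * fine (P C).
  move=> mB; have mrB := measurable_rectangle mB.
  pose f A := M (fun n => fine (P (iter n T @^-1` A `&` rectangle B))).
  have -> : fine (P (C `&` rectangle B)) = f C.
    by rewrite /f -[LHS](mean_cst meanM); congr M; apply/funext => n; rewrite mTC.
  have fP : additive_below P f.
    apply: additive_below_mean => // n.
    apply: (additive_below_preimage (mTn n) (invariant_iter mT iT n)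
      (additive_belowI mrB (additive_below_probability P))).
  have gP : additive_below P (fun A => fine (P (rectangle B)) * fine (P A)).
    apply: additive_belowZ; last exact: additive_below_probability.
    exact: fine_probability_le1.
  apply: (additive_below_unique_prodspace fP gP) mC => A mA.
  by rewrite /f rectM// mulrC.
have PC2 : fine (P C) = fine (P C) * fine (P C).
  have fP := additive_belowI mC (additive_below_probability P).
  have gP := additive_belowZ (fine_probability_le1 P mC) (additive_below_probability P).
  rewrite -[in LHS](setIid C).
  apply: (additive_below_unique_prodspace fP gP) mC => A mA.
  by rewrite setIC CB// mulrC.
have : fine (P C) * (fine (P C) - 1) = 0 by rewrite mulrBr mulr1 -PC2 subrr.
move/eqP; rewrite mulf_eq0 subr_eq0 => /orP[] /eqP PC; [left|right];
  by rewrite -[LHS]fineK ?fin_num_measure// PC.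
Qed.

End weak_mixing.

(** * Densities bounded at every point *)

Section density.
Context {d} {Y : measurableType d} {R : realType}.
Variables (P : probability Y R) (f : set Y -> R) (w : Y -> R).
Hypotheses (fP : additive_below P f) (mw : measurable_fun setT w).
Hypothesis w01 : forall y, 0 <= w y <= 1.
Hypothesis fw : forall B, measurable B ->
  ((f B)%:E <= \int[P]_(y in B) (w y)%:E)%E.

(** A Radon-Nikodym derivative truncated by [w], so that the bound holds everywhere and not just
    almost everywhere. *)
Lemma exists_density : exists a : Y -> R,
  [/\ measurable_fun setT a, forall y, 0 <= a y <= w y &
    forall B, measurable B -> (f B)%:E = (\int[P]_(y in B) (a y)%:E)%E].
Proof.
have [m mE] := additive_below_measure fP.
have mP : m `<< P.
  apply/null_content_dominatesP => A mA PA; rewrite mE//; congr EFin.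
  have := fP.1 _ mA; rewrite PA/= => ?; apply/le_anti; rewrite andbC//.
have [g [g0 gfin ig mg]] := radon_nikodym_sigma_finite mP.
have mgm : measurable_fun [set: Y] g by exact: measurable_int ig.
pose h y := fine (g y).
have gE y : g y = (h y)%:E by rewrite fineK.
have h0 y : 0 <= h y by rewrite -lee_fin -gE.
have mh : measurable_fun setT h.
  by apply/measurable_EFinP; rewrite (_ : _ \o _ = g)//; apply/funext => y; rewrite /= -gE.
pose a y := Num.min (h y) (w y).
have ma : measurable_fun setT a by exact: measurable_minr.
have a0 y : 0 <= a y by rewrite le_min h0; case/andP: (w01 y) => ->.
exists a; split => //; first by move=> y; rewrite a0 ge_min lexx orbT.
move=> B mB.
(* Truncation changes nothing on [D]. Off [D] one has w < h, and f <= int w <= int h = f forces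
   equality. *)
pose D := [set y | h y <= w y].
have mD : measurable D by rewrite -[D]setTI; exact: measurable_fun_le.
have mBD : measurable (B `&` D) by exact: measurableI.
have mBC : measurable (B `\` D) by exact: measurableD.
have mE' F (k : Y -> R) : measurable_fun setT k -> measurable_fun F (EFin \o k).
  by move=> mk; apply/measurable_EFinP; exact: measurable_funTS.
have mgE F : measurable F -> (f F)%:E = (\int[P]_(y in F) (h y)%:E)%E.
  by move=> mF; rewrite -mE// mg//; apply: eq_integral => y _; rewrite gE.
rewrite -(setUIDK B D) ge0_integral_setU//; last 3 first.
- exact: mE'.
- by move=> y _; rewrite lee_fin.
- by apply/disj_setPS => y [[_ Dy] [_]].
rewrite fP.2//; last by rewrite setDE setIACA setICr setI0.
rewrite EFinD; congr (_ + _)%E.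
  rewrite mgE//; apply: eq_integral => y /[!inE] -[_ Dy].
  by rewrite /a; move: Dy => /= /min_idPl ->.
have -> : (\int[P]_(y in B `\` D) (a y)%:E = \int[P]_(y in B `\` D) (w y)%:E)%E.
  apply: eq_integral => y /[!inE] -[_ /negP]; rewrite /D/= -ltNge => /ltW.
  by rewrite /a => /min_idPr ->.
apply/le_anti; rewrite fw//= mgE//; apply: ge0_le_integral => //.
- by move=> y _; rewrite lee_fin; case/andP: (w01 y).
- exact: mE'.
- exact: mE'.
- by move=> y [_ /negP]; rewrite /D/= -ltNge lee_fin => /ltW.
Qed.

End density.

(** * Standard Borel spaces through countable families of small sets *)

(* [C] shrinks to a point of arbitrarily small sets of the family, and [J U]
   indexes the sets of the family well inside [U]; the last field is
   completeness. *)
Record complete_basis d (X : measurableType d) (E : nat -> set X)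
    (lev : nat -> nat) (opens : set_system X) (J : set X -> set nat) : Prop := {
  basis_measurable : forall i, measurable (E i);
  basis_cover : forall m x, exists2 i, lev i = m & E i x;
  basis_opens : measurable = <<s opens >>;
  basis_opensI : setI_closed opens;
  basis_opensT : opens setT;
  basis_openE : forall U, opens U -> U = \bigcup_(i in J U) E i;
  basis_limit : forall C : nat -> set X, (forall n, C n !=set0) ->
    (forall n, C n.+1 `<=` C n) ->
    (forall m, exists n i, lev i = m /\ C n `<=` E i) ->
    exists x, forall U, opens U ->
      (U x <-> exists n i, J U i /\ C n `<=` E i) }.

(** The index i encodes a pair (m, a), and [E i] is the pull-back of the ball of radius 1/(m+1)
    around the point of code a in a countable dense set, or is empty. *)
Lemma standard_borel_basis (R : realType) d (X : measurableType d) :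
  standard_borel R X -> exists E lev opens J, @complete_basis d X E lev opens J.
Proof.
move=> [M [phi [complM [D cD dD] bphi mX]]].
have [f finj] : exists f : M -> nat, {in D &, injective f} by exact/countable_injP.
have [psi phiK psiK] := bphi.
pose r m : R := m.+1%:R^-1.
have r0 m : 0 < r m by rewrite invr_gt0.
have rlt e : 0 < e -> exists m, r m < e.
  move=> e0; exists (Num.truncn e^-1).
  by rewrite /r -[ltRHS]invrK ltf_pV2 ?posrE ?invr_gt0// truncnS_gt.
pose dec : nat -> option (nat * nat) := unpickle.
pose enc : nat * nat -> nat := pickle.
have decK : pcancel enc dec by exact: pickleK.
pose e m a : set X := [set x | exists2 q, D q & f q = a /\ mdist q (phi x) < r m].
pose E (i : nat) : set X := if dec i is Some (m, a) then e m a else set0.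
pose lev (i : nat) : nat := if dec i is Some (m, a) then m else 0%N.
pose opens : set_system X := [set phi @^-1` U | U in @open M].
(* The whole closed ball must lie in V: a limit of points of [E i] is only known to be in the closed
   ball. *)
pose J (V : set X) : set nat := [set i | exists (m a : nat), dec i = Some (m, a) /\
  forall q, D q -> f q = a -> forall x, mdist q (phi x) <= r m -> V x].
have openb (q : M) s : open (ball q s).
  rewrite openE => y; rewrite ballEmdist /interior /= => qy.
  apply/nbhs_ballP; exists (s - mdist q y) => /=; first by rewrite subr_gt0.
  move=> z; rewrite !ballEmdist/= ltrBrDl; apply: le_lt_trans.
  exact: metric_triangle.
have near_small (U : set X) x : opens U -> U x ->
    exists2 m0, (0 < m0)%R & forall y, mdist (phi x) (phi y) < m0 -> U y.
  move=> [V oV <-] Vx; move: oV; rewrite openE => /(_ _ Vx).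
  move=> /nbhs_ballP[m0 m00 xV]; exists m0 => // y xy; apply: xV.
  by rewrite ballEmdist.
have inJ (U : set X) x : opens U -> U x -> exists m, forall i a q,
    D q -> f q = a -> mdist q (phi x) <= r m -> dec i = Some (m, a) -> J U i.
  move=> oU Ux; have [s s0 sU] := near_small U x oU Ux.
  (* If x is within r m of q, the closed ball of radius r m around q stays within 2 r m < s of x. *)
  have [m ms] := rlt (s / 2) ltac:(by rewrite divr_gt0).
  exists m => i a q Dq fq qx ia; exists m, a; split => // q' Dq' fq' y.
  have -> : q' = q by apply: finj; rewrite ?inE// fq fq'.
  move=> qy; apply: sU; rewrite (le_lt_trans (metric_triangle _ q _))//.
  by rewrite metric_sym (splitr s) (le_lt_trans (lerD qx qy))// ltrD.
have EP i x m a : dec i = Some (m, a) -> E i x ->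
    exists q, [/\ D q, f q = a & mdist q (phi x) < r m].
  by move=> ia; rewrite /E ia => -[q Dq [fq qx]]; exists q.
have cover (m : nat) x : exists2 i, lev i = m & E i x.
  have [] := dD (ball (phi x) (r m)) _ (openb _ _).
    by exists (phi x); rewrite ballEmdist/= mdistxx.
  move=> q; rewrite ballEmdist => -[/= xq Dq]; exists (enc (m, f q)).
    by rewrite /lev decK.
  by rewrite /E decK; exists q => //; rewrite metric_sym.
exists E, lev, opens, J; split => //.
- move=> i; rewrite /E; case: (dec i) => [[m a]|//].
  have -> : e m a = phi @^-1` (\bigcup_(q in [set q | D q /\ f q = a]) ball q (r m)).
    apply/seteqP; split=> x /= [q].
      by move=> Dq [fq qx]; exists q => //; rewrite ballEmdist.
    by move=> [Dq fq]; rewrite ballEmdist => qx; exists q.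
  rewrite mX; eexists; last by rewrite setTI.
  by apply: sub_sigma_algebra; apply: bigcup_open => q _; exact: openb.
- rewrite mX; apply/seteqP; split.
    move=> _ [U sU <-]; rewrite setTI; move: U sU.
    apply: smallest_sub; last first.
      by move=> U oU /=; apply: sub_sigma_algebra; exists U.
    have [h0 hC hU] := smallest_sigma_algebra setT opens.
    split => /=.
    + by rewrite preimage_set0.
    + by move=> A /hC; rewrite !setTD preimage_setC.
    + by move=> F hF; rewrite preimage_bigcup; exact: hU.
  apply: smallest_sub.
    exact/sigma_algebra_preimage/smallest_sigma_algebra.
  move=> _ [U oU <-]; exists U; last by rewrite setTI.
  exact: sub_sigma_algebra.
- move=> _ _ [U oU <-] [V oV <-]; exists (U `&` V); first exact: openI.
  by rewrite preimage_setI.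
- by exists setT; [exact: openT|rewrite preimage_setT].
- move=> U oU; apply/seteqP; split=> x.
    move=> Ux; have [m mJ] := inJ _ _ oU Ux; have [i im Ex] := cover m x.
    move: im (Ex); rewrite {1}/E /lev; case: (dec i) (mJ i) => [[m' a]|//].
    move=> mJi mm; subst m'; move=> [q Dq [fq qx]].
    by exists i => //; apply: (mJi a q) => //; exact: ltW.
  move=> [i [m [a [ia Jq]]] /(EP _ _ _ _ ia)[q [Dq fq qx]]].
  exact: (Jq q Dq fq x (ltW qx)).
- move=> C C0 Cdec CE.
  have Cle n n' : (n <= n')%N -> C n' `<=` C n.
    move=> /subnK <-; elim: (n' - n)%N => [//|k ih].
    by rewrite addSn; exact: subset_trans (Cdec _) ih.
  (* The images of the [C n] generate a Cauchy filter, as they are eventually inside a ball of any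
     given level; its limit is the required point. *)
  pose F : set_system M := filter_from setT (fun n => phi @` C n).
  have PF : ProperFilter F.
    apply: filter_from_proper; last by move=> n _; have [z Cz] := C0 n; exists (phi z), z.
    apply: filter_fromT_filter; first by exists 0%N.
    move=> n n'; exists (maxn n n') => _ [z Cz <-]; split; exists z => //.
      by move: Cz; apply: Cle; exact: leq_maxl.
    by move: Cz; apply: Cle; exact: leq_maxr.
  have lev_dec i m n : lev i = m -> C n `<=` E i ->
      exists a, dec i = Some (m, a).
    have [z Cz] := C0 n; move=> im /(_ _ Cz); move: im; rewrite /lev /E.
    by case: (dec i) => [[m' a]|//] <- _; exists a.
  have [|x Fx] := complM F PF.
    apply: cauchy_exP => s s0; have [m ms] := rlt _ s0.
    have [n [i [im CEi]]] := CE m; have [a ia] := lev_dec _ _ _ im CEi.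
    have [z Cz] := C0 n; have [q [Dq fq qz]] := EP _ _ _ _ ia (CEi _ Cz).
    exists q, n => // _ [y Cy <-]; have [q' [Dq' fq' qy]] := EP _ _ _ _ ia (CEi _ Cy).
    have qq : q' = q by apply: finj; rewrite ?inE// fq fq'.
    by rewrite ballEmdist/= -qq (lt_trans qy).
  have limE n i m a : dec i = Some (m, a) -> C n `<=` E i ->
      exists q, [/\ D q, f q = a & mdist q x <= r m].
    move=> ia CEi; have [z Cz] := C0 n.
    have [q [Dq fq qz]] := EP _ _ _ _ ia (CEi _ Cz).
    exists q; split => //; apply/ler_addgt0Pl => s s0.
    have [n' _ n's] : F (ball x s) by apply: Fx; exact: nbhsx_ballx.
    have [y Cy] := C0 (maxn n n').
    have Cny : C n y by move: Cy; apply: Cle; exact: leq_maxl.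
    have : ball x s (phi y).
      by apply: n's; exists y => //; move: Cy; apply: Cle; exact: leq_maxr.
    rewrite ballEmdist/= => xy.
    have [q' [Dq' fq' qy]] := EP _ _ _ _ ia (CEi _ Cny).
    have qq : q' = q by apply: finj; rewrite ?inE// fq fq'.
    rewrite (le_trans (metric_triangle _ (phi y) _))// addrC lerD//.
      by rewrite metric_sym ltW.
    by rewrite -qq ltW.
  exists (psi x) => U oU; split=> [Ux|[n [i [[m [a [ia Jq]]] CEi]]]].
    have [m mJ] := inJ _ _ oU Ux; have [n [i [im CEi]]] := CE m.
    have [a ia] := lev_dec _ _ _ im CEi; have [q [Dq fq qx]] := limE _ _ _ _ ia CEi.
    by exists n, i; split => //; apply: (mJ i a q) => //; rewrite psiK.
  have [q [Dq fq qx]] := limE _ _ _ _ ia CEi.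
  by apply: (Jq q) => //; rewrite psiK.
Qed.

(** * Bimeasures with given marginals *)

Section bimeasure.
Context {d1 d2} {Z : measurableType d1} {Y : measurableType d2} {R : realType}.
Variables (P : probability Z R) (Q : probability Y R).

(** The values of a coupling on rectangles, with finite additivity in each variable: such conditions
    pass to pointwise limits, and the marginals then dominate each variable separately. *)
Record bimeasure (b : set Z -> set Y -> R) : Prop := {
  bimeasure_ge0 : forall A B, measurable A -> measurable B -> 0 <= b A B;
  bimeasureUl : forall A A' B, measurable A -> measurable A' -> measurable B ->
    A `&` A' = set0 -> b (A `|` A') B = b A B + b A' B;
  bimeasureUr : forall A B B', measurable A -> measurable B -> measurable B' ->
    B `&` B' = set0 -> b A (B `|` B') = b A B + b A B';
  bimeasureT : forall A, measurable A -> b A setT = fine (P A);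
  bimeasureTl : forall B, measurable B -> b setT B = fine (Q B) }.

Variable b : set Z -> set Y -> R.
Hypothesis bb : bimeasure b.

Lemma bimeasure_left B : measurable B -> additive_below P (b ^~ B).
Proof.
move=> mB; have mBC := measurableC mB; split=> [A mA|A A' mA mA' AA'].
  rewrite (bimeasure_ge0 bb)//= -(bimeasureT bb)// -(setUv B).
  by rewrite (bimeasureUr bb)// ?setICr// lerDl (bimeasure_ge0 bb).
exact: (bimeasureUl bb).
Qed.

Lemma bimeasure_right A : measurable A -> additive_below Q (b A).
Proof.
move=> mA; have mAC := measurableC mA; split=> [B mB|B B' mB mB' BB'].
  rewrite (bimeasure_ge0 bb)//= -(bimeasureTl bb)// -(setUv A).
  by rewrite (bimeasureUl bb)// ?setICr// lerDl (bimeasure_ge0 bb).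
exact: (bimeasureUr bb).
Qed.

End bimeasure.

(** * Realizing a bimeasure as the law of a map on Y x [0, 1] *)

Lemma exists_uniform (R : realType) : exists U : probability R R,
  forall l r : R, 0 <= l -> l <= r -> r <= 1 -> U [set u | l <= u < r] = (r - l)%:E.
Proof.
have mid : measurable_fun setT (idfun : measurableTypeR R -> R) by exact: measurable_id.
have [U UE] := exists_pushforward (uniform_prob (@ltr01 R)) mid.
exists U => l r l0 lr r1; rewrite UE preimage_id.
apply: (etrans (integral_uniform_pdf _ _ _)).
rewrite (_ : _ `&` _ = `[l, r[%classic); last first.
  rewrite setIidl; first by apply/seteqP; split=> u; rewrite /= in_itv.
  move=> u /=; rewrite in_itv /= => /andP[lu ur].
  by rewrite (le_trans l0)//= (le_trans (ltW ur)).
rewrite (eq_integral (fun=> 1%:E)); last first.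
  move=> u /[!inE] /=; rewrite in_itv /= => /andP[lu ur]; rewrite /uniform_pdf.
  by rewrite (le_trans l0)//= (le_trans (ltW ur))// subr0 invr1.
rewrite integral_cst//= mul1e lebesgue_measure_itv/= lte_fin.
move: lr; rewrite le_eqVlt => /orP[/eqP->|lr]; first by rewrite ltxx subrr.
by rewrite lr EFinB.
Qed.

Lemma between_measure d (Y : measurableType d) (R : realType)
    (Q : probability Y R) (U : probability R R) (l r : Y -> R) B :
  (forall l r : R, 0 <= l -> l <= r -> r <= 1 -> U [set u | l <= u < r] = (r - l)%:E) ->
  (forall y, 0 <= l y /\ l y <= r y <= 1) ->
  measurable B ->
  (Q \x U)%E [set w | B w.1 /\ l w.1 <= w.2 < r w.1] =
  (\int[Q]_(y in B) (r y - l y)%:E)%E.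
Proof.
move=> UE lr mB; rewrite /product_measure1/= [RHS]integral_mkcond.
apply: eq_integral => y _; rewrite patchE; case: ifPn => [/[!inE] By|].
  rewrite (_ : xsection _ _ = [set u | l y <= u < r y]).
    by have [? /andP[? ?]] := lr y; rewrite UE.
  apply/seteqP; split=> u; rewrite /xsection /= inE/=; first by case.
  by [].
move=> /negP; rewrite inE => By; rewrite (_ : xsection _ _ = set0) ?measure0//.
by apply/seteqP; split=> // u; rewrite /xsection /= inE => -[].
Qed.

Section binary_tree.
Context {d1 d2} {Z : measurableType d1} {Y : measurableType d2} {R : realType}.
Variables (P : probability Z R) (Q : probability Y R) (b : set Z -> set Y -> R).
Hypothesis bb : bimeasure P Q b.
Variable E : nat -> set Z.
Hypothesis mE : forall i, measurable (E i).

(** The last digit comes first: the head of a word of length n+1 records membership in [E n], so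
    that adding a head refines the cell. *)
Fixpoint digits n (x : Z) : seq bool :=
  if n is n'.+1 then `[< E n' x >] :: digits n' x else [::].

Fixpoint cell (s : seq bool) : set Z :=
  if s is c :: s' then cell s' `&` (if c then E (size s') else ~` E (size s'))
  else setT.

(** Some index in [K] carries the digit true: a witness, at finite depth, of membership in the union
    of the [E i] for i in [K]. *)
Fixpoint hit (K : set nat) (s : seq bool) : Prop :=
  if s is c :: s' then (c /\ K (size s')) \/ hit K s' else False.

Lemma size_digits n x : size (digits n x) = n.
Proof. by elim: n => //= n ->. Qed.

Lemma cell_digits n x : cell (digits n x) x.
Proof. by elim: n => //= n ih; split => //; rewrite size_digits; case: asboolP. Qed.

Lemma cellP s x : cell s x <-> digits (size s) x = s.
Proof.
split=> [|<-]; last exact: cell_digits.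
elim: s => //= c s ih [/ih -> Ec]; congr (_ :: _).
by case: c Ec => Ec; [apply/asboolP|apply/asboolPn].
Qed.

Lemma measurable_cell s : measurable (cell s).
Proof.
elim: s => [|c s ih] /=; first exact: measurableT.
by apply: measurableI => //; case: c; [|exact: measurableC].
Qed.

Lemma hit_digits K n x : hit K (digits n x) <-> exists i, [/\ (i < n)%N, K i & E i x].
Proof.
elim: n => [|n ih] /=; first by split=> [//|[i []]].
rewrite size_digits ih; split=> [[[/asboolP En Kn]|[i [ni Ki Ei]]]|[i []]].
- by exists n.
- by exists i; split => //; exact: ltnW.
- rewrite ltnS leq_eqVlt => /orP[/eqP-> Kn En|ni Ki Ei]; last by right; exists i.
  by left; split => //; exact/asboolP.
Qed.

Lemma hit_cell K s : hit K s -> exists2 i, K i & cell s `<=` E i.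
Proof.
elim: s => //= c s ih [[cT Ks]|/ih[i Ki si]].
  by exists (size s) => //; rewrite cT => x [].
by exists i => // x [/si].
Qed.

(** Converse of [hit_cell]. Nonemptiness is essential: an empty cell is contained in every [E i],
    whatever its digits. *)
Lemma cell_hit K s i : cell s !=set0 -> (i < size s)%N -> K i ->
  cell s `<=` E i -> hit K s.
Proof.
move=> [x sx] si Ki sE; have /cellP <- := sx.
by apply/hit_digits; exists i; split => //; exact: sE.
Qed.

(* [lr] cuts out of each fibre {y} x [0, 1] an interval whose length is the
   conditional probability of [cell s] at y.  Splitting these intervals
   recursively realizes [b] on Y x [0, 1]: a point of the strip follows a branch
   of the binary tree of cells, which shrinks to its image in Z. *)
Definition fits s (lr : (Y -> R) * (Y -> R)) : Prop :=
  [/\ measurable_fun setT lr.1, measurable_fun setT lr.2,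
      forall y, 0 <= lr.1 y /\ lr.1 y <= lr.2 y <= 1 &
      forall B, measurable B ->
        (b (cell s) B)%:E = (\int[Q]_(y in B) (lr.2 y - lr.1 y)%:E)%E].

Lemma fits_nil : fits [::] (cst 0, cst 1).
Proof.
split => //= [y|B mB]; first by split; rewrite ?lexx ?ler01.
rewrite (eq_integral (cst 1%:E)); last by move=> y _; rewrite subr0.
by rewrite integral_cst// mul1e (bimeasureTl bb)// fineK// fin_num_measure.
Qed.

(** Given y, the mass of the subcell has a density [a] bounded by the length r - l of the parent
    interval. The true child takes [l, l + a) and the false child the rest. *)
Lemma fits_split s lr : fits s lr -> exists c,
  fits (true :: s) (lr.1, c) /\ fits (false :: s) (c, lr.2).
Proof.
case: lr => l r [/= ml mr lr bs].
have mc := measurable_cell s.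
have mT := measurable_cell (true :: s).
have mF := measurable_cell (false :: s).
have cD B : measurable B ->
    b (cell s) B = b (cell (true :: s)) B + b (cell (false :: s)) B.
  move=> mB; rewrite -(bimeasureUl bb)//=.
    by rewrite -setIUr setUv setIT.
  by rewrite setIACA setICr setI0.
have mw : measurable_fun setT (fun y => r y - l y) by exact: measurable_funB.
have w01 y : 0 <= r y - l y <= 1 by have [? /andP[? ?]] := lr y; lra.
have [B mB|a [ma a0 aE]] := exists_density (bimeasure_right bb mT) mw w01.
  rewrite -bs// lee_fin cD// lerDl; exact: (bimeasure_ge0 bb).
have mla : measurable_fun setT (fun y => l y + a y) by exact: measurable_funD.
exists (fun y => l y + a y); split; split => //=.
- by move=> y; have [? /andP[? ?]] := lr y; have := a0 y; lra.
- move=> B mB; rewrite aE//; apply: eq_integral => y _; congr EFin; ring.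
- by move=> y; have [? /andP[? ?]] := lr y; have := a0 y; lra.
move=> B mB; apply/eqP.
have m1 (k : Y -> R) : measurable_fun setT k -> measurable_fun B (EFin \o k).
  by move=> mk; apply/measurable_EFinP; exact: measurable_funTS.
have mra : measurable_fun setT (fun y => r y - (l y + a y)) by exact: measurable_funB.
have : (b (cell s) B)%:E = ((b (cell (true :: s)) B)%:E + \int[Q]_(y in B) (r y - (l y + a y))%:E)%E.
  rewrite bs// aE// -ge0_integralD//.
  - apply: eq_integral => y _; rewrite -EFinD; congr EFin; ring.
  - by move=> y _; rewrite lee_fin; case/andP: (a0 y).
  - exact: m1.
  - by move=> y _; rewrite lee_fin; case/andP: (a0 y); lra.
  - exact: m1.
rewrite cD//; case: (\int[Q]_(y in B) (r y - (l y + a y))%:E)%E => [v| |]//.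
by rewrite -EFinD => -[] /addrI ->.
Qed.

Lemma exists_tree : exists lr : seq bool -> (Y -> R) * (Y -> R),
  [/\ lr [::] = (cst 0, cst 1), forall s, fits s (lr s) &
    forall s, exists c,
      lr (true :: s) = ((lr s).1, c) /\ lr (false :: s) = (c, (lr s).2)].
Proof.
(* The cut is chosen for all pairs at once, with value 0 on those that do not fit, so that the tree
   is an ordinary fixpoint whose correctness is proved afterwards. *)
have [c cP] : exists c : seq bool * ((Y -> R) * (Y -> R)) -> Y -> R, forall p,
    fits p.1 p.2 -> fits (true :: p.1) (p.2.1, c p) /\
                    fits (false :: p.1) (c p, p.2.2).
  suff /choice[c cP] : forall p : seq bool * ((Y -> R) * (Y -> R)), exists c,
      fits p.1 p.2 -> fits (true :: p.1) (p.2.1, c) /\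
                      fits (false :: p.1) (c, p.2.2) by exists c.
  move=> p; have [fp|nfp] := pselect (fits p.1 p.2); last by exists (cst 0).
  by have [c cP] := fits_split fp; exists c.
pose fix lr s := if s is h :: s' then let p := lr s' in
  if h then (p.1, c (s', p)) else (c (s', p), p.2) else (cst 0 : Y -> R, cst 1 : Y -> R).
exists lr; split => //; last by move=> s; exists (c (s, lr s)).
elim=> [|h s ih]; first exact: fits_nil.
by have [] := cP (s, lr s) ih; case: h.
Qed.

Variables (U : probability R R) (lr : seq bool -> (Y -> R) * (Y -> R)).
Hypothesis UE : forall l r : R, 0 <= l -> l <= r -> r <= 1 ->
  U [set u | l <= u < r] = (r - l)%:E.
Hypotheses (lr0 : lr [::] = (cst 0, cst 1)) (lr_fits : forall s, fits s (lr s)).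
Hypothesis lr_split : forall s, exists c,
  lr (true :: s) = ((lr s).1, c) /\ lr (false :: s) = (c, (lr s).2).

Let mu : probability (Y * R)%type R := (Q \x U)%E.

(** The two children of a word share an endpoint, the upper end of the true child; comparing the
    height [w.2] with it selects one of them. *)
Fixpoint branch n (w : Y * R) : seq bool :=
  if n is n'.+1 then
    let s := branch n' w in (w.2 < (lr (true :: s)).2 w.1) :: s
  else [::].

Lemma size_branch n w : size (branch n w) = n.
Proof. by elim: n => //= n ->. Qed.

Definition strip : set (Y * R) := [set w | 0 <= w.2 < 1].

Lemma branch_lr s w : strip w ->
  branch (size s) w = s <-> (lr s).1 w.1 <= w.2 < (lr s).2 w.1.
Proof.
rewrite /strip /= => Vw; elim: s => [|h s ih] /=; first by rewrite lr0.
have [c [lrT lrF]] := lr_split s.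
have [_ _ /(_ w.1)[_ /andP[lc _]] _] := lr_fits (true :: s).
have [_ _ /(_ w.1)[_ /andP[cr _]] _] := lr_fits (false :: s).
rewrite lrT/= in lc; rewrite lrF/= in cr.
split=> [[hE ps]|].
  have /andP[l1 r1] := ih.1 ps; move: hE; rewrite ps lrT/=.
  by case: h; rewrite ?lrT ?lrF/=; [move=> -> |move/negbT; rewrite -leNgt => ->];
    rewrite ?l1 ?r1.
case: h; rewrite ?lrT ?lrF/= => /andP[l1 r1].
  have -> : branch (size s) w = s by apply/ih; rewrite l1 (lt_le_trans r1).
  by rewrite lrT/= r1.
have -> : branch (size s) w = s by apply/ih; rewrite r1 (le_trans lc).
by rewrite lrT/= ltNge l1.
Qed.

Lemma measurable_branch_cell s :
  measurable (strip `&` [set w | branch (size s) w = s]).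
Proof.
rewrite (_ : _ `&` _ = strip `&` ([set w | (lr s).1 w.1 <= w.2] `&`
    [set w | w.2 < (lr s).2 w.1])); last first.
  apply/seteqP; split=> w [Vw] /=; first by move/(branch_lr s Vw)/andP.
  by move/andP => ?; split => //; exact/branch_lr.
have [ml mr _ _] := lr_fits s.
have m1 : measurable_fun [set: Y * R] (fun w => (lr s).1 w.1).
  exact: (measurableT_comp ml measurable_fst).
have m2 : measurable_fun [set: Y * R] (fun w => (lr s).2 w.1).
  exact: (measurableT_comp mr measurable_fst).
have m0 : measurable_fun [set: Y * R] (fun w => w.2) by exact: measurable_snd.
have le (f g : Y * R -> R) : measurable_fun setT f -> measurable_fun setT g ->
    measurable [set w | f w <= g w].
  by move=> mf mg; rewrite -[X in measurable X]setTI; exact: measurable_fun_le.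
have lt (f g : Y * R -> R) : measurable_fun setT f -> measurable_fun setT g ->
    measurable [set w | f w < g w].
  move=> mf mg; rewrite (_ : [set w | _] = ~` [set w | g w <= f w]).
    by apply: measurableC; exact: le.
  apply/seteqP; split=> w /=; first by rewrite ltNge => /negP.
  by move/negP; rewrite -ltNge.
rewrite (_ : strip = [set w | cst 0 w <= w.2] `&` [set w | w.2 < cst 1 w]).
  by apply: measurableI; apply: measurableI; [exact: le|exact: lt|exact: le|exact: lt].
by apply/seteqP; split=> w /=; rewrite /strip/= => /andP.
Qed.

(** An event of finite depth has the same mass for the digits of a point of Z, measured by [b], as
    for the branch in the strip, measured by [mu]. The induction is on the number [k] of digits
    still free; with none left, this is [fits]. *)
Lemma branch_transfer k s (Psi : seq bool -> Prop) :
  let A := [set x | cell s x /\ Psi (digits (k + size s) x)] in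
  let D := [set w | [/\ strip w, branch (size s) w = s & Psi (branch (k + size s) w)]] in
  [/\ measurable A, measurable D & forall B, measurable B ->
    mu (D `&` [set w | B w.1]) = (b A B)%:E].
Proof.
elim: k s => [|k ih] s A D.
  have [PsiT|PsiF] := pselect (Psi s); last first.
    have -> : A = set0.
      by apply/seteqP; split=> // x [/cellP sx]; rewrite add0n sx.
    have -> : D = set0 by apply/seteqP; split=> // x [_]; rewrite add0n => ->.
    split => // B mB; rewrite set0I measure0.
    by rewrite (additive_below0 (bimeasure_left bb mB)).
  have -> : A = cell s.
    apply/seteqP; split=> x; first by case.
    by rewrite /A /= add0n => sx; split => //; move/cellP : sx => ->.
  have DE : D = strip `&` [set w | branch (size s) w = s].
    apply/seteqP; split=> x; first by case.
    by move=> [Vx sx]; rewrite /D/= add0n sx.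
  split; [exact: measurable_cell|rewrite DE; exact: measurable_branch_cell|].
  move=> B mB; have [_ _ lr01 ->//] := lr_fits s.
  rewrite -(between_measure Q UE lr01 mB) -[RHS]/(mu _); congr (mu _); apply/seteqP; split=> w.
    by rewrite DE => -[[Vw /(branch_lr s Vw)]].
  rewrite DE => -[Bw lw]; split => //=.
  have Vw : strip w.
    have [? /andP[_ ?]] := lr01 w.1; have /andP[? ?] := lw.
    by rewrite /strip/=; apply/andP; split; [apply: le_trans|apply: lt_le_trans]; eauto.
  by split=> //; exact/branch_lr.
have [mA1 mD1 muD1] := ih (true :: s); have [mA2 mD2 muD2] := ih (false :: s).
set A1 := [set x | _] in mA1 muD1; set D1 := [set w | _] in mD1 muD1.
set A2 := [set x | _] in mA2 muD2; set D2 := [set w | _] in mD2 muD2.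
have kE c : (k + size (c :: s) = k.+1 + size s)%N by rewrite addSnnS.
have AE : A = A1 `|` A2.
  rewrite /A1 /A2 !kE; apply/seteqP; split=> x.
    move=> [sx Px]; have [Ex|Ex] := pselect (E (size s) x); [left|right];
      by split => //; split.
  by move=> [[[sx _] Px]|[[sx _] Px]].
have DE : D = D1 `|` D2.
  rewrite /D1 /D2 !kE; apply/seteqP; split=> w.
    move=> [Vw sw Pw]; case pE : (w.2 < (lr (true :: s)).2 w.1); [left|right];
      by split => //=; rewrite sw pE.
  by move=> [[Vw [_ sw] Pw]|[Vw [_ sw] Pw]].
have A0 : A1 `&` A2 = set0 by apply/seteqP; split=> // x [[[_ ?] _] [[_ ?] _]].
have D0 : D1 `&` D2 = set0.
  by apply/seteqP; split=> // w [[_ /= [e1 _] _] [_ [e2 _] _]]; rewrite e1 in e2.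
rewrite AE DE; split; [exact: measurableU|exact: measurableU|move=> B mB].
have mB' : measurable [set w : Y * R | B w.1] := measurable_preimageT measurable_fst mB.
rewrite setIUl measureU//; [|exact: measurableI..|].
  by rewrite (bimeasureUl bb)// EFinD; congr (_ + _)%E; [exact: muD1|exact: muD2].
by rewrite setIACA D0 set0I.
Qed.

End binary_tree.

Lemma probability_bigcap1 d (X : measurableType d) (R : realType)
    (P : probability X R) (F : (set X)^nat) :
  (forall i, measurable (F i)) -> (forall i, P (F i) = 1%E) ->
  P (\bigcap_i F i) = 1%E.
Proof.
move=> mF F1; have mI : measurable (\bigcap_i F i) by exact: bigcapT_measurable.
rewrite -[\bigcap_i F i]setCK probability_setC; last exact: measurableC.
rewrite (_ : P _ = 0%E) ?sube0//; apply/eqP; rewrite -measure_le0.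
have mFC i : measurable (~` F i) by exact: measurableC.
have FC0 i : P (~` F i) = 0%E by rewrite probability_setC// F1 subee.
rewrite setC_bigcap.
have /le_trans -> // : (P (\bigcup_i ~` F i) <= \sum_(0 <= i <oo) P (~` F i))%E.
  by apply: measure_sigma_subadditive => //; exact: bigcupT_measurable.
by rewrite eseries0.
Qed.

(** Almost every w in the strip follows a branch whose cells shrink to a point [G w] of Z, and the
    coupling is the law of (G w, w.1). An open W contains [G w] exactly when the branch hits [J W],
    which gives the masses for open W; they determine all others. *)
Theorem exists_coupling d1 d2 (Z : measurableType d1) (Y : measurableType d2)
    (R : realType) (P : probability Z R) (Q : probability Y R) b :
  standard_borel R Z -> bimeasure P Q b ->
  exists lam : probability (Z * Y)%type R,
    forall A B, measurable A -> measurable B -> lam (A `*` B) = (b A B)%:E.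
Proof.
move=> sbZ bb; have [E [lev [opens [J basis]]]] := standard_borel_basis sbZ.
have mE := basis_measurable basis.
have [U UE] := exists_uniform R.
have [lr [lr0 lr_fits lr_split]] := exists_tree bb mE.
pose mu : probability (Y * R)%type R := (Q \x U)%E.
pose st n w := branch lr n w.
pose V : set (Y * R) := strip (Y := Y) (R := R).
have tr n (Psi : seq bool -> Prop) :
  let A := [set x | Psi (digits E n x)] in
  let D := [set w | V w /\ Psi (st n w)] in
  [/\ measurable A, measurable D & forall B, measurable B ->
    mu (D `&` [set w | B w.1]) = (b A B)%:E].
  move=> A D.
  have [] := branch_transfer bb mE UE lr0 lr_fits lr_split n [::] Psi.
  rewrite addn0 (_ : [set x | _] = A); last by apply/seteqP; split=> x // [].
  rewrite (_ : [set w | _] = D)//.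
  by apply/seteqP; split=> w []; [move=> Vw _|move=> Vw].
pose H K : set (Y * R) := [set w | V w /\ exists n, hit K (st n w)].
have HE K : H K = \bigcup_n [set w | V w /\ hit K (st n w)].
  by apply/seteqP; split=> w; [move=> [Vw [n h]]; exists n|move=> [n _ [Vw h]]; split => //; exists n].
have mH K : measurable (H K).
  by rewrite HE; apply: bigcupT_measurable => n; have [] := tr n (hit K).
have muH K B : measurable B ->
    mu (H K `&` [set w | B w.1]) = (b (\bigcup_(i in K) E i) B)%:E.
  move=> mB; have mB' : measurable [set w : Y * R | B w.1] :=
    measurable_preimageT measurable_fst mB.
  pose F n := [set x | hit K (digits E n x)].
  have mF n : measurable (F n) by have [] := tr n (hit K).
  have ndF : nondecreasing_seq F.
    by apply/nondecreasing_seqP => n; apply/subsetPset => x /=; right.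
  have FE : \bigcup_n F n = \bigcup_(i in K) E i.
    apply/seteqP; split=> x.
      by move=> [n _ /hit_digits[i [_ Ki Ei]]]; exists i.
    by move=> [i Ki Ei]; exists i.+1 => //; apply/hit_digits; exists i.
  pose D n := [set w | V w /\ hit K (st n w)] `&` [set w | B w.1].
  have mD n : measurable (D n) by apply: measurableI => //; have [] := tr n (hit K).
  have ndD : nondecreasing_seq D.
    by apply/nondecreasing_seqP => n; apply/subsetPset => w [[Vw h] Bw]; split => //; split => //=; right.
  have c1 : mu (D n) @[n --> \oo] --> mu (\bigcup_n D n).
    by apply: nondecreasing_cvg_mu => //; exact: bigcupT_measurable.
  rewrite HE setI_bigcupl -FE; apply: (cvg_unique _ c1) => //.
  rewrite (_ : (fun n => mu (D n)) = (fun n => (b (F n) B)%:E)).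
    apply: cvg_EFin; first exact: nearW.
    exact: (additive_below_cvg (bimeasure_left bb mB)).
  by apply/funext => n; have [_ _ ->] := tr n (hit K).
(* The hypotheses of [basis_limit]: the branch enters sets of every level and all its cells are
   nonempty. Both events have full mass because they hold for the digits of every actual point of
   Z. *)
pose good : set (Y * R) := \bigcap_m H (lev @^-1` [set m]) `&`
  \bigcap_n [set w | V w /\ cell E (st n w) !=set0].
have mgood : measurable good.
  apply: measurableI; apply: bigcapT_measurable => n; first exact: mH.
  by have [] := tr n (fun s => cell E s !=set0).
have bT : b setT setT = 1 by rewrite (bimeasureTl bb)// probability_setT.
have setT1 : [set w : Y * R | [set: Y] w.1] = setT by apply/seteqP.
have good1 : mu good = 1%E.
  have m1 : mu (\bigcap_m H (lev @^-1` [set m])) = 1%E.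
    apply: probability_bigcap1 => // m.
    rewrite -[H _]setIT -setT1 muH// -bT; congr (b _ _)%:E.
    by apply/seteqP; split=> // x _; have [i im Ei] := basis_cover basis m x; exists i.
  have m2 : mu (\bigcap_n [set w | V w /\ cell E (st n w) !=set0]) = 1%E.
    apply: probability_bigcap1 => [n|n]; have [_ mD muD] := tr n (fun s => cell E s !=set0) => //.
    rewrite -[X in mu X]setIT -setT1 muD// -bT; congr (b _ _)%:E.
    by apply/seteqP; split=> // x _; exists x; exact: cell_digits.
  have := @probability_bigcap1 _ _ _ mu (bigcap2 (\bigcap_m H (lev @^-1` [set m])) (\bigcap_n [set w | V w /\ cell E (st n w) !=set0])).
  rewrite bigcap2E; apply.
    case=> [|[|n]] /=.
    - by apply: bigcapT_measurable => n; exact: mH.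
    - by apply: bigcapT_measurable => n; have [] := tr n (fun s => cell E s !=set0).
    - exact: measurableT.
  by case=> [|[|n]] //=; exact: probability_setT.
have mugood D : measurable D -> mu (D `&` good) = mu D.
  move=> mD; apply/esym/(etrans (measureDI mu mD mgood)).
  rewrite -[RHS]add0e; congr (_ + _)%E; apply/eqP; rewrite -measure_le0.
  have <- : mu (~` good) = 0%E by rewrite probability_setC// good1 subee.
  apply: le_measure; rewrite ?inE; [exact: measurableD|exact: measurableC|].
  by rewrite setDE; exact: subIsetr.
have cell_dec n k w : cell E (st (k + n)%N w) `<=` cell E (st n w).
  by elim: k => // k ih; rewrite addSn => x [/ih].
have /choice[g gP] : forall w, exists x, good w ->
    forall W, opens W -> (W x <-> exists n, hit (J W) (st n w)).
  move=> w; have [gw|] := pselect (good w); last by exists point.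
  have [gH gC] := gw.
  have [|||x xP] := basis_limit basis (C := fun n => cell E (st n w)).
  - by move=> n; have [] := gC n Logic.I.
  - by move=> n; exact: (cell_dec n 1%N).
  - move=> m; have [_ [n /(hit_cell E)[i im sE]]] := gH m Logic.I.
    by exists n, i.
  exists x => _ W oW; rewrite xP//; split=> [[n [i [Ji nE]]]|[n /(hit_cell E)[i Ji nE]]].
    (* At this depth the word is long enough to contain digit i, and its cell is still inside the
       cell of depth n. *)
    exists (i.+1 + n)%N; apply: (@cell_hit _ _ E _ _ i).
    + by have [] := gC (i.+1 + n)%N Logic.I.
    + by rewrite size_branch addSn ltnS leq_addr.
    + exact: Ji.
    + by apply: subset_trans nE; exact: cell_dec.
  by exists n, i.
pose G w := if `[< good w >] then g w else point.
have GE W : opens W -> G @^-1` W `&` good = H (J W) `&` good.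
  move=> oW; apply/seteqP; split=> w [] + gw; rewrite /preimage/= /G asboolT//.
    by move/(gP _ gw _ oW); split => //; split => //; have [] := gw.2 0%N Logic.I.
  by move=> [_ h]; split => //; exact/(gP _ gw _ oW).
have mG : measurable_fun setT G.
  apply: (@measurability _ _ (Y * R)%type Z setT G opens); first exact: basis_opens basis.
  move=> _ [W oW <-]; rewrite setTI -(setIT (G @^-1` W)) -(setUv good) setIUr GE//.
  apply: measurableU; first exact: measurableI.
  have [Op|Op] := pselect (W point).
    rewrite (_ : _ `&` _ = ~` good); first exact: measurableC.
    by apply/seteqP; split=> w; [case|move=> gw; split => //; rewrite /preimage/= /G asboolF].
  rewrite (_ : _ `&` _ = set0); first exact: measurable0.
  by apply/seteqP; split=> // w [+ gw]; rewrite /preimage/= /G asboolF.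
have mG1 : measurable_fun setT (fun w => (G w, w.1)).
  exact: (measurable_fun_pair mG measurable_fst).
have [lam lamE] := exists_pushforward mu mG1.
exists lam => A B mA mB.
have lamO W : opens W -> lam (W `*` B) = (b W B)%:E.
  move=> oW; have mW : measurable W.
    by rewrite (basis_opens basis); exact: sub_sigma_algebra.
  have mB' : measurable [set w : Y * R | B w.1] :=
    measurable_preimageT measurable_fst mB.
  rewrite lamE (_ : _ @^-1` _ = G @^-1` W `&` [set w | B w.1])//.
  rewrite -mugood; last by apply: measurableI => //; exact: measurable_preimageT.
  rewrite setIAC GE// setIAC mugood; last exact: measurableI.
  by rewrite muH// [in RHS](basis_openE basis oW).
have [P' P'E] := exists_pushforward lam measurable_fst.
have mTB : measurable ([set: Z] `*` B) by exact: measurableX.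
rewrite -[LHS]fineK ?fin_num_measure//; last exact: measurableX.
congr EFin.
have lamB : additive_below P' (fun A => fine (lam (A `*` B))).
  have -> : (fun A => fine (lam (A `*` B))) =
      (fun A => fine (lam (fst @^-1` A `&` ([set: Z] `*` B)))).
    apply/funext => A'; congr (fine (lam _)).
    by apply/seteqP; split=> -[z y]; [case|move=> [? [_ ?]]].
  apply: (additive_below_preimage measurable_fst (fun E mE => esym (P'E E))
    (additive_belowI mTB (additive_below_probability lam))).
apply: (additive_below_unique (basis_opens basis) (basis_opensI basis)
  (basis_opensT basis) lamB (bimeasure_left bb mB)) mA.
by move=> W /[!inE] oW; rewrite lamO.
Qed.

(** * Extreme points by successive maximization *)

Section extreme.
Context {R : realType} {X : Type}.
Variables (L : (nat -> R) -> R) (F : set (X -> R)) (c : nat -> X).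
Hypotheses (meanL : is_mean L)
  (Lle : forall a b, bounded_seq a -> bounded_seq b ->
    (\forall n \near \oo, a n <= b n) -> L a <= L b)
  (F0 : F !=set0) (F01 : forall b, F b -> forall x, 0 <= b x <= 1)
  (FL : forall b : nat -> X -> R, (forall n, F (b n)) ->
    F (fun x => L (b ^~ x))).

(* Successive faces of F: those maximizing the evaluation at c 0, among them
   those maximizing the evaluation at c 1, and so on. *)
Fixpoint face n : set (X -> R) :=
  if n is n'.+1 then
    [set b | face n' b /\ forall b', face n' b' -> b' (c n') <= b (c n')]
  else F.

Let faceF n : face n `<=` F.
Proof. by elim: n => //= n ih b [/ih]. Qed.

Let face_le m n : (m <= n)%N -> face n `<=` face m.
Proof.
move=> /subnK <-; elim: (n - m)%N => [//|k ih] b; rewrite addSn => -[bk _].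
exact: ih.
Qed.

Let bounded_face n (b : nat -> X -> R) x : (forall k, face n (b k)) ->
  bounded_seq (b ^~ x).
Proof. by move=> nb; apply: bounded_seq01 => k; exact/F01/faceF/nb. Qed.

Let face_limit n (b : nat -> X -> R) : (forall k, face n (b k)) ->
  face n (fun x => L (b ^~ x)).
Proof.
elim: n => [|n ih] nb; first exact: FL.
have nb' k : face n (b k) by case: (nb k).
split=> [|b' fb']; first exact: ih.
rewrite -(mean_cst meanL (b' _)); apply: mean_le => //.
- exact: bounded_seq_cst.
- exact: bounded_face nb'.
- by move=> k; have [_] := nb k; exact.
Qed.

Let face_nonempty n : face n !=set0.
Proof.
elim: n => [//|n [b0 fb0]].
pose E := [set b (c n) | b in face n].
have supE : has_sup E.
  split; first by exists (b0 (c n)), b0.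
  by exists 1 => _ [b fb <-]; have /andP[] := F01 (faceF fb) (c n).
have : forall k : nat, exists b, face n b /\ sup E - k.+1%:R^-1 < b (c n).
  move=> k; have [|_ [b fb <-] lb] := sup_adherent (eps := k.+1%:R^-1) _ supE => //.
  by exists b.
move=> /choice[b bP]; have fb k : face n (b k) by case: (bP k).
exists (fun x => L (b ^~ x)); split; first exact: face_limit.
move=> b' fb'; apply: (@le_trans _ _ (sup E)).
  by apply: ub_le_sup; [case: supE|exists b'].
apply/ler_addgt0Pl => e e0; rewrite -lerBlDl -[leLHS](mean_cst meanL).
apply: Lle; [exact: bounded_seq_cst|exact: bounded_face fb|].
near=> k; have [_ /ltW] := bP k; apply: le_trans; rewrite lerD2l lerN2.
rewrite -[leRHS]invrK lef_pV2 ?posrE ?invr_gt0//.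
rewrite (@le_trans _ _ k%:R)// ?ler_nat//.
near: k; exact: nbhs_infty_ger.
Unshelve. all: by end_near. Qed.

Lemma exists_extreme : exists b,
  [/\ F b, forall b', F b' -> b' (c 0%N) <= b (c 0%N) &
    forall b1 b2 t, F b1 -> F b2 -> 0 < t < 1 ->
      (forall i, b (c i) = t * b1 (c i) + (1 - t) * b2 (c i)) ->
      forall i, b1 (c i) = b2 (c i)].
Proof.
have /choice[b fb] := face_nonempty.
pose binf x := L (b ^~ x).
have finf n : face n binf.
  (* For k >= n the term is unchanged, so [L] gives the same value, while now every term lies in
     [face n]. *)
  have -> : binf = fun x => L (fun k => b (maxn n k) x).
    apply/funext => x; have bm : bounded_seq (fun k => b (maxn n k) x).
      by apply: (@bounded_face n (fun k => b (maxn n k))) => k; apply: face_le (fb _); exact: leq_maxl.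
    have bb : bounded_seq (b ^~ x).
      by apply: (@bounded_face 0%N b) => k; exact: (@faceF k).
    apply/le_anti/andP; split; apply: Lle => //.
      by exists n => // k /= nk; rewrite (maxn_idPr nk).
    by exists n => // k /= nk; rewrite (maxn_idPr nk).
  by apply: face_limit => k; apply: face_le (fb _); exact: leq_maxl.
exists binf; split; first exact: finf 0%N.
  by have [_] := finf 1%N.
move=> b1 b2 t Fb1 Fb2 /andP[t0 t1] bE.
have maxE n b' : face n b' -> b' (c n) <= binf (c n).
  by have [_] := finf n.+1; exact.
have eqE n : face n b1 -> face n b2 ->
    b1 (c n) = binf (c n) /\ b2 (c n) = binf (c n).
  move=> /maxE le1 /maxE le2; have := bE n.
  set x := b1 _ in le1 *; set y := b2 _ in le2 *; set z := binf _ in le1 le2 * => zE.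
  have e1 : t * (z - x) + (1 - t) * (z - y) = 0 by rewrite {1 2}zE; ring.
  have p1 : 0 <= t * (z - x) by rewrite mulr_ge0 ?subr_ge0// ltW.
  have p2 : 0 <= (1 - t) * (z - y) by rewrite mulr_ge0 ?subr_ge0// ltW.
  have : t * (z - x) = 0 by lra.
  have : (1 - t) * (z - y) = 0 by lra.
  move=> /eqP; rewrite mulf_eq0 !subr_eq0 (gt_eqF t1)/= => /eqP ->.
  by move=> /eqP; rewrite mulf_eq0 (gt_eqF t0)/= subr_eq0 => /eqP ->.
have key n : face n b1 /\ face n b2.
  elim: n => [//|n [f1 f2]]; have [e1 e2] := eqE _ f1 f2.
  by split; split => // b' fb'; rewrite ?e1 ?e2; exact: maxE.
by move=> i; have [f1 f2] := key i; have [-> ->] := eqE _ f1 f2.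
Qed.

End extreme.

(** * Countable generating pi-systems *)

Section countably_generated.

(** Closure under intersection makes agreement of measures on countably many sets imply agreement on
    all measurable sets. *)
Definition countably_generated d (X : measurableType d) : Prop :=
  exists a : nat -> set X, [/\ measurable = <<s range a >>,
    setI_closed (range a) & range a setT].

Lemma measurable_countably_generated d (X : measurableType d) (a : nat -> set X) i :
  measurable = <<s range a >> -> measurable (a i).
Proof. by move=> ->; apply: sub_sigma_algebra; exists i. Qed.

Lemma standard_borel_countably_generated (R : realType) d (X : measurableType d) :
  standard_borel R X -> countably_generated X.
Proof.
move=> /standard_borel_basis[E [lev [opens [J basis]]]].
have mE := basis_measurable basis.
pose inter (s : seq nat) : set X := foldr (fun j A => E j `&` A) setT s.
have interE s t : inter s `&` inter t = inter (s ++ t).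
  by elim: s => [|j s ih] /=; rewrite ?setTI// -setIA ih.
have m_inter s : measurable (inter s).
  by elim: s => [|j s ih] /=; [exact: measurableT|exact: measurableI].
pose a (i : nat) : set X := if (unpickle i : option (seq nat)) is Some s then inter s else setT.
have aE s : a (pickle s) = inter s by rewrite /a pickleK.
exists a; split.
- apply/seteqP; split; last first.
    apply: smallest_sub; first exact: sigma_algebra_measurable.
    by move=> _ [i _ <-]; rewrite /a; case: (unpickle i).
  rewrite (basis_opens basis); apply: smallest_sub; first exact: smallest_sigma_algebra.
  move=> V oV; rewrite (basis_openE basis oV) bigcup_mkcond.
  have [h0 hC hU] := smallest_sigma_algebra setT (range a).
  apply: hU => i; case: ifPn => // _.
  by apply: sub_sigma_algebra; exists (pickle [:: i]); rewrite ?aE//= setIT.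
- move=> _ _ [i _ <-] [j _ <-]; rewrite /a.
  case: (unpickle i) (unpickle j) => [s|] [t|].
  + by exists (pickle (s ++ t)); rewrite ?pickleK.
  + by exists (pickle s); rewrite ?pickleK ?setIT.
  + by exists (pickle t); rewrite ?pickleK ?setTI.
  + by exists (pickle ([::] : seq nat)); rewrite ?pickleK ?setIT.
- by exists (pickle ([::] : seq nat)); rewrite ?pickleK.
Qed.

Lemma countably_generated_prodspace (I : finType) (d : I -> measure_display)
    (Y : forall i, measurableType (d i)) :
  (forall i, countably_generated (Y i)) -> countably_generated (prodspace Y).
Proof.
move=> cY; have [a aP] : exists a : forall i, nat -> set (Y i), forall i,
    [/\ measurable = <<s range (a i) >>, setI_closed (range (a i)) & range (a i) setT].
  by exists (fun i => sval (cid (cY i))) => i; exact: (svalP (cid (cY i))).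
have ma i n : measurable (a i n).
  by apply: measurable_countably_generated; have [] := aP i.
have [t tE] : exists t : I -> nat, forall i, a i (t i) = setT.
  have h i : exists n, a i n = setT by have [_ _ [n _ ?]] := aP i; exists n.
  by exists (fun i => sval (cid (h i))) => i; exact: (svalP (cid (h i))).
pose rect (f : {ffun I -> nat}) : set (prodspace Y) := rectangle (fun i => a i (f i)).
pose b (n : nat) := if (unpickle n : option {ffun I -> nat}) is Some f then rect f else setT.
have bE f : b (pickle f) = rect f by rewrite /b pickleK.
have rectT : rect [ffun i => t i] = setT.
  by apply/seteqP; split=> // y _ i; rewrite ffunE tE.
have b_rect n : exists f, b n = rect f.
  by rewrite /b; case: (unpickle n) => [f|]; [exists f|exists [ffun i => t i]].
exists b; split.
- apply/seteqP; split; last first.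
    apply: smallest_sub; first exact: sigma_algebra_measurable.
    move=> _ [n _ <-]; have [f ->] := b_rect n; exact: measurable_rectangle.
  apply: smallest_sub; first exact: smallest_sigma_algebra.
  move=> _ [i _ [B mB <-]]; rewrite setTI.
  have [h0 hC hU] := smallest_sigma_algebra setT (range b).
  pose G : set_system (Y i) := [set B | <<s range b >> ((fun y : prodspace Y => y i) @^-1` B)].
  suff : measurable `<=` G by exact.
  have [-> _ _] := aP i; apply: smallest_sub.
    split; rewrite /G /=.
    + by rewrite preimage_set0.
    + by move=> A /hC; rewrite !setTD preimage_setC.
    + by move=> A hA; rewrite preimage_bigcup; exact: hU.
  move=> _ [n _ <-]; apply: sub_sigma_algebra.
  pose f := [ffun j => if j == i then n else t j].
  exists (pickle f) => //; rewrite bE; apply/seteqP; split=> y.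
    by move=> /(_ i); rewrite ffunE eqxx.
  by move=> yi j; rewrite ffunE; case: eqVneq => [->//|_]; rewrite tE.
- move=> _ _ [m _ <-] [n _ <-]; have [f ->] := b_rect m; have [g ->] := b_rect n.
  have h i : exists k, a i k = a i (f i) `&` a i (g i).
    have [_ aI _] := aP i.
    by have [k _ kE] := aI _ _ (imageT (a i) (f i)) (imageT (a i) (g i)); exists k.
  pose k : {ffun I -> nat} := [ffun i => sval (cid (h i))].
  exists (pickle k) => //; rewrite bE /rect rectangleI; congr rectangle.
  by apply: functional_extensionality_dep => i; rewrite ffunE; exact: (svalP (cid (h i))).
- by exists (pickle [ffun i => t i]); rewrite ?bE.
Qed.

End countably_generated.

(** * Ergodic joinings with large mass on a given rectangle *)

Section extremal_joining.
Context {R : realType}.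
Variables (Z W : system R).
Let P := sys_prob Z.
Let Q := sys_prob W.
Let T := @sys_map R Z.
Let S := @sys_map R W.
Let TS := @sys_map R (system_pair Z W).
Hypotheses (mT : measurable_fun setT T) (mS : measurable_fun setT S).
Hypotheses (PT : invariant_measure P T) (QS : invariant_measure Q S).
Hypotheses (ergT : ergodic P T) (ergS : ergodic Q S).
Hypotheses (sbZ : standard_borel R Z) (cgW : countably_generated W).

Definition invariant_bimeasure (b : set Z -> set W -> R) :=
  bimeasure P Q b /\ forall A B, measurable A -> measurable B ->
    b (T @^-1` A) (S @^-1` B) = b A B.

Let mTS : measurable_fun setT TS := measurable_pair_map mT mS.

Lemma invariant_coupling b (lam : probability (Z * W)%type R) :
  invariant_bimeasure b ->
  (forall A B, measurable A -> measurable B -> lam (A `*` B) = (b A B)%:E) ->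
  @joining R Z W lam.
Proof.
move=> [bb bI] lamE; split.
- move=> A mA; rewrite (_ : _ @^-1` _ = A `*` setT).
    by rewrite lamE// (bimeasureT bb)// fineK// fin_num_measure.
  by apply/seteqP; split=> -[z y] //; case.
- move=> B mB; rewrite (_ : _ @^-1` _ = setT `*` B).
    by rewrite lamE// (bimeasureTl bb)// fineK// fin_num_measure.
  by apply/seteqP; split=> -[z y] //; case.
move=> C mC; have [lam' lamE'] := exists_pushforward lam mTS.
rewrite -lamE'; apply: probability_unique_prod mC => A B mA mB.
rewrite lamE' (_ : _ @^-1` _ = (T @^-1` A) `*` (S @^-1` B))// !lamE ?bI//.
- exact: measurable_preimageT.
- exact: measurable_preimageT.
Qed.

Section conditioning.
Variables (lam : probability (Z * W)%type R) (C : set (Z * W)).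
Hypotheses (lamJ : @joining R Z W lam) (mC : measurable C).
Hypotheses (CTS : TS @^-1` C = C) (lamC : 0 < fine (lam C)).

Let f (D : set (Z * W)) : R := fine (lam (D `&` C)).

Let flam : additive_below lam f :=
  additive_belowI mC (additive_below_probability lam).

Let f_inv D : measurable D -> f (TS @^-1` D) = f D.
Proof.
move=> mD; have [_ _ lamI] := lamJ; rewrite /f -{1}CTS -preimage_setI.
by rewrite (lamI (D `&` C))//; exact: measurableI.
Qed.

Let f_fst A : measurable A -> f (A `*` setT) = fine (lam C) * fine (P A).
Proof.
move=> mA; have [lam1 _ _] := lamJ.
have fP : additive_below P (fun A => f (fst @^-1` A)).
  exact: additive_below_preimage measurable_fst lam1 flam.
have -> : A `*` [set: W] = fst @^-1` A by apply/seteqP; split=> -[z y] //; case.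
rewrite (ergodic_additive_below mT PT ergT fP)//.
  by rewrite preimage_setT /f setTI.
by move=> A' mA'; rewrite -[RHS]f_inv//; exact: (measurable_preimageT measurable_fst).
Qed.

Let f_snd B : measurable B -> f (setT `*` B) = fine (lam C) * fine (Q B).
Proof.
move=> mB; have [_ lam2 _] := lamJ.
have fQ : additive_below Q (fun B => f (snd @^-1` B)).
  exact: additive_below_preimage measurable_snd lam2 flam.
have -> : [set: Z] `*` B = snd @^-1` B by apply/seteqP; split=> -[z y] //; case.
rewrite (ergodic_additive_below mS QS ergS fQ)//.
  by rewrite preimage_setT /f setTI.
by move=> B' mB'; rewrite -[RHS]f_inv//; exact: (measurable_preimageT measurable_snd).
Qed.

(* Ergodicity of the two factors makes the conditioned measure a joining. *)
Lemma invariant_bimeasure_conditioned :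
  invariant_bimeasure (fun A B => (fine (lam C))^-1 * f (A `*` B)).
Proof.
split; first split.
- move=> A B mA mB; apply: mulr_ge0; first by rewrite invr_ge0 ltW.
  by have /andP[] := flam.1 _ (measurableX mA mB).
- move=> A A' B mA mA' mB AA'; rewrite -mulrDr -flam.2; [|exact: measurableX..|].
    congr (_ * f _); apply/seteqP; split=> -[z y] /=.
      by move=> [[Az|Az] By]; [left|right].
    by move=> [[Az By]|[Az By]]; split => //; [left|right].
  by rewrite -setXI AA' set0X.
- move=> A B B' mA mB mB' BB'; rewrite -mulrDr -flam.2; [|exact: measurableX..|].
    congr (_ * f _); apply/seteqP; split=> -[z y] /=.
      by move=> [Az [By|By]]; [left|right].
    by move=> [[Az By]|[Az By]]; split => //; [left|right].
  by rewrite -setXI BB' setX0.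
- by move=> A mA; rewrite f_fst// mulKf// gt_eqF.
- by move=> B mB; rewrite f_snd// mulKf// gt_eqF.
move=> A B mA mB; congr (_ * _); rewrite -[RHS]f_inv//; exact: measurableX.
Qed.

End conditioning.

Lemma exists_ergodic_joining_ge b A0 B0 : invariant_bimeasure b ->
  measurable A0 -> measurable B0 ->
  exists2 lam : probability (Z * W)%type R,
    @ergodic_joining R Z W lam & b A0 B0 <= fine (lam (A0 `*` B0)).
Proof.
move=> bI mA0 mB0.
have [L [meanL Lle]] := @exists_ultralimit R.
have [a [aE aI aT]] := standard_borel_countably_generated sbZ.
have [a' [a'E a'I a'T]] := cgW.
have ma i := measurable_countably_generated i aE.
have ma' i := measurable_countably_generated i a'E.
(* Values off the measurable pairs are fixed to 0, so that members of [F] take values in [0, 1] at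
   every pair, as [exists_extreme] requires. *)
pose F : set (set Z * set W -> R) :=
  [set b | invariant_bimeasure (fun A B => b (A, B)) /\
    forall A B, ~ (measurable A /\ measurable B) -> b (A, B) = 0].
pose trunc (b : set Z -> set W -> R) (p : set Z * set W) : R :=
  if `[< measurable p.1 /\ measurable p.2 >] then b p.1 p.2 else 0.
have truncE b1 A B : measurable A -> measurable B -> trunc b1 (A, B) = b1 A B.
  by move=> mA mB; rewrite /trunc asboolT.
have truncF b1 : invariant_bimeasure b1 -> F (trunc b1).
  move=> [bb binv]; split; last by move=> A B nAB; rewrite /trunc asboolF.
  split; first split.
  - by move=> A B mA mB; rewrite truncE// (bimeasure_ge0 bb).
  - by move=> A A' B mA mA' mB AA'; rewrite !truncE ?(bimeasureUl bb)//; exact: measurableU.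
  - by move=> A B B' mA mB mB' BB'; rewrite !truncE ?(bimeasureUr bb)//; exact: measurableU.
  - by move=> A mA; rewrite truncE// (bimeasureT bb).
  - by move=> B mB; rewrite truncE// (bimeasureTl bb).
  move=> A B mA mB; have mTA := measurable_preimageT mT mA.
  have mSB := measurable_preimageT mS mB.
  by rewrite !truncE// binv.
have F01 b1 : F b1 -> forall x, 0 <= b1 x <= 1.
  move=> [[bb _] b0] [A B]; have [[mA mB]|nAB] := pselect (measurable A /\ measurable B).
    have /andP[-> /le_trans->//] := (bimeasure_left bb mB).1 _ mA.
    by have /andP[] := fine_probability_le1 P mA.
  by rewrite b0// lexx ler01.
pose c (i : nat) : set Z * set W := if i is j.+1 then
  (if (unpickle j : option (nat * nat)) is Some (m, n) then (a m, a' n) else (A0, B0)) else (A0, B0).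
have FL (b1 : nat -> set Z * set W -> R) : (forall n, F (b1 n)) ->
    F (fun x => L (b1 ^~ x)).
  move=> Fb; have bd x : bounded_seq (b1 ^~ x) by apply: bounded_seq01 => n; exact: F01.
  have bm n : bimeasure P Q (fun A B => b1 n (A, B)) by have [[]] := Fb n.
  split; last first.
    move=> A B nAB; rewrite -[RHS](mean_cst meanL); congr L; apply/funext => n.
    by have [_ ->] := Fb n.
  split; first split.
  - move=> A B mA mB; rewrite -(mean_cst meanL 0); apply: mean_le => //.
      exact: bounded_seq_cst.
    by move=> n; exact: (bimeasure_ge0 (bm n)).
  - move=> A A' B mA mA' mB AA'; rewrite -(meanD meanL)//; congr L.
    by apply/funext => n; exact: (bimeasureUl (bm n)).
  - move=> A B B' mA mB mB' BB'; rewrite -(meanD meanL)//; congr L.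
    by apply/funext => n; exact: (bimeasureUr (bm n)).
  - move=> A mA; rewrite -[RHS](mean_cst meanL); congr L.
    by apply/funext => n; exact: (bimeasureT (bm n)).
  - move=> B mB; rewrite -[RHS](mean_cst meanL); congr L.
    by apply/funext => n; exact: (bimeasureTl (bm n)).
  move=> A B mA mB; congr L; apply/funext => n.
  by have [[_ binv] _] := Fb n; exact: binv.
have F0 : F !=set0 by exists (trunc b); exact: truncF.
have [bx [Fbx bx_max bx_ext]] := exists_extreme c meanL Lle F0 F01 FL.
have [bxI _] := Fbx.
have [lam lamE] := exists_coupling sbZ bxI.1.
have lamJ := invariant_coupling bxI lamE.
exists lam; last first.
  by rewrite lamE//= -(truncE b)//; exact: (bx_max _ (truncF _ bI)).
split => // C mC CTS.
have [lam0|lam0] := eqVneq (fine (lam C)) 0.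
  by left; rewrite -[LHS]fineK ?fin_num_measure// lam0.
have [lam1|lam1] := eqVneq (fine (lam C)) 1.
  by right; rewrite -[LHS]fineK ?fin_num_measure// lam1.
exfalso; set t := fine (lam C) in lam0 lam1.
have /andP[t0 t1] : 0 < t < 1.
  have /andP[t0 t1] := fine_probability_le1 lam mC.
  by rewrite !lt_neqAle t0 t1 eq_sym lam0 lam1.
have mCC : measurable (~` C) by exact: measurableC.
have tC : fine (lam (~` C)) = 1 - t.
  by rewrite probability_setC// fineB ?fin_num_measure.
have CCTS : TS @^-1` (~` C) = ~` C by rewrite -[in RHS]CTS.
have lamCC : 0 < fine (lam (~` C)) by rewrite tC subr_gt0.
pose g1 A B := (fine (lam C))^-1 * fine (lam (A `*` B `&` C)).
pose g2 A B := (fine (lam (~` C)))^-1 * fine (lam (A `*` B `&` ~` C)).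
have F1 : F (trunc g1) := truncF _ (invariant_bimeasure_conditioned lamJ mC CTS t0).
have F2 : F (trunc g2) := truncF _ (invariant_bimeasure_conditioned lamJ mCC CCTS lamCC).
have mc i : measurable (c i).1 /\ measurable (c i).2.
  by case: i => [|j]; rewrite /c; [|case: (unpickle j) => [[m n]|]]; split; rewrite /= ?ma ?ma'.
have dec A B : measurable A -> measurable B -> fine (lam (A `*` B)) =
    fine (lam (A `*` B `&` C)) + fine (lam (A `*` B `&` ~` C)).
  move=> mA mB; have mAB := measurableX mA mB.
  have mABC := measurableI _ _ mAB mC; have mABCC := measurableI _ _ mAB mCC.
  rewrite -fineD ?fin_num_measure// -measureU// -?setIUr ?setUv ?setIT//.
  by rewrite setIACA setICr setI0.
(* By extremality the measures conditioned on C and on its complement agree at [c i]: this rectangle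
   is independent of C. *)
have ceq i : fine (lam ((c i).1 `*` (c i).2 `&` C)) =
    t * fine (lam ((c i).1 `*` (c i).2)).
  have [m1 m2] := mc i.
  have h j : bx (c j) = t * trunc g1 (c j) + (1 - t) * trunc g2 (c j).
    have [n1 n2] := mc j.
    rewrite [c j]surjective_pairing (truncE g1 _ _ n1 n2) (truncE g2 _ _ n1 n2).
    have -> : bx ((c j).1, (c j).2) = fine (lam ((c j).1 `*` (c j).2)) by rewrite lamE.
    rewrite /g1 /g2 tC -/t mulrA mulfV ?gt_eqF// mul1r mulrA mulfV ?gt_eqF ?subr_gt0// mul1r.
    exact: dec.
  have := bx_ext _ _ t F1 F2; rewrite t0 t1 => /(_ isT h i).
  rewrite [c i]surjective_pairing (truncE g1 _ _ m1 m2) (truncE g2 _ _ m1 m2) /g1 /g2.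
  rewrite tC -/t (dec _ _ m1 m2); set x := fine _; set y := fine _ => xy.
  have t0' : t != 0 by rewrite gt_eqF.
  have t1' : 1 - t != 0 by rewrite gt_eqF ?subr_gt0.
  have -> : y = (1 - t) / t * x by rewrite -[LHS](mulVKf t1') -xy; field.
  by field.
have tle : 0 <= t <= 1 by rewrite !ltW.
have lamt := additive_belowZ tle (additive_below_probability lam).
have lamCb := additive_belowI mC (additive_below_probability lam).
have aa' m n : fine (lam (a m `*` a' n `&` C)) = t * fine (lam (a m `*` a' n)).
  by have := ceq (pickle (m, n)).+1; rewrite /c pickleK.
have [lamfst lamsnd _] := lamJ.
have rectI A B : A `*` B = fst @^-1` A `&` snd @^-1` B :> set (Z * W).
  by apply/seteqP; split.
have left f B : additive_below lam f -> measurable B ->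
    additive_below P (fun A => f (A `*` B)).
  move=> fl mB; have mB' := measurable_preimageT (@measurable_snd _ _ Z W) mB.
  have -> : (fun A => f (A `*` B)) = (fun A => f (fst @^-1` A `&` snd @^-1` B)).
    by apply/funext => A; rewrite rectI.
  exact: additive_below_preimage measurable_fst lamfst (additive_belowI mB' fl).
have right f A : additive_below lam f -> measurable A ->
    additive_below Q (fun B => f (A `*` B)).
  move=> fl mA; have mA' := measurable_preimageT (@measurable_fst _ _ Z W) mA.
  have -> : (fun B => f (A `*` B)) = (fun B => f (snd @^-1` B `&` fst @^-1` A)).
    by apply/funext => B; rewrite rectI setIC.
  exact: additive_below_preimage measurable_snd lamsnd (additive_belowI mA' fl).
have Aa' A n : measurable A ->
    fine (lam (A `*` a' n `&` C)) = t * fine (lam (A `*` a' n)).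
  move=> mA; apply: (additive_below_unique aE aI aT (left _ _ lamCb (ma' n))
    (left _ _ lamt (ma' n))) mA => _ /[!inE] -[m _ <-]; exact: aa'.
have AB A B : measurable A -> measurable B ->
    fine (lam (A `*` B `&` C)) = t * fine (lam (A `*` B)).
  move=> mA mB; apply: (additive_below_unique a'E a'I a'T (right _ _ lamCb mA)
    (right _ _ lamt mA)) mB => _ /[!inE] -[n _ <-]; exact: Aa'.
(* Independence of C extends from rectangles to all measurable sets, in particular to C itself, so t
   = t^2. *)
have := additive_below_unique_prod lamCb lamt AB mC; rewrite setIid -/t => tt.
have : t * (1 - t) = 0 by rewrite mulrBr mulr1 -tt subrr.
by move/eqP; rewrite mulf_eq0 gt_eqF//= subr_eq0 gt_eqF.
Qed.

End extremal_joining.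

(** * Integrals under measure-preserving maps *)

Lemma integral_preserving d d' (W : measurableType d) (X : measurableType d')
    (R : realType) (nu : probability W R) (mu : probability X R) (p : W -> X)
    (f : X -> R) D :
  measurable_fun setT p -> (forall A, measurable A -> nu (p @^-1` A) = mu A) ->
  measurable_fun setT f -> (forall x, 0 <= f x) -> measurable D ->
  (\int[nu]_(y in p @^-1` D) (f (p y))%:E = \int[mu]_(x in D) (f x)%:E)%E.
Proof.
move=> mp pE mf f0 mD; rewrite -(@ge0_integral_pushforward _ _ _ _ _ p mp nu D (EFin \o f))//.
- by apply: eq_measure_integral => A mA _; exact: pE.
- by apply/measurable_EFinP; exact: measurable_funTS.
- by move=> x _; rewrite lee_fin.
Qed.

Lemma integral_fin_num d (X : measurableType d) (R : realType)
    (mu : probability X R) (f : X -> R) (K : R) D :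
  measurable_fun setT f -> (forall x, 0 <= f x <= K) -> measurable D ->
  (\int[mu]_(x in D) (f x)%:E)%E \is a fin_num.
Proof.
move=> mf fK mD; have f0 x : 0 <= f x by case/andP: (fK x).
rewrite ge0_fin_numE; last by apply: integral_ge0 => x _; rewrite lee_fin.
apply: (@le_lt_trans _ _ (K%:E * mu D)%E); last first.
  by rewrite -[mu D]fineK ?fin_num_measure// -EFinM ltry.
rewrite -integral_cst//; apply: ge0_le_integral => //.
- by move=> x _; rewrite lee_fin.
- by apply/measurable_EFinP; exact: measurable_funTS.
- by move=> x _; rewrite lee_fin; case/andP: (fK x).
Qed.

(** Equality of the integrals over all D gives f = g almost everywhere, hence after composition with
    p; the conclusion then covers every B, not just preimages under p. *)
Lemma eq_integral_preserving d d' (W : measurableType d) (X : measurableType d')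
    (R : realType) (nu : probability W R) (mu : probability X R) (p : W -> X)
    (f g : X -> R) (K : R) :
  measurable_fun setT p -> (forall A, measurable A -> nu (p @^-1` A) = mu A) ->
  measurable_fun setT f -> measurable_fun setT g ->
  (forall x, 0 <= f x <= K) -> (forall x, 0 <= g x <= K) ->
  (forall D, measurable D ->
    \int[mu]_(x in D) (f x)%:E = \int[mu]_(x in D) (g x)%:E)%E ->
  forall B, measurable B ->
    (\int[nu]_(y in B) (f (p y))%:E = \int[nu]_(y in B) (g (p y))%:E)%E.
Proof.
move=> mp pE mf mg fK gK fg B mB.
have f0 x : 0 <= f x by case/andP: (fK x).
have g0 x : 0 <= g x by case/andP: (gK x).
have mfE : measurable_fun setT (EFin \o f) by exact/measurable_EFinP.
have mgE : measurable_fun setT (EFin \o g) by exact/measurable_EFinP.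
have [N [mN N0 fgN]] : ae_eq mu setT (EFin \o f) (EFin \o g).
  apply: integral_ae_eq => //; last by move=> D _ mD; exact: fg.
  apply/integrableP; split => //.
  under eq_integral do rewrite /= ger0_norm//.
  by rewrite -ge0_fin_numE ?(integral_fin_num _ mf fK)//; apply: integral_ge0 => x _; rewrite lee_fin.
apply: ge0_ae_eq_integral => //.
- by apply/measurable_EFinP; apply: measurable_funTS; exact: measurableT_comp.
- by apply/measurable_EFinP; apply: measurable_funTS; exact: measurableT_comp.
- by move=> y _; rewrite lee_fin.
- by move=> y _; rewrite lee_fin.
exists (p @^-1` N); split; [exact: measurable_preimageT|exact: etrans (pE _ mN) N0|].
by move=> y /= h; apply: fgN => /= fgy; apply: h => _; exact: fgy.
Qed.

(** * The relatively independent extension of a joining *)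

Section relative_product.
Context {R : realType}.
Variables (X Z W : system R) (lam : probability (X * Z)%type R) (p : W -> X).
Let mu := sys_prob X.
Let rho := sys_prob Z.
Let nu := sys_prob W.
Let T := @sys_map R X.
Let V := @sys_map R Z.
Let S := @sys_map R W.
Hypotheses (lamJ : joining lam) (pW : factor_map p).
Hypotheses (iT : invertible T) (PT : invariant_measure mu T).
Hypotheses (mV : measurable_fun setT V).
Hypotheses (mS : measurable_fun setT S) (nuS : invariant_measure nu S).

Let lam1 : forall A, measurable A -> lam (fst @^-1` A) = mu A.
Proof. by have [] := lamJ. Qed.
Let lam2 : forall B, measurable B -> lam (snd @^-1` B) = rho B.
Proof. by have [] := lamJ. Qed.
Let mp : measurable_fun setT p. Proof. by have [] := pW. Qed.
Let pE : forall A, measurable A -> nu (p @^-1` A) = mu A.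
Proof. by have [] := pW. Qed.


(** [phi] is the conditional probability of A given the X coordinate. Measurability of A stands
    under the existential so that [choice] yields one function for every set A. *)
Lemma exists_conditional A : exists phi : X -> R, measurable A ->
  [/\ measurable_fun setT phi, forall x, 0 <= phi x <= 1 &
    forall D, measurable D ->
      (fine (lam (D `*` A)))%:E = (\int[mu]_(x in D) (phi x)%:E)%E].
Proof.
have [mA|nmA] := pselect (measurable A); last by exists (cst 0).
have mA' := measurable_preimageT (@measurable_snd _ _ X Z) mA.
have fP : additive_below mu (fun D => fine (lam (D `*` A))).
  rewrite (_ : (fun _ => _) = (fun D => fine (lam (fst @^-1` D `&` snd @^-1` A)))); last first.
    by apply/funext => D; congr (fine (lam _)); apply/seteqP; split.
  exact: additive_below_preimage measurable_fst lam1
    (additive_belowI mA' (additive_below_probability lam)).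
have [||D mD|phi [mphi phi0 phiE]] := @exists_density _ _ _ mu _ (cst 1) fP.
- exact: measurable_cst.
- by move=> x /=; rewrite ler01 lexx.
- rewrite (eq_integral (cst 1%:E))// integral_cst// mul1e.
  by rewrite -[leRHS]fineK ?fin_num_measure// lee_fin; have /andP[] := fP.1 _ mD.
by exists phi.
Qed.

(** The bimeasure integrates over B the conditional probability of A at p y. Each identity to be
    checked amounts to an almost sure identity between conditional probabilities. *)
Lemma exists_relative_product : exists b : set Z -> set W -> R,
  invariant_bimeasure b /\ forall A D, measurable A -> measurable D ->
    b A (p @^-1` D) = fine (lam (D `*` A)).
Proof.
have /choice[phi phiP] := exists_conditional.
have mphi A : measurable A -> measurable_fun setT (phi A) by move=> /phiP[].
have phi01 A : measurable A -> forall x, 0 <= phi A x <= 1 by move=> /phiP[].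
have phiE A D : measurable A -> measurable D ->
    (\int[mu]_(x in D) (phi A x)%:E)%E = (fine (lam (D `*` A)))%:E.
  by move=> /phiP[_ _ h] mD; rewrite -h.
pose I A B := (\int[nu]_(y in B) (phi A (p y))%:E)%E.
pose b A B := fine (I A B).
have mphip A : measurable A -> measurable_fun setT (fun y => phi A (p y)).
  by move=> mA; exact: (measurableT_comp (mphi A mA) mp).
have Ifin A B : measurable A -> measurable B -> I A B \is a fin_num.
  by move=> mA mB; apply: (integral_fin_num _ (mphip A mA) (K := 1)) => // y; exact: phi01.
have phi0 A y : measurable A -> 0 <= phi A y by move=> /phi01/(_ y)/andP[].
have phiEF A B : measurable A -> measurable_fun B (fun y => (phi A (p y))%:E).
  by move=> mA; apply/measurable_EFinP/measurable_funTS; exact: mphip.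
have bpre A D : measurable A -> measurable D -> b A (p @^-1` D) = fine (lam (D `*` A)).
  move=> mA mD; rewrite /b /I (integral_preserving mp pE (mphi A mA)) ?phiE//.
  by move=> x; exact: phi0.
(* Any bounded function with the integrals that characterize [phi A] may replace it. *)
have cong A (f : X -> R) (K : R) : measurable A -> measurable_fun setT f ->
    (forall x, 0 <= phi A x <= K) -> (forall x, 0 <= f x <= K) ->
    (forall D, measurable D -> (fine (lam (D `*` A)))%:E = \int[mu]_(x in D) (f x)%:E)%E ->
    forall B, measurable B -> I A B = (\int[nu]_(y in B) (f (p y))%:E)%E.
  move=> mA mf phiK fK fE; apply: (eq_integral_preserving mp pE (mphi A mA) mf phiK fK).
  by move=> D mD; rewrite phiE// fE.
exists b; split => //; split; first split.
- by move=> A B mA mB; rewrite fine_ge0// integral_ge0// => y _; rewrite lee_fin phi0.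
- move=> A A' B mA mA' mB AA'; rewrite /b -fineD ?Ifin//; congr fine.
  have mAA' : measurable (A `|` A') by exact: measurableU.
  (* The bound 2 is the one that holds at every point: the sum is at most 1 only almost
     everywhere. *)
  rewrite (cong _ (fun x => phi A x + phi A' x) 2 mAA')//.
  + under eq_integral do rewrite EFinD.
    by rewrite ge0_integralD//; do ?[exact: phiEF|move=> y _; rewrite lee_fin phi0].
  + by apply: measurable_funD; exact: mphi.
  + by move=> x; have := phi01 _ mAA' x; lra.
  + by move=> x; have := phi01 _ mA x; have := phi01 _ mA' x; lra.
  move=> D mD; under eq_integral do rewrite EFinD.
  rewrite ge0_integralD//.
  + have mDA : measurable (D `*` A) by exact: measurableX.
    have mDA' : measurable (D `*` A') by exact: measurableX.
    rewrite !phiE// -EFinD -fineD ?fin_num_measure//; congr (fine _)%:E.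
    have -> : D `*` (A `|` A') = (D `*` A) `|` (D `*` A').
      apply/seteqP; split=> -[x z] /=; first by move=> [Dx [Az|Az]]; [left|right].
      by move=> [[Dx Az]|[Dx Az]]; split => //; [left|right].
    by rewrite measureU// -setXI AA' setX0.
  + by move=> x _; rewrite lee_fin phi0.
  + by apply/measurable_EFinP/measurable_funTS; exact: mphi.
  + by move=> x _; rewrite lee_fin phi0.
  + by apply/measurable_EFinP/measurable_funTS; exact: mphi.
- move=> A B B' mA mB mB' BB'; rewrite /b -fineD ?Ifin//; congr fine.
  rewrite /I ge0_integral_setU//; first exact: phiEF.
    by move=> y _; rewrite lee_fin phi0.
  by apply/disj_setPS; rewrite BB'.
- move=> A mA; rewrite -(preimage_setT p) bpre// -lam2//; congr (fine (lam _)).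
  by apply/seteqP; split=> -[x z] //; case.
- move=> B mB; rewrite /b (cong _ (cst 1) 1)//.
  + by rewrite (eq_integral (cst 1%:E))// integral_cst// mul1e.
  + exact: phi01.
  + by move=> x; rewrite ler01 lexx.
  + move=> D mD; rewrite (eq_integral (cst 1%:E))// integral_cst// mul1e fineK.
      apply: etrans (lam1 mD); congr (lam _).
      by apply/seteqP; split=> -[x z] //; case.
    by apply: fin_num_measure; exact: measurableX.
move=> A B mA mB; congr fine.
have [T' [TK T'K mT mT']] := iT.
have mVA := measurable_preimageT mV mA.
have mSB := measurable_preimageT mS mB.
have mphiT : measurable_fun setT (phi A \o T) by exact: (measurableT_comp (mphi A mA) mT).
(* Invariance of [lam] makes [phi A \o T] a conditional probability of the preimage of A under V,
   and p intertwines S and T almost everywhere. *)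
rewrite (cong _ (phi A \o T) 1 mVA mphiT)//.
- transitivity (\int[nu]_(y in S @^-1` B) (phi A (p (S y)))%:E)%E.
    have [_ _ [N [mN N0 pN]]] := pW.
    apply: ge0_ae_eq_integral => //.
    + by apply/measurable_EFinP/measurable_funTS; exact: (measurableT_comp mphiT mp).
    + by apply/measurable_EFinP/measurable_funTS; exact: (measurableT_comp (mphip A mA) mS).
    + by move=> y _; rewrite lee_fin phi0.
    + by move=> y _; rewrite lee_fin phi0.
    exists N; split => // y /= h; apply: pN => /= py; apply: h => _.
    by rewrite /= /S py.
  rewrite (integral_preserving mS nuS (f := fun y => phi A (p y)))//.
    exact: mphip.
  by move=> y; exact: phi0.
- exact: phi01.
- by move=> x; exact: phi01.
(* Invertibility writes every D as a preimage under T, so that invariance of [lam] can be applied to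
   it. *)
move=> D mD; have DE : D = T @^-1` (T' @^-1` D).
  by apply/seteqP; split=> x; rewrite /preimage/= TK.
have mT'D := measurable_preimageT mT' mD.
rewrite [in RHS]DE (integral_preserving mT PT (mphi A mA))//; last by move=> x; exact: phi0.
rewrite phiE//; congr (fine _)%:E; have [_ _ lamI] := lamJ.
rewrite -(lamI (T' @^-1` D `*` A)); last exact: measurableX.
by congr (lam _); rewrite {1}DE; apply/seteqP; split.
Qed.

End relative_product.

(** * Independence of disjoint sets of coordinates *)

Lemma integral_indicM d (X : measurableType d) (R : realType)
    (mu : probability X R) (f : X -> R) D :
  (\int[mu]_(x in D) (f x)%:E = \int[mu]_x (f x * \1_D x)%:E)%E.
Proof.
rewrite integral_mkcond; apply: eq_integral => x _; rewrite patchE indicE.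
by case: ifPn => _; rewrite ?mulr1 ?mulr0.
Qed.

Section product_independence.
Context {I : finType} {d : I -> measure_display} {R : realType}.
Variables (Y : forall i, measurableType (d i)) (nu : forall i, probability (Y i) R).
Local Notation nuI := (prod_prob nu).
Implicit Type P : pred I.

Definition depends_on P (f : prodspace Y -> R) :=
  forall y y' : prodspace Y, (forall i, P i -> y i = y' i) -> f y = f y'.

Definition merge P (w : prodspace Y * prodspace Y) : prodspace Y :=
  fun i => if P i then w.1 i else w.2 i.

Lemma measurable_merge P : measurable_fun setT (merge P).
Proof.
apply: measurable_prodspaceP => i; rewrite /merge; case: (P i).
  exact: (measurableT_comp (@measurable_coord _ _ Y i) measurable_fst).
exact: (measurableT_comp (@measurable_coord _ _ Y i) measurable_snd).
Qed.

Lemma merge_preserving P C : measurable C ->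
  (nuI \x nuI)%E (merge P @^-1` C) = nuI C.
Proof.
move=> mC.
have [Q QE] := exists_pushforward ((nuI \x nuI)%E : probability _ R) (measurable_merge P).
rewrite -QE; apply: probability_unique_prodspace mC => A mA; rewrite QE.
pose A1 i := if P i then A i else setT; pose A2 i := if P i then setT else A i.
have mA1 i : measurable (A1 i) by rewrite /A1; case: (P i).
have mA2 i : measurable (A2 i) by rewrite /A2; case: (P i).
have mE : merge P @^-1` rectangle A = rectangle A1 `*` rectangle A2.
  apply/seteqP; split=> -[y y'].
    move=> h; split=> i /=; have := h i; rewrite /merge /A1 /A2 /=; case: (P i) => //.
  move=> [h1 h2] i; have := h1 i; have := h2 i; rewrite /merge /A1 /A2 /=.
  by case: (P i).
transitivity ((nuI \x nuI)%E (rectangle A1 `*` rectangle A2)); first by rewrite -mE.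
rewrite product_measure1E; [|exact: measurable_rectangle..].
transitivity ((\prod_i fine (nu i (A1 i)))%:E * (\prod_i fine (nu i (A2 i)))%:E)%E.
  by congr (_ * _)%E; exact: prod_probE.
rewrite prod_probE// -EFinM -big_split/=; congr EFin; apply: eq_bigr => i _.
by rewrite /A1 /A2; case: (P i); rewrite probability_setT ?mulr1 ?mul1r.
Qed.

(** [merge P] splices two independent samples into one. After this change of variables f sees only
    the first sample and g only the second, and Tonelli separates them. *)
Lemma integral_independent P (f g : prodspace Y -> R) :
  measurable_fun setT f -> measurable_fun setT g ->
  (forall y, 0 <= f y) -> (forall y, 0 <= g y) ->
  depends_on P f -> depends_on (predC P) g ->
  (\int[nuI]_y (f y * g y)%:E =
   \int[nuI]_y (f y)%:E * \int[nuI]_y (g y)%:E)%E.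
Proof.
move=> mf mg f0 g0 fP gP.
rewrite -(@integral_preserving _ _ _ _ R ((nuI \x nuI)%E : probability _ R)
  nuI _ (fun y => f y * g y) setT (measurable_merge P) (@merge_preserving P))//; last 2 first.
- exact: measurable_funM.
- by move=> y; exact: mulr_ge0.
rewrite preimage_setT.
rewrite (eq_integral (fun w : prodspace Y * prodspace Y => (f w.1 * g w.2)%:E)); last first.
  move=> w _; congr (_ * _)%:E; [apply: fP|apply: gP] => i /=; rewrite /merge.
    by move=> ->.
  by move=> /negbTE ->.
have mE (h : prodspace Y -> R) : measurable_fun setT h -> measurable_fun setT (EFin \o h).
  by move=> mh; exact/measurable_EFinP.
rewrite fubini_tonelli1//=.
- rewrite /fubini_F /= (eq_integral (fun x => (f x)%:E * \int[nuI]_y (g y)%:E)%E); last first.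
    move=> x _; under eq_integral do rewrite EFinM.
    rewrite ge0_integralZl//; first exact: mE.
      by move=> y _; rewrite lee_fin.
    by rewrite lee_fin.
  rewrite ge0_integralZr//; first exact: mE.
    by move=> x _; rewrite lee_fin.
  by apply: integral_ge0 => y _; rewrite lee_fin.
- apply/measurable_EFinP; apply: measurable_funM.
    exact: (measurableT_comp mf measurable_fst).
  exact: (measurableT_comp mg measurable_snd).
- by move=> w; rewrite lee_fin mulr_ge0.
Qed.

Definition restrict_coords P (y : prodspace Y) :
    prodspace (fun i : {i | P i} => Y (val i)) :=
  fun i => y (val i).

Lemma measurable_restrict_coords P : measurable_fun setT (@restrict_coords P).
Proof. by apply: measurable_prodspaceP => i; exact: measurable_coord. Qed.

Lemma restrict_coords_preserving P C : measurable C ->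
  nuI (@restrict_coords P @^-1` C) = prod_prob (fun i : {i | P i} => nu (val i)) C.
Proof.
move=> mC; have [Q QE] := exists_pushforward nuI (@measurable_restrict_coords P).
rewrite -QE; apply: probability_unique_prodspace mC => A mA; rewrite QE.
(* Quantifying over proofs of [P i] gives [A] on the coordinates in P and the whole space elsewhere,
   without any cast between types. *)
pose B i : set (Y i) := [set z : Y i | forall h : P i, A (exist _ i h) z].
have BT i : P i = false -> B i = setT.
  by move=> Pi; apply/seteqP; split=> // z _ h; exfalso; rewrite h in Pi.
have BA (i : {i | P i}) : B (val i) = A i.
  case: i => i h; apply/seteqP; split=> z /=; first exact.
  by move=> Az h'; rewrite (bool_irrelevance h' h).
have mB i : measurable (B i).
  case Pi : (P i); last by rewrite BT.
  by rewrite (BA (exist _ i Pi)); exact: mA.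
rewrite (_ : _ @^-1` _ = rectangle B); last first.
  apply/seteqP; split=> y /=; first by move=> h i Pi; exact: (h (exist _ i Pi)).
  by move=> h [i Pi]; exact: h.
rewrite !prod_probE//; congr EFin.
rewrite (bigID P)/= [X in _ * X]big1 ?mulr1; last first.
  by move=> i /negbTE Pi; rewrite BT// probability_setT.
rewrite (reindex_omap (val : {i | P i} -> I) insub); last first.
  by move=> i Pi; rewrite insubT.
apply: eq_big => [i|i _]; last by rewrite BA.
by rewrite valK eqxx andbT; exact: valP.
Qed.

End product_independence.

Section density_outside.
Context {I : finType} {R : realType}.
Variables (Z : system R) (S : I -> system R) (P : pred I).
Variable lam : probability (Z * prodspace S)%type R.
Let nu := prod_prob (fun i => sys_prob (S i)).
Hypotheses (lamP : independent_outside P lam)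
  (lam2 : forall B, measurable B -> lam (snd @^-1` B) = nu B).

(** The density is taken on the coordinates in [P] alone and pulled back by restriction. It remains
    a density on the whole product because the other coordinates are independent of Z and of those
    in [P]. *)
Lemma exists_density_outside A : measurable A -> exists a : prodspace S -> R,
  [/\ measurable_fun setT a, forall y, 0 <= a y <= 1, depends_on P a &
    forall B, measurable B ->
      (fine (lam (A `*` B)))%:E = (\int[nu]_(y in B) (a y)%:E)%E].
Proof.
move=> mA; have mA' := measurable_preimageT (@measurable_fst _ _ Z (prodspace S)) mA.
have AB B : A `*` B = snd @^-1` B `&` fst @^-1` A :> set (Z * prodspace S).
  by apply/seteqP; split=> -[z y] [].
have f1 : additive_below nu (fun B => fine (lam (A `*` B))).
  under [X in additive_below _ X]eq_fun do rewrite AB.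
  exact: additive_below_preimage measurable_snd lam2
    (additive_belowI mA' (additive_below_probability lam)).
pose r := @restrict_coords _ _ S P; pose r' := @restrict_coords _ _ S (fun i => ~~ P i).
pose nuP := prod_prob (fun i : {i | P i} => sys_prob (S (val i))).
have mr : measurable_fun setT r by exact: measurable_restrict_coords.
have mr' : measurable_fun setT r' by exact: measurable_restrict_coords.
have rE := restrict_coords_preserving (fun i => sys_prob (S i)) (P := P).
have r'E := restrict_coords_preserving (fun i => sys_prob (S i)) (P := fun i => ~~ P i).
have fP : additive_below nuP (fun C => fine (lam (A `*` (r @^-1` C)))).
  exact: (additive_below_preimage mr rE f1).
have [||C mC|a' [ma' a'01 a'E]] := @exists_density _ _ _ nuP _ (cst 1) fP.
- exact: measurable_cst.
- by move=> y /=; rewrite ler01 lexx.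
- rewrite (eq_integral (cst 1%:E))// integral_cst// mul1e.
  by rewrite -[leRHS]fineK ?fin_num_measure// lee_fin; have /andP[] := fP.1 _ mC.
have ma : measurable_fun setT (a' \o r) by exact: measurableT_comp.
have a01 y : 0 <= (a' \o r) y <= 1 by exact: a'01.
exists (a' \o r); split => //.
  move=> y y' yy'; rewrite /=; congr a'; apply: functional_extensionality_dep => i.
  by rewrite /r /restrict_coords yy'//; exact: valP.
have afin B : measurable B -> (\int[nu]_(y in B) ((a' \o r) y)%:E)%E \is a fin_num.
  by move=> mB; apply: (integral_fin_num _ ma (K := 1)).
have f2 : additive_below nu (fun B => fine (\int[nu]_(y in B) ((a' \o r) y)%:E)%E).
  split=> [B mB|B B' mB mB' BB'].
    rewrite fine_ge0/=; last by apply: integral_ge0 => y _; rewrite lee_fin; case/andP: (a01 y).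
    rewrite -lee_fin fineK ?afin// fineK ?fin_num_measure//.
    rewrite -[leRHS]mul1e -integral_cst//; apply: ge0_le_integral => //.
    - by move=> y _; rewrite lee_fin; case/andP: (a01 y).
    - by apply/measurable_EFinP; exact: measurable_funTS.
    - by move=> y _; rewrite lee_fin; case/andP: (a01 y).
  rewrite -fineD ?afin//; congr fine; rewrite ge0_integral_setU//.
  - by apply/measurable_EFinP; exact: measurable_funTS.
  - by move=> y _; rewrite lee_fin; case/andP: (a01 y).
  - by apply/disj_setPS; rewrite BB'.
move=> B mB; rewrite -[RHS]fineK ?afin//; congr EFin.
apply: (additive_below_unique_prodspace f1 f2) mB => Bs mBs.
pose R1 := rectangle (fun i : {i | P i} => Bs (val i)).
pose R2 := rectangle (fun i : {i | ~~ P i} => Bs (val i)).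
have mR1 : measurable R1 by exact: measurable_rectangle.
have mR2 : measurable R2 by exact: measurable_rectangle.
have mrR1 := measurable_preimageT mr mR1.
have mrR2 := measurable_preimageT mr' mR2.
have RE : rectangle Bs = r @^-1` R1 `&` r' @^-1` R2.
  apply/seteqP; split=> [y By|y [y1 y2] i]; first by split=> i; exact: By.
  by case Pi : (P i); [exact: (y1 (exist _ i Pi))|exact: (y2 (exist _ i (negbT Pi)))].
have -> : lam (A `*` rectangle Bs) =
    (lam (A `*` (r @^-1` R1)) * prod_prob (fun i : {i | ~~ P i} => sys_prob (S (val i))) R2)%E.
  have -> : A `*` rectangle Bs = split_coords P @^-1` ((A `*` R1) `*` R2).
    rewrite RE; apply/seteqP; split=> -[z y] /=; first by move=> [Az [y1 y2]].
    by move=> [[Az y1] y2].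
  rewrite lamP; last by apply: measurableX => //; exact: measurableX.
  rewrite product_measure1E//; exact: measurableX.
rewrite -r'E// fineM ?fin_num_measure//; last by apply: measurableX.
apply: EFin_inj; rewrite EFinM a'E// fineK ?fin_num_measure//.
rewrite fineK; last by apply: afin; exact: measurable_rectangle.
have a'0 y : 0 <= a' y by case/andP: (a'01 y).
rewrite -(integral_preserving mr rE ma')//.
rewrite [RHS]integral_indicM [X in (X * _)%E = _]integral_indicM.
pose f y := (a' \o r) y * \1_(r @^-1` R1) y; pose g : prodspace S -> R := \1_(r' @^-1` R2).
transitivity (\int[nu]_y (f y * g y)%:E)%E; last first.
  by apply: eq_integral => y _; rewrite RE indicI /f /g /= mulrA.
rewrite /nu (@integral_independent _ _ _ _ (fun i => sys_prob (S i)) P f g).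
- by congr (_ * _)%E; rewrite integral_indic// setIT.
- by apply: measurable_funM => //; exact: measurable_indic.
- exact: measurable_indic.
- by move=> y; rewrite /f mulr_ge0//; exact: a'0.
- by move=> y; rewrite /g indicE.
- move=> y y' yy'; have e : r y = r y'.
    apply: functional_extensionality_dep => i.
    by rewrite /r /restrict_coords yy'//; exact: valP.
  rewrite /f /= e !indicE; congr (_ * (nat_of_bool _)%:R).
  by apply/idP/idP; rewrite !inE /= e.
- move=> y y' yy'; have e : r' y = r' y'.
    apply: functional_extensionality_dep => i.
    by rewrite /r' /restrict_coords yy'//; exact: valP.
  rewrite /g !indicE; congr ((nat_of_bool _)%:R).
  by apply/idP/idP; rewrite !inE /= e.
Qed.

End density_outside.

(** * Averaging nearly uncorrelated functions *)

Section averaging.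
Context {d} {Y : measurableType d} {R : realType} (nu : probability Y R).
Local Notation E f := (Rintegral nu setT f).
Implicit Types (f g u v : Y -> R).

Definition integrable_real f := nu.-integrable setT (EFin \o f).

Lemma integrable_real_measurable f : integrable_real f -> measurable_fun setT f.
Proof. by move=> /integrableP[/measurable_EFinP]. Qed.

Lemma Rintegral_probability_cst (c : R) : E (fun=> c) = c.
Proof.
rewrite Rintegral_cst// -[RHS]mulr1; congr (_ * _).
by transitivity (fine (nu setT)) => //; rewrite probability_setT.
Qed.

Lemma le_integrable_real f g : measurable_fun setT f -> integrable_real g ->
  (forall y, `|f y| <= `|g y|) -> integrable_real f.
Proof.
move=> mf ig fg; apply: le_integrable ig => //; first exact/measurable_EFinP.
by move=> y _; rewrite /= lee_fin.
Qed.

Lemma integrable_real_cst K : integrable_real (fun=> K).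
Proof. exact: finite_measure_integrable_cst. Qed.

Lemma bounded_integrable_real f K : measurable_fun setT f ->
  (forall y, `|f y| <= K) -> integrable_real f.
Proof.
move=> mf fK; apply: (le_integrable_real mf (integrable_real_cst K)) => y.
by rewrite (le_trans (fK y)) ?ler_norm.
Qed.

Lemma integrable_realD f g : integrable_real f -> integrable_real g ->
  integrable_real (fun y => f y + g y).
Proof. by move=> fi gi; exact: (integrableD measurableT fi gi). Qed.

Lemma integrable_realB f g : integrable_real f -> integrable_real g ->
  integrable_real (fun y => f y - g y).
Proof. by move=> fi gi; exact: (integrableB measurableT fi gi). Qed.

Lemma integrable_realZ c f : integrable_real f -> integrable_real (fun y => c * f y).
Proof. by move=> fi; exact: (integrableZl measurableT c fi). Qed.

Lemma integrable_realM u v K : measurable_fun setT u -> (forall y, `|u y| <= K) ->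
  integrable_real v -> integrable_real (fun y => u y * v y).
Proof.
move=> mu uK iv; have mv := integrable_real_measurable iv.
apply: (le_integrable_real (measurable_funM mu mv) (integrable_realZ K iv)) => y.
rewrite normrM [leRHS]normrM ler_wpM2r//.
by rewrite (le_trans (uK y)) ?ler_norm.
Qed.

Lemma integrable_real_sum (I : Type) (r : seq I) (f : I -> Y -> R) :
  (forall i, integrable_real (f i)) ->
  integrable_real (fun y => \sum_(i <- r) f i y) /\
  E (fun y => \sum_(i <- r) f i y) = \sum_(i <- r) E (f i).
Proof.
move=> fi; elim: r => [|i r [ih1 ih2]].
  have e : (fun y => \sum_(i <- [::]) f i y) = (fun=> 0).
    by apply/funext => y; rewrite big_nil.
  rewrite e big_nil; split; first exact: integrable_real_cst.
  exact: Rintegral_probability_cst.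
have e : (fun y => \sum_(j <- i :: r) f j y) = (fun y => f i y + \sum_(j <- r) f j y).
  by apply/funext => y; rewrite big_cons.
rewrite e big_cons; split; first exact: integrable_realD.
by rewrite -ih2; exact: (RintegralD measurableT (fi i) ih1).
Qed.

Lemma Rintegral_le_norm u v : measurable_fun setT u -> (forall y, `|u y| <= 1) ->
  integrable_real v -> `|E (fun y => u y * v y)| <= E (fun y => `|v y|).
Proof.
move=> mu u1 iv; have iuv := integrable_realM mu u1 iv.
have norm_int f : integrable_real f -> integrable_real (fun y => `|f y|).
  move=> fi; apply: (le_integrable_real _ fi) => [|y]; last by rewrite normr_id.
  by apply: measurableT_comp => //; exact: integrable_real_measurable.
apply: (le_trans (le_normr_Rintegral measurableT iuv)).
apply: le_Rintegral => //; [exact: norm_int|exact: norm_int|].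
by move=> y _; rewrite normrM ler_piMl.
Qed.

(** Pointwise |v| <= e/2 + v^2/(2e), since (e - |v|)^2 >= 0. *)
Lemma Rintegral_norm_le_sqr v e : 0 < e -> integrable_real v ->
  integrable_real (fun y => v y ^+ 2) ->
  E (fun y => `|v y|) <= e / 2 + E (fun y => v y ^+ 2) / (2 * e).
Proof.
move=> e0 iv iv2; have e2 : 0 < 2 * e by rewrite mulr_gt0.
have mnv : measurable_fun setT (fun y => `|v y|).
  by apply: measurableT_comp => //; exact: integrable_real_measurable.
have -> : e / 2 + E (fun y => v y ^+ 2) / (2 * e) =
    E (fun y => e / 2 + (2 * e)^-1 * v y ^+ 2).
  rewrite RintegralD//; [|exact: integrable_real_cst|exact: integrable_realZ].
  by rewrite Rintegral_probability_cst RintegralZl// (mulrC (2 * e)^-1).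
apply: le_Rintegral => //.
- by apply: (le_integrable_real mnv iv) => y; rewrite normr_id.
- exact: (integrable_realD (integrable_real_cst _) (integrable_realZ _ iv2)).
move=> y _; rewrite -subr_ge0 -[v y ^+ 2]real_normK ?num_real//.
set x := `|v y|.
have -> : e / 2 + (2 * e)^-1 * x ^+ 2 - x = (2 * e)^-1 * (e - x) ^+ 2.
  by field; rewrite gt_eqF.
by rewrite mulr_ge0 ?sqr_ge0// invr_ge0 ltW.
Qed.

Variables (k : nat) (N rho delta : R) (a : 'I_k.+1 -> Y -> R) (q h : Y -> R).
Hypotheses (ma : forall s, measurable_fun setT (a s))
  (a01 : forall s y, 0 <= a s y <= 1) (Ea : forall s, E (a s) = rho)
  (Eaa : \sum_s \sum_t E (fun y => a s y * a t y) <= k.+1%:R ^+ 2 * rho ^+ 2 + N * k.+1%:R).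
Hypotheses (mq : measurable_fun setT q) (q01 : forall y, 0 <= q y <= 1)
  (ih : integrable_real h)
  (Eah : forall s t, E (fun y => a s y * h y) = E (fun y => a t y * h y))
  (Eqh : E (fun y => `|q y - h y|) <= delta).

Let W y := k.+1%:R^-1 * \sum_s a s y.
Let k0 : (0 : R) < k.+1%:R. Proof. by rewrite ltr0n. Qed.

Let a1 s y : `|a s y| <= 1.
Proof. by have /andP[? ?] := a01 s y; rewrite ger0_norm. Qed.

Let ia s : integrable_real (a s) := bounded_integrable_real (ma s) (a1 s).

Let iq : integrable_real q.
Proof. by apply: (bounded_integrable_real mq (K := 1)) => y; have /andP[? ?] := q01 y; rewrite ger0_norm. Qed.

Let W01 y : 0 <= W y <= 1.
Proof.
rewrite /W mulr_ge0 ?invr_ge0//=; last by apply: sumr_ge0 => s _; case/andP: (a01 s y).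
rewrite ler_pdivrMl// mulr1 -[leRHS]mulr1 mulr_natl -[X in _ *+ X](card_ord k.+1) -sumr_const.
by apply: ler_sum => s _; case/andP: (a01 s y).
Qed.

Let rho01 : 0 <= rho <= 1.
Proof.
rewrite -(Ea ord0) Rintegral_ge0/=; last by move=> y _; case/andP: (a01 ord0 y).
have -> : (1 : R) = E (fun=> 1) by rewrite Rintegral_probability_cst.
apply: le_Rintegral; [by []|exact: ia|exact: integrable_real_cst|].
by move=> y _; case/andP: (a01 ord0 y).
Qed.

Let mW : measurable_fun setT W.
Proof. by apply: measurable_funM => //; exact: measurable_sum. Qed.

Let iW : integrable_real W.
Proof. by apply: integrable_realZ; have [] := integrable_real_sum (index_enum 'I_k.+1) ia. Qed.

Let EWM v : integrable_real v ->
  E (fun y => W y * v y) = k.+1%:R^-1 * \sum_s E (fun y => a s y * v y).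
Proof.
move=> iv; have iav s : integrable_real (fun y => a s y * v y).
  exact: integrable_realM (ma s) (a1 s) iv.
have [isum <-] := integrable_real_sum (index_enum 'I_k.+1) iav.
rewrite -RintegralZl//; apply: eq_Rintegral => y _.
by rewrite /W -mulrA mulr_suml.
Qed.

(** Against h, all the [a s] have the same integral, so [a s0] may be replaced by the average [W].
    Passing from q to h and back costs delta twice, and what remains is at most the L1 norm of W -
    rho, controlled by its variance. *)
Lemma averaging_estimate e s0 : 0 < e ->
  `|E (fun y => a s0 y * q y) - rho * E q| <= 2 * delta + e + N / (k.+1%:R * e).
Proof.
move=> e0.
have diff1 f : measurable_fun setT f -> (forall y, 0 <= f y <= 1) ->
    measurable_fun setT (fun y => f y - rho) /\ forall y, `|f y - rho| <= 1.
  move=> mf f01; split; first exact: measurable_funB.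
  by move=> y; rewrite ler_norml; have := f01 y; have := rho01; lra.
have [mar ar1] := diff1 _ (ma s0) (a01 s0).
have [mWr Wr1] := diff1 _ mW W01.
have EB f v : measurable_fun setT f -> (forall y, 0 <= f y <= 1) -> integrable_real v ->
    E (fun y => (f y - rho) * v y) = E (fun y => f y * v y) - rho * E v.
  move=> mf f01 iv; rewrite -RintegralZl// -RintegralB//.
  - by apply: eq_Rintegral => y _; rewrite mulrBl.
  - by apply: (integrable_realM mf (K := 1)) => // y; have /andP[? ?] := f01 y; rewrite ger0_norm.
  - exact: integrable_realZ.
have iqh : integrable_real (fun y => q y - h y) by exact: integrable_realB.
have EWr v : integrable_real v -> (forall s t, E (fun y => a s y * v y) = E (fun y => a t y * v y)) ->
    E (fun y => (a s0 y - rho) * v y) = E (fun y => (W y - rho) * v y).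
  move=> iv Eav; rewrite !EB// EWM//; congr (_ - _).
  rewrite (eq_bigr (fun=> E (fun y => a s0 y * v y)))//.
  by rewrite sumr_const card_ord -[X in _ * X]mulr_natl mulKf// gt_eqF.
have split f : measurable_fun setT (fun y => f y - rho) -> (forall y, `|f y - rho| <= 1) ->
    E (fun y => (f y - rho) * q y) =
    E (fun y => (f y - rho) * (q y - h y)) + E (fun y => (f y - rho) * h y).
  move=> mf f1; rewrite -RintegralD//; [|exact: integrable_realM mf f1 _..].
  by apply: eq_Rintegral => y _; ring.
have EWa : E W = rho.
  have := @EWM (fun=> 1) (integrable_real_cst 1).
  have -> : (fun y => W y * 1) = W by apply/funext => y; rewrite mulr1.
  move=> ->; rewrite (eq_bigr (fun=> rho)).
    by rewrite sumr_const card_ord -[X in _ * X]mulr_natl mulKf// gt_eqF.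
  move=> s _; rewrite -(Ea s); congr (Rintegral _ _ _).
  by apply/funext => y; rewrite mulr1.
have iWr : integrable_real (fun y => W y - rho) by exact: bounded_integrable_real mWr Wr1.
have iWr2 : integrable_real (fun y => (W y - rho) ^+ 2).
  have -> : (fun y => (W y - rho) ^+ 2) = (fun y => (W y - rho) * (W y - rho)).
    by apply/funext => y; rewrite expr2.
  exact: integrable_realM mWr Wr1 iWr.
(* Since W has mean rho, its variance is E(W^2) - rho^2, and E(W^2) is the double sum of [Eaa]
   divided by (k+1)^2. *)
have var : E (fun y => (W y - rho) ^+ 2) <= N / k.+1%:R.
  have -> : E (fun y => (W y - rho) ^+ 2) = E (fun y => W y * W y) - rho ^+ 2.
    transitivity (E (fun y => (W y - rho) * W y) - rho * E (fun y => W y - rho)).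
      rewrite -RintegralZl// -RintegralB//; [|exact: integrable_realM mWr Wr1 iW|exact: integrable_realZ].
      by apply: eq_Rintegral => y _; ring.
    rewrite EB// RintegralB//; last exact: integrable_real_cst.
    by rewrite Rintegral_probability_cst EWa; ring.
  rewrite EWM// lerBlDr.
  have -> : \sum_s E (fun y => a s y * W y) =
      k.+1%:R^-1 * \sum_s \sum_t E (fun y => a s y * a t y).
    rewrite mulr_sumr; apply: eq_bigr => s _.
    have -> : (fun y => a s y * W y) = (fun y => W y * a s y).
      by apply/funext => y; rewrite mulrC.
    rewrite EWM//; congr (_ * _); apply: eq_bigr => t _.
    by congr (Rintegral _ _ _); apply/funext => y; rewrite mulrC.
  rewrite mulrA -invfM -expr2 ler_pdivrMl ?exprn_gt0// (le_trans Eaa)//.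
  by rewrite mulrDr addrC lerD// expr2 mulrA (mulrC _ N) mulrA mulfK ?gt_eqF// mulrC.
rewrite -EB// (split (a s0))// (EWr h)//.
have -> : E (fun y => (W y - rho) * h y) =
    E (fun y => (W y - rho) * q y) - E (fun y => (W y - rho) * (q y - h y)).
  by rewrite (split W)// addrC addKr.
have n1 := le_trans (Rintegral_le_norm mar ar1 iqh) Eqh.
have n2 := le_trans (Rintegral_le_norm mWr Wr1 iqh) Eqh.
have n3 : `|E (fun y => (W y - rho) * q y)| <= e + N / (k.+1%:R * e).
  have -> : (fun y => (W y - rho) * q y) = (fun y => q y * (W y - rho)).
    by apply/funext => y; rewrite mulrC.
  apply: (le_trans (Rintegral_le_norm mq _ iWr)).
    by move=> y; have /andP[? ?] := q01 y; rewrite ger0_norm.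
  apply: (le_trans (Rintegral_norm_le_sqr e0 iWr iWr2)).
  have V0 : 0 <= E (fun y => (W y - rho) ^+ 2).
    by apply: Rintegral_ge0 => y _; exact: sqr_ge0.
  have Ne : 0 <= N / (k.+1%:R * e).
    by rewrite invfM mulrA mulr_ge0 ?invr_ge0 ?(ltW e0)// (le_trans V0).
  have : E (fun y => (W y - rho) ^+ 2) / (2 * e) <= N / (k.+1%:R * e) / 2.
    rewrite !invfM [leRHS]mulrAC !mulrA ler_pM2r ?invr_gt0//.
    by rewrite [leRHS]mulrAC ler_wpM2r ?invr_ge0.
  move: Ne e0; set M := N / _; set X := E _ / _; lra.
apply: (le_trans (ler_normD _ _)).
apply: (le_trans (lerD n1 (le_trans (ler_normB _ _) (lerD n3 n2)))).
by set M := N / _; lra.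
Qed.

End averaging.

Lemma Rintegral_preserving d d' (W : measurableType d) (X : measurableType d')
    (R : realType) (nu : probability W R) (mu : probability X R) (p : W -> X)
    (f : X -> R) :
  measurable_fun setT p -> (forall A, measurable A -> nu (p @^-1` A) = mu A) ->
  integrable_real mu f -> integrable_real nu (f \o p) ->
  Rintegral nu setT (f \o p) = Rintegral mu setT f.
Proof.
move=> mp pE fi fpi; congr fine.
have mf : measurable_fun setT (EFin \o f) := measurable_int _ fi.
rewrite -[LHS](integral_pushforward mp mf (D := setT))// ?preimage_setT//.
by apply: eq_measure_integral => A mA _; exact: pE.
Qed.

(** * Cyclic shifts of coordinates and the estimate from JP(n) *)

Section coordinate_shift.
Context {R : realType}.
Variables (S : system R) (K : nat).
Let W := system_power S K.+1.
Let nu := sys_prob W.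

(** Addition in ['I_K.+1] is modulo K+1, so this shift is cyclic; the exponent is written [K.+1] to
    have this group structure. *)
Definition shift_coords (s : 'I_K.+1) (y : prodspace (fun _ : 'I_K.+1 => S)) :
    prodspace (fun _ : 'I_K.+1 => S) :=
  fun j => y (j + s).

Lemma measurable_shift_coords s : measurable_fun setT (shift_coords s).
Proof. by apply: measurable_prodspaceP => i; exact: measurable_coord. Qed.

Lemma shift_coords_preserving s B : measurable B ->
  nu (shift_coords s @^-1` B) = nu B.
Proof.
move=> mB; have [Q QE] := exists_pushforward nu (measurable_shift_coords s).
rewrite -QE; apply: probability_unique_prodspace mB => A mA; rewrite QE.
pose A' (j : 'I_K.+1) := A (j - s).
transitivity (nu (rectangle A')).
  congr (nu _); apply/seteqP; split=> y yA i.
    by have := yA (i - s); rewrite /shift_coords subrK.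
  by have := yA (i + s); rewrite /A' addrK.
rewrite /nu /W /= !prod_probE//; last by move=> i; exact: mA.
congr EFin; rewrite [RHS](reindex_inj (addIr (- s)))//.
Qed.

(** The level set of h through y belongs to the symmetric factor, hence is invariant under the shift
    viewed as a permutation. *)
Lemma symmetric_shift (h : W -> R) s :
  preimage_set_system setT h measurable `<=` @symmetric_factor R S K.+1 ->
  forall y, h (shift_coords s y) = h y.
Proof.
move=> hsym y.
have inj : injective (fun j : 'I_K.+1 => j + s) by exact: addIr.
have [_ /(_ (perm inj)) hE] : @symmetric_factor R S K.+1 (h @^-1` [set h y]).
  by apply: hsym; exists [set h y]; [exact: measurable_set1|rewrite setTI].
have : (h @^-1` [set h y]) y by [].
rewrite -[X in X y]hE /preimage/= => <-; congr h.
by apply: functional_extensionality_dep => j; rewrite permE.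
Qed.

End coordinate_shift.

(** The constant n^2 counts collisions: for given s, u and v, exactly one t satisfies i_u + s = i_v
    + t. So at most n^2 k pairs of shifts of the density share a coordinate, each contributing at
    most 1, and all other pairs are independent. *)
Lemma JP_estimate (R : realType) (n : nat) (Z S : system R) (k : nat)
    (lam : probability (Z * system_power S k)%type R)
    (A : set Z) (B : set (system_power S k)) (h : system_power S k -> R) (delta e : R) :
  JP n Z -> automorphism S /\ weakly_mixing S -> (n < k)%N ->
  @ergodic_joining R Z (system_power S k) lam -> measurable A -> measurable B ->
  integrable_real (sys_prob (system_power S k)) h ->
  preimage_set_system setT h measurable `<=` @symmetric_factor R S k ->
  Rintegral (sys_prob (system_power S k)) setT (fun y => `|\1_B y - h y|) <= delta ->
  0 < e ->
  fine (lam (A `*` B)) <=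
    fine (sys_prob Z A) * fine (sys_prob (system_power S k) B) +
    (2 * delta + e + (n ^ 2)%:R / (k%:R * e)).
Proof.
move=> hZ hS; case: k lam B h => // K lam B h nK lamJ mA mB ih hsym Eqh e0.
pose nu := sys_prob (system_power S K.+1).
have [_ _ /(_ K.+1 (fun _ => S) nK (fun _ => hS) lam lamJ)[i indep]] := hZ.
have [[lam1 lam2 _] _] := lamJ.
have [a [ma a01 aP aE]] := exists_density_outside indep lam2 mA.
have aB C : measurable C -> Rintegral nu setT (fun y => a y * \1_C y) = fine (lam (A `*` C)).
  by move=> mC; rewrite /Rintegral -integral_indicM -[RHS]/(fine (fine _)%:E) aE.
pose as_ s y := a (shift_coords s y).
pose rho := fine (sys_prob Z A).
have mas s : measurable_fun setT (as_ s).
  exact: (measurableT_comp ma (@measurable_shift_coords R S K s)).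
have as01 s y : 0 <= as_ s y <= 1 by exact: a01.
have bnd (f : system_power S K.+1 -> R) : measurable_fun setT f ->
    (forall y, 0 <= f y <= 1) -> integrable_real nu f.
  move=> mf f01; apply: (bounded_integrable_real nu (K := 1) mf) => y.
  by have /andP[? ?] := f01 y; rewrite ger0_norm.
have Ea : Rintegral nu setT a = rho.
  transitivity (Rintegral nu setT (fun y => a y * \1_setT y)).
    by congr (Rintegral _ _ _); apply/funext => y; rewrite indicT mulr1.
  rewrite aB//; congr fine; rewrite -lam1//; congr (lam _).
  by apply/seteqP; split=> -[z y] //; case.
have Eas s : Rintegral nu setT (as_ s) = rho.
  rewrite -Ea; apply: (Rintegral_preserving (@measurable_shift_coords R S K s)
    (@shift_coords_preserving R S K s)).
    exact: bnd ma a01.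
  exact: bnd (mas s) (as01 s).
have aM f : integrable_real nu f -> integrable_real nu (fun y => a y * f y).
  move=> fi; apply: (integrable_realM (K := 1) ma) => // y.
  by have /andP[? ?] := a01 y; rewrite ger0_norm.
have Eash s : Rintegral nu setT (fun y => as_ s y * h y) =
    Rintegral nu setT (fun y => a y * h y).
  have e1 : (fun y => as_ s y * h y) = (fun y => a y * h y) \o shift_coords s.
    by apply/funext => y; rewrite /= (@symmetric_shift R S K h s hsym).
  rewrite e1; apply: (Rintegral_preserving (@measurable_shift_coords R S K s)
    (@shift_coords_preserving R S K s)); first exact: aM.
  rewrite -e1; apply: (integrable_realM (mas s) (K := 1)) => // y.
  by have /andP[? ?] := as01 s y; rewrite ger0_norm.
have Easat s t : Rintegral nu setT (fun y => as_ s y * as_ t y) <=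
    rho ^+ 2 + \sum_(u < n) \sum_(v < n) (tnth i u + s == tnth i v + t)%:R.
  have prod01 y : 0 <= as_ s y * as_ t y <= 1.
    have /andP[? ?] := as01 s y; have /andP[? ?] := as01 t y.
    by rewrite mulr_ge0//= mulr_ile1.
  have [/existsP[u /existsP[v uv]]|noE] :=
      boolP [exists u, exists v, tnth i u + s == tnth i v + t].
    apply: (@le_trans _ _ 1).
      rewrite -[leRHS](Rintegral_probability_cst nu 1).
      apply: le_Rintegral; [by []| |exact: integrable_real_cst|].
        by apply: bnd => //; exact: measurable_funM.
      by move=> y _; case/andP: (prod01 y).
    rewrite ler_wpDl ?sqr_ge0// (bigD1 u)//= (bigD1 v)//= uv.
    by rewrite -addrA lerDl addr_ge0// ?sumr_ge0// => x _; rewrite ?sumr_ge0.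
  rewrite ler_wpDr//; first by apply: sumr_ge0 => u _; apply: sumr_ge0.
  (* [as_ s] depends on the coordinates j + s with j in [i]; without a collision, none of them is a
     coordinate of [as_ t]. *)
  pose P : pred 'I_K.+1 := [pred j | (j - s) \in (i : seq 'I_K.+1)].
  have as_dep s' (P' : pred 'I_K.+1) : (forall j, j \in (i : seq 'I_K.+1) -> P' (j + s')) ->
      depends_on P' (as_ s').
    by move=> iP y y' yy'; apply: aP => j ij; exact/yy'/iP.
  have asP : depends_on P (as_ s) by apply: as_dep => j ij; rewrite /P /= addrK.
  have atP : depends_on (predC P) (as_ t).
    apply: as_dep => j ij; rewrite /P /=; apply: contra noE => ij'.
    have /tnthP[u uE] := ij'; have /tnthP[v vE] := ij.
    by apply/existsP; exists u; apply/existsP; exists v; rewrite -uE -vE subrK.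
  have /(congr1 fine) := @integral_independent _ _ R (fun _ : 'I_K.+1 => S)
    (fun _ => sys_prob S) P (as_ s) (as_ t) (mas s) (mas t)
    (fun y => proj1 (andP (as01 s y))) (fun y => proj1 (andP (as01 t y))) asP atP.
  rewrite fineM; last 2 first.
  - exact: (integral_fin_num nu (mas s) (as01 s) measurableT).
  - exact: (integral_fin_num nu (mas t) (as01 t) measurableT).
  move=> st; suff -> : Rintegral nu setT (fun y => as_ s y * as_ t y) = rho ^+ 2 by [].
  apply: (etrans st); rewrite expr2.
  by congr (_ * _); exact: Eas.
have sumE : \sum_s \sum_t Rintegral nu setT (fun y => as_ s y * as_ t y) <=
    K.+1%:R ^+ 2 * rho ^+ 2 + (n ^ 2)%:R * K.+1%:R.
  apply: (le_trans (ler_sum _ (fun s _ => ler_sum _ (fun t _ => Easat s t)))).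
  under eq_bigr do rewrite big_split/=.
  rewrite big_split/= lerD//.
    rewrite sumr_const card_ord sumr_const card_ord -mulrnA -[leLHS]mulr_natl.
    by rewrite natrM expr2.
  rewrite (eq_bigr (fun=> (n ^ 2)%:R)); first by rewrite sumr_const card_ord mulr_natr.
  move=> s _; rewrite exchange_big/= (eq_bigr (fun=> n%:R)).
    by rewrite sumr_const card_ord -[LHS]mulr_natl -natrM mulnn.
  move=> u _; rewrite exchange_big/= (eq_bigr (fun=> 1)).
    by rewrite sumr_const card_ord.
  move=> v _; rewrite (bigD1 (tnth i u + s - tnth i v))//= big1 ?addr0.
    by rewrite [tnth i v + _]addrC subrK eqxx.
  by move=> t /negbTE tE; rewrite [tnth i v + t]addrC -subr_eq eq_sym tE.
have a0 : as_ ord0 = a.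
  apply/funext => y; rewrite /as_; congr a.
  apply: functional_extensionality_dep => j; rewrite /shift_coords.
  by congr y; exact: addr0.
have ind01 y : 0 <= (\1_B y : R) <= 1 by rewrite indicE; case: (_ \in _); rewrite ?lexx ?ler01.
have Eah s t : Rintegral nu setT (fun y => as_ s y * h y) = Rintegral nu setT (fun y => as_ t y * h y).
  by rewrite !Eash.
have mI : measurable_fun [set: system_power S K.+1] (\1_B : _ -> R) by exact: measurable_indic.
have est := @averaging_estimate _ _ R nu K (n ^ 2)%:R rho delta as_ \1_B h mas as01 Eas
  sumE mI ind01 ih Eah Eqh e ord0 e0.
have EB : Rintegral nu setT \1_B = fine (nu B) by rewrite /Rintegral integral_indic// setIT.
rewrite a0 aB// EB in est; rewrite -lerBlDl.
exact: le_trans (ler_norm _) est.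
Qed.

(** * From L2 distance to L1 approximation *)

Section L2_norm.
Context {d} {X : measurableType d} {R : realType} (mu : probability X R).

Lemma indic_Lfun2 D : measurable D -> (\1_D : X -> R) \in Lfun mu 2%:E.
Proof.
move=> mD; rewrite inE; apply/andP; split; rewrite inE/=; first exact: measurable_indic.
rewrite /finite_norm unlock poweR_lty//.
rewrite (eq_integral (fun x => (\1_D x)%:E)).
  by rewrite integral_indic// setIT ltey_eq fin_num_measure.
by move=> x _ /=; rewrite indicE; case: (_ \in _); rewrite ?normr1 ?normr0 ?powR1 ?powR0.
Qed.

Lemma Lfun2B (f g : X -> R) : f \in Lfun mu 2%:E -> g \in Lfun mu 2%:E ->
  f \- g \in Lfun mu 2%:E.
Proof.
have p1 : (1 <= 2%:E :> \bar R)%E by rewrite lee1n.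
move=> f2 g2; have [_ addL] := Lfun_addr_closed mu p1.
have oppL := Lfun_oppr_closed (mu := mu) (p := 2%:E).
apply: (addL f (- g) f2); exact: oppL.
Qed.

(** [Rintegral_norm_le_sqr] with e = delta bounds the L1 norm by delta/2 + delta/2. *)
Lemma Lfun2_L1_le (v : X -> R) delta : 0 < delta -> v \in Lfun mu 2%:E ->
  ('N[mu]_2%:E[EFin \o v] < delta%:E)%E ->
  integrable_real mu v /\ Rintegral mu setT (fun x => `|v x|) <= delta.
Proof.
move=> d0 v2 vd; have iv : integrable_real mu v.
  by apply/Lfun1_integrable; apply: Lfun_subset12 v2; exact: fin_num_measure.
have iv2 := Lfun2_integrable_sqr v2; split => //.
have Ev2 : Rintegral mu setT (fun x => v x ^+ 2) <= delta ^+ 2.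
  rewrite -lee_fin /Rintegral fineK; last exact: integrable_fin_num.
  have := @poweR_Lnorm _ _ _ mu (EFin \o v) 2.
  rewrite (_ : \int[mu]_x `|(EFin \o v) x| `^ 2 = \int[mu]_x (v x ^+ 2)%:E)%E; last first.
    by apply: eq_integral => x _; rewrite /= powR_mulrn// real_normK ?num_real.
  move=> <- //; have := Lnorm_ge0 mu 2%:E (EFin \o v); move: vd.
  case: ('N[mu]_2%:E[EFin \o v])%E => // c; rewrite lte_fin !lee_fin => cd c0.
  suff : c `^ 2 <= delta ^+ 2 by [].
  by rewrite powR_mulrn// ler_pXn2r ?nnegrE// ltW.
apply: (le_trans (Rintegral_norm_le_sqr d0 iv iv2)).
have dE : delta / 2 + delta ^+ 2 / (2 * delta) = delta by field; rewrite gt_eqF.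
rewrite -[leRHS]dE.
by rewrite lerD2l ler_pM2r// invr_gt0 mulr_gt0.
Qed.

Lemma L2_dist_lt (f : X -> R) (G : set_system X) delta :
  f \in Lfun mu 2%:E -> G set0 -> G setT -> L2_dist mu f (L2_sub mu G) < delta ->
  exists2 h, L2_sub mu G h & ('N[mu]_2%:E[EFin \o (f \- h)%R] < delta%:E)%E.
Proof.
move=> f2 G0 GT; rewrite /L2_dist; set N := [set _ | _ in _] => Nd.
have N0 : L2_sub mu G (cst 0).
  split; first exact: Lfun_cst.
  by move=> _ [B mB <-]; rewrite setTI preimage_cst; case: ifP.
have fin : ('N[mu]_2%:E[EFin \o (f \- cst 0)%R] < +oo)%E.
  have -> : f \- cst 0 = f by apply/funext => x; rewrite /= subr0.
  by move: f2; rewrite inE => /andP[_]; rewrite inE.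
have inf0 : (0 <= ereal_inf N)%E.
  by apply/ereal_infP => _ [h _ <-]; exact: Lnorm_ge0.
have infoo : (ereal_inf N < +oo)%E.
  by apply: le_lt_trans fin; apply: ereal_inf_lbound; exists (cst 0).
have : (ereal_inf N < delta%:E)%E.
  by rewrite -(fineK (x := ereal_inf N)) ?lte_fin// ge0_fin_numE.
by move=> /ereal_inf_lt[_ [h Eh <-] hd]; exists h.
Qed.

End L2_norm.

(** * The inequality on rectangles and disjointness *)

Section disjointness.
Context {R : realType}.
Variables (n : nat) (T Z : system R).
Hypothesis autT : automorphism T.
Hypothesis hsym : forall g : T -> R, g \in Lfun (sys_prob T) 2%:E ->
  exists (k : nat -> nat) (S : nat -> system R)
         (p : forall j, system_power (S j) (k j) -> T),
    [/\ forall j, (0 < k j)%N,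
        k @ \oo --> \oo,
        forall j, automorphism (S j) /\ weakly_mixing (S j),
        forall j, factor_map (p j)
      & (fun j => L2_dist (sys_prob (system_power (S j) (k j)))
                    (g \o p j)
                    (L2_sub (sys_prob (system_power (S j) (k j)))
                            (@symmetric_factor R (S j) (k j))))
        =o_\oo (fun j => ((k j)%:R `^ (n%:R / 2))^-1)].
Hypothesis hZ : JP n Z.

Lemma exists_symmetric_approximation D (delta : R) (m : nat) :
  measurable D -> 0 < delta ->
  exists k S (p : system_power S k -> T) h,
    [/\ (m <= k)%N /\ (0 < k)%N, automorphism S /\ weakly_mixing S, factor_map p,
        preimage_set_system setT h measurable `<=` @symmetric_factor R S k &
        integrable_real (sys_prob (system_power S k)) h /\
        Rintegral (sys_prob (system_power S k)) setT
          (fun y => `|\1_(p @^-1` D) y - h y|) <= delta].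
Proof.
move=> mD d0; have [k [S [p [k0 koo hS hp /eqoP]]]] := hsym (indic_Lfun2 (sys_prob T) mD).
have d2 : 0 < delta / 2 by rewrite divr_gt0.
move=> /(_ _ d2) distk.
have km : \forall j \near \oo, (m <= k j)%N.
  by apply: (koo [set i | (m <= i)%N]); exact: nbhs_infty_ge.
have : \forall j \near \oo, (m <= k j)%N /\
    L2_dist (sys_prob (system_power (S j) (k j))) (\1_D \o p j)
      (L2_sub (sys_prob (system_power (S j) (k j)))
        (@symmetric_factor R (S j) (k j))) < delta.
  near=> j; split; first by near: j.
  apply: (le_lt_trans (ler_norm _)).
  have /le_lt_trans : `|L2_dist (sys_prob (system_power (S j) (k j))) (\1_D \o p j)
      (L2_sub (sys_prob (system_power (S j) (k j)))
        (@symmetric_factor R (S j) (k j)))| <= delta / 2 * `|((k j)%:R `^ (n%:R / 2))^-1|.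
    by near: j.
  (* Since k j >= 1, the comparison function is at most 1, so the distance is at most delta/2. *)
  apply; apply: (@le_lt_trans _ _ (delta / 2)); last by rewrite gtr_pMr// invf_lt1// ltr1n.
  apply: ler_piMr; [exact: ltW|rewrite ger0_norm ?invr_ge0 ?powR_ge0// invf_le1 ?powR_gt0 ?ltr0n//;
    rewrite -[leLHS](powRr0 (k j)%:R) ler_powR ?ler1n// divr_ge0//].
move=> [j0 _ /(_ j0 (leqnn j0))[mk distj]].
have [mp pE _] := hp j0.
have mpD := measurable_preimageT mp mD.
have q2 := indic_Lfun2 (sys_prob (system_power (S j0) (k j0))) mpD.
have [||h [h2 hG] hd] := L2_dist_lt q2 _ _ distj.
- by split => // s; rewrite preimage_set0.
- by split=> [|s]; [exact: measurableT|rewrite preimage_setT].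
exists (k j0), (S j0), (p j0), h; split => //.
have [iv vd] := Lfun2_L1_le d0 (Lfun2B q2 h2) hd.
split => //; apply/Lfun1_integrable; apply: Lfun_subset12 h2; exact: fin_num_measure.
Unshelve. all: by end_near. Qed.

Lemma joining_rectangle_le (lam : probability (T * Z)%type R) D A :
  joining lam -> measurable D -> measurable A ->
  fine (lam (D `*` A)) <= fine (sys_prob T D) * fine (sys_prob Z A).
Proof.
move=> lamJ mD mA; apply/ler_addgt0Pl => e e0.
have [autZ ergZ _] := hZ.
have [sbZ _ iZ] := autZ; have mZ := automorphism_measurable autZ.
have [_ iT muT] := autT.
have e4 : 0 < e / 4 by rewrite divr_gt0.
(* For k >= m the term n^2/(k e/4) is at most e/4; with delta = e/4 the three error terms add up to
   at most e. The other bound k >= n+1 is the one in JP(n). *)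
pose m := (Num.truncn ((n ^ 2)%:R / (e / 4 * (e / 4)))).+1.
have [k [S [p [h [[mk k0] hS hp hG [ih hd]]]]]] :=
  exists_symmetric_approximation (maxn m n.+1) mD e4.
pose W := system_power S k.
have mS : forall i : 'I_k, measurable_fun setT (@sys_map R S).
  by move=> _; exact: automorphism_measurable hS.1.
have mW : measurable_fun setT (@sys_map R W) by exact: measurable_prod_map mS.
have iW : invariant_measure (sys_prob W) (@sys_map R W).
  by apply: invariant_prod mS _ => _; have [[]] := hS.
have ergW : ergodic (sys_prob W) (@sys_map R W) by apply: ergodic_prod => _; exact: hS.
have cgW : countably_generated W.
  apply: countably_generated_prodspace => _.
  by apply: (@standard_borel_countably_generated R); have [[]] := hS.
have [mp pE _] := hp; have mpD := measurable_preimageT mp mD.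
have [b [bI bE]] := exists_relative_product lamJ hp iT muT mZ mW iW.
(* [lam'] need not extend [lam]: it only charges the product of A and the preimage of D at least as
   much. *)
have [lam' lamJ' le_lam] := exists_ergodic_joining_ge mZ mW iZ iW ergZ ergW sbZ cgW bI mA mpD.
rewrite -bE//; apply: (le_trans le_lam).
have nk : (n < k)%N by rewrite (leq_trans _ mk)// leq_maxr.
apply: (le_trans (JP_estimate hZ hS nk lamJ' mA mpD ih hG hd e4)).
rewrite pE// (mulrC (fine (sys_prob T D))) [leLHS]addrC lerD2r.
have kR : (0 : R) < k%:R by rewrite ltr0n.
have : (n ^ 2)%:R / (k%:R * (e / 4)) <= e / 4 :> R.
  rewrite ler_pdivrMr ?mulr_gt0// mulrCA -ler_pdivrMr ?mulr_gt0//.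
  by rewrite (le_trans (ltW (truncnS_gt _)))// ler_nat (leq_trans _ mk)// leq_maxl.
by move: ((n ^ 2)%:R / (k%:R * (e / 4))) => x; lra.
Qed.

End disjointness.

Theorem proposition6p3 (R : realType) (n : nat) (hn : (1 <= n)%N)
    (T : system R) (hT : automorphism T)
    (hsym : forall g : T -> R, g \in Lfun (sys_prob T) 2%:E ->
      exists (k : nat -> nat) (S : nat -> system R)
             (p : forall j, system_power (S j) (k j) -> T),
        [/\ forall j, (0 < k j)%N,
            k @ \oo --> \oo,
            forall j, automorphism (S j) /\ weakly_mixing (S j),
            forall j, factor_map (p j)
          & (fun j => L2_dist (sys_prob (system_power (S j) (k j)))
                        (g \o p j)
                        (L2_sub (sys_prob (system_power (S j) (k j)))
                                (@symmetric_factor R (S j) (k j))))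
            =o_\oo (fun j => ((k j)%:R `^ (n%:R / 2))^-1)])
    (Z : system R) (hZ : JP n Z) :
  disjoint_systems T Z.
Proof.
(* Disjointness is stated as an equivalence, so the product measure must also be shown to be a
   joining. *)
move=> lam; split=> [lamJ|lamE]; last first.
  split.
  - move=> A mA; rewrite lamE; last exact: (measurable_preimageT measurable_fst).
    rewrite (_ : fst @^-1` A = A `*` setT); last by apply/seteqP; split=> -[x z] //; case.
    rewrite product_measure1E// -[RHS]mule1; congr (_ * _)%E.
    exact: probability_setT.
  - move=> B mB; rewrite lamE; last exact: (measurable_preimageT measurable_snd).
    rewrite (_ : snd @^-1` B = setT `*` B); last by apply/seteqP; split=> -[x z] //; case.
    rewrite product_measure1E// -[RHS]mul1e; congr (_ * _)%E.
    exact: probability_setT.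
  have [autZ _ _] := hZ.
  have mT := automorphism_measurable hT; have mZ := automorphism_measurable autZ.
  move=> C mC; rewrite !lamE//; last exact: measurable_preimageT (measurable_pair_map mT mZ) mC.
  have [_ _ iT] := hT; have [_ _ iZ] := autZ.
  exact: invariant_pair.
pose mu := sys_prob T; pose rho := sys_prob Z.
move=> C mC.
apply: (probability_unique_prod (Q := (mu \x rho)%E : probability _ R)) mC => D A mD mA.
have le A' : measurable A' -> fine (lam (D `*` A')) <= fine (mu D) * fine (rho A').
  by move=> mA'; exact: joining_rectangle_le hT hsym hZ _ _ _ lamJ mD mA'.
have mAC : measurable (~` A) by exact: measurableC.
have mDA := measurableX mD mA; have mDAC := measurableX mD mAC.
have [lam1 _ _] := lamJ.
have sumE : fine (lam (D `*` A)) + fine (lam (D `*` ~` A)) = fine (mu D).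
  rewrite -fineD ?fin_num_measure// -measureU//.
    rewrite -lam1//; congr (fine (lam _)); apply/seteqP; split=> -[x z] /=.
      by move=> [] [].
    by move=> Dx; have [Az|Az] := pselect (A z); [left|right].
  by rewrite -setXI setICr setX0.
have rhoC : fine (rho (~` A)) = 1 - fine (rho A).
  by rewrite probability_setC// fineB ?fin_num_measure.
have eqE : fine (lam (D `*` A)) = fine (mu D) * fine (rho A).
  apply/le_anti; rewrite le//=; have := le _ mAC; rewrite rhoC mulrBr mulr1 -sumE.
  by lra.
rewrite [RHS](product_measure1E mu rho mD mA).
by rewrite -[LHS]fineK ?fin_num_measure// eqE EFinM !fineK ?fin_num_measure.
Qed.
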